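(* Let $E=A\#_fH$ be a crossed product and $M$ an $E$-bimodule. Let $\widehat X^n=\bigoplus_{r+s=n}\mathrm{Hom}_k(\overline H^s\otimes\overline A^r,M)$ and $\widehat d^{\,n}=\sum_{r+s=n}\ \sum_{0\le l\le s,\ r+l>0}\widehat d^{\,rs}_l$, with $\widehat d^{\,rs}_l:\mathrm{Hom}_k(\overline H^{s-l}\otimes\overline A^{r+l-1},M)\to\mathrm{Hom}_k(\overline H^s\otimes\overline A^r,M)$ as defined in the context. Then the Hochschild cohomology of $E$ with coefficients in $M$ is the homology of the cochain complex $$\widehat X^*(E,M)=\quad\widehat X^0\xrightarrow{\widehat d^{\,1}}\widehat X^1\xrightarrow{\widehat d^{\,2}}\widehat X^2\xrightarrow{\widehat d^{\,3}}\cdots.$$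
   Context: $k$ is a commutative ring with unit, $\otimes=\otimes_k$, $H$ is a Hopf algebra with counit $\epsilon$ and Sweedler notation $\Delta(h)=h^{(1)}\otimes h^{(2)}$ (sum understood), $A$ is a $k$-algebra. A weak action of $H$ on $A$ is a bilinear map $(h,a)\mapsto a^h$, $H\times A\to A$, with $(ab)^h=a^{h^{(1)}}b^{h^{(2)}}$, $1^h=\epsilon(h)1$, $a^1=a$. Given a weak action and a $k$-linear map $f:H\otimes H\to A$, $A\#_fH$ is $A\otimes H$ (elements written $a\#h$) with product $(a\#h)(b\#l)=ab^{h^{(1)}}f(h^{(2)},l^{(1)})\#h^{(3)}l^{(2)}$; it is called a crossed product if it is associative with unit $1\#1$, equivalently: $f(h,1)=f(1,h)=\epsilon(h)1_A$; $f(l^{(1)},m^{(1)})^{h^{(1)}}f(h^{(2)},l^{(2)}m^{(2)})=f(h^{(1)},l^{(1)})f(h^{(2)}l^{(2)},m)$; and $(a^{l^{(1)}})^{h^{(1)}}f(h^{(2)},l^{(2)})=f(h^{(1)},l^{(1)})a^{h^{(2)}l^{(2)}}$ for all $h,l,m\in H$, $a\in A$. $A$ is regarded as the subalgebra $A\#1$ of $E$. Notation: $\overline B=B/k$ (classes denoted by the same letter), $\overline B^l$ its $l$-fold tensor power. $\mathbf h_{ij}=h_i\otimes\cdots\otimes h_j$, $\mathfrak h_{ij}=h_i\cdots h_j\in H$, $\mathbf a_{ij}=a_i\otimes\cdots\otimes a_j$ (empty tensors are $1_k$). For $\mathbf h=h_i\otimes\cdots\otimes h_j$: $\mathbf h^{(1)}\otimes\mathbf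 h^{(2)}=(h_i^{(1)}\otimes\cdots\otimes h_j^{(1)})\otimes(h_i^{(2)}\otimes\cdots\otimes h_j^{(2)})$; $a^{\overline{\mathbf h}}=(\cdots((a^{h_j})^{h_{j-1}})\cdots)^{h_i}$ for $a\in A$; and for $\mathbf a=a_1\otimes\cdots\otimes a_r$, $\mathbf a^{\overline{\mathbf h}}=a_1^{\overline{\mathbf h^{(1)}}}\otimes\cdots\otimes a_r^{\overline{\mathbf h^{(r)}}}$; for a single $h\in H$, $\mathbf a^h=a_1^{h^{(1)}}\otimes\cdots\otimes a_r^{h^{(r)}}$. The maps $F^{(l)}_r$ ($l\ge2$, $r\ge0$), $F^{(l)}_r:\overline H^l\otimes\overline A^r\to\overline A^{r+l-1}$. For $r=0$: $F^{(2)}_0(h_1\otimes h_2)=-f(h_1,h_2)$ and $F^{(l+1)}_0(\mathbf h)=\sum_{j=1}^l(-1)^jf(h_j^{(1)},h_{j+1}^{(1)})^{\overline{\mathbf h_{1,j-1}^{(1)}}}\otimes F^{(l)}_0(\mathbf h_{1,j-1}^{(2)}\otimes h_j^{(2)}h_{j+1}^{(2)}\otimes\mathbf h_{j+2,l+1})$. For $r\ge1$: $F^{(2)}_r(\mathbf h\otimes\mathbf a)=\sum_{i=0}^r(-1)^{i+1}\mathbf a_{1i}^{\overline{\mathbf h_{12}^{(1)}}}\otimes f(h_1^{(2)},h_2^{(2)})\otimes\mathbf a_{i+1,r}^{\mathfrak h_{12}^{(3)}}$ and $F^{(l+1)}_r(\mathbf h\otimes\mathbf a)=\sum_{j=1}^l\sum_{i=0}^r(-1)^{il+j}\mathbf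 a_{1i}^{\overline{\mathbf h_{1,l+1}^{(1)}}}\otimes f(h_j^{(2)},h_{j+1}^{(2)})^{\overline{\mathbf h_{1,j-1}^{(2)}}}\otimes F^{(l)}_{r-i}\big((\mathbf h_{1,j-1}^{(3)}\otimes h_j^{(3)}h_{j+1}^{(3)}\otimes\mathbf h_{j+2,l+1}^{(2)})\otimes\mathbf a_{i+1,r}\big)$. The maps $\widehat d^{\,rs}_l$ ($0\le l\le s$, $r+l>0$): for $\mathbf x=\mathbf h\otimes\mathbf a$, $\mathbf h=h_1\otimes\cdots\otimes h_s$, $\mathbf a=a_1\otimes\cdots\otimes a_r$, $\widehat d^{\,rs}_0(\varphi)(\mathbf x)=a_1^{\overline{\mathbf h^{(1)}}}\varphi(\mathbf h^{(2)}\otimes\mathbf a_{2r})+(-1)^r\varphi(\mathbf h\otimes\mathbf a_{1,r-1})a_r+\sum_{i=1}^{r-1}(-1)^i\varphi(\mathbf h\otimes\mathbf a_{1,i-1}\otimes a_ia_{i+1}\otimes\mathbf a_{i+2,r})$; $\widehat d^{\,rs}_1(\varphi)(\mathbf x)=(-1)^r(1\#h_1)\varphi(\mathbf h_{2s}\otimes\mathbf a)+(-1)^{r+s}\varphi(\mathbf h_{1,s-1}\otimes\mathbf a^{h_s^{(1)}})(1\#h_s^{(2)})+\sum_{i=1}^{s-1}(-1)^{r+i}f(h_i^{(1)},h_{i+1}^{(1)})^{\overline{\mathbf h_{1,i-1}^{(1)}}}\varphi(\mathbf h_{1,i-1}^{(2)}\otimes h_i^{(2)}h_{i+1}^{(2)}\otimes\mathbf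 h_{i+2,s}\otimes\mathbf a)$; for $l\ge2$: $\widehat d^{\,rs}_l(\varphi)(\mathbf x)=(-1)^{l(r+s)}\varphi\big(\mathbf h_{1,s-l}\otimes F^{(l)}_r(\mathbf h_{s-l+1,s}^{(1)}\otimes\mathbf a)\big)(1\#\mathfrak h_{s-l+1,s}^{(2)})$. Hochschild cohomology $H^*(E,M)$ is the cohomology of the (normalized) Hochschild complex $(\mathrm{Hom}_k(\overline E^*,M),b^* )$. *)

(* Defs.v *)
From HB Require Import structures.
From mathcomp Require Import all_boot all_algebra boolp.
From mathcomp.multinomials Require Import freeg.
From mathcomp Require Import zify.

Set Implicit Arguments.
Unset Strict Implicit.
Unset Printing Implicit Defensive.

Import GRing.Theory.
Local Open Scope ring_scope.

Record submodule (k : comNzRingType) (V : lmodType k) := Submodule {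
  in_submodule :> V -> Prop;
  submodule0 : in_submodule 0;
  submoduleP : forall (c : k) x y,
    in_submodule x -> in_submodule y -> in_submodule (c *: x + y) }.

Section QuotientModule.
Variables (k : comNzRingType) (V : lmodType k) (S : submodule V).

Definition submodule_pred : pred V := fun x => `[< S x >].

Fact submodule_pred_closed : GRing.subsemimod_closed submodule_pred.
Proof.
split=> [|c x /asboolP Sx]; last first.
  by apply/asboolP; rewrite -[_ *: _]addr0; apply: submoduleP => //; apply: submodule0.
split=> [|x y /asboolP Sx /asboolP Sy]; first by apply/asboolP; apply: submodule0.
by apply/asboolP; rewrite -[x]scale1r; apply: submoduleP.
Qed.

Import Quotient.
Local Open Scope quotient_scope.

Definition submodule_zmod : zmodClosed V :=
  HB.pack submodule_pred (GRing.isZmodClosed.Build V submodule_pred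
    (GRing.subsemimod_closedB submodule_pred_closed)).

Definition quotmod := @Quotient.quot V submodule_zmod.
HB.instance Definition _ := GRing.Zmodule.on quotmod.
Notation Q := quotmod.

Definition quot_class (v : V) : Q := \pi_Q v.

Lemma quot_reprK (x : Q) : quot_class (repr x) = x.
Proof. exact: reprK. Qed.

Fact quot_classD u v : quot_class (u + v) = quot_class u + quot_class v.
Proof. exact: (raddfD (\pi_Q)). Qed.

Definition quot_scale (c : k) (x : Q) : Q := quot_class (c *: repr x).

Lemma quot_scaleE c v : quot_scale c (quot_class v) = quot_class (c *: v).
Proof.
apply/eqP; rewrite /quot_scale /quot_class -idealrBE -scalerBr.
apply: submodule_pred_closed.2.
by rewrite -[_ \in _]/(_ \in submodule_zmod) idealrBE reprK.
Qed.

Fact quot_scaleA a b x : quot_scale a (quot_scale b x) = quot_scale (a * b) x.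
Proof.
by rewrite -[x]quot_reprK (quot_scaleE b) (quot_scaleE a) (quot_scaleE (_ * _)) scalerA.
Qed.

Fact quot_scale1 : left_id 1 quot_scale.
Proof. by move=> x; rewrite -[x in LHS]quot_reprK (quot_scaleE 1) scale1r quot_reprK. Qed.

Fact quot_scaleDr : right_distributive quot_scale +%R.
Proof.
move=> a x y; rewrite -[x]quot_reprK -[y]quot_reprK -quot_classD.
by rewrite !(quot_scaleE a) scalerDr quot_classD.
Qed.

Fact quot_scaleDl x : {morph quot_scale^~ x : a b / a + b}.
Proof.
move=> a b; rewrite -[x]quot_reprK (quot_scaleE (a + b)) (quot_scaleE a) (quot_scaleE b).
by rewrite scalerDl quot_classD.
Qed.

HB.instance Definition _ := GRing.Zmodule_isLmodule.Build k Q
  quot_scaleA quot_scale1 quot_scaleDr quot_scaleDl.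

Fact quot_class_linear : linear quot_class.
Proof. by move=> c u v; rewrite quot_classD -quot_scaleE. Qed.

HB.instance Definition _ := GRing.isLinear.Build k V Q *:%R quot_class
  quot_class_linear.

Lemma quot_classP u v : quot_class u = quot_class v <-> S (u - v).
Proof.
rewrite (rwP eqP) (rwP (asboolP (S _))) -[`[< _ >]]/(u - v \in submodule_zmod).
by rewrite /quot_class idealrBE.
Qed.

End QuotientModule.

Section HomModule.
Variables (k : comNzRingType) (U V : lmodType k).
Notation hom := {linear U -> V}.

HB.instance Definition _ := gen_eqMixin hom.
HB.instance Definition _ := gen_choiceMixin hom.

Lemma hom_ext (f g : hom) : f =1 g -> f = g.
Proof.
move=> /funext; case: f g => f cf [g cg] /= fg; case: _ / fg in cg *.
case: cf cg => [[f1] [f2]] [[g1] [g2]].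
by rewrite (Prop_irrelevance f1 g1) (Prop_irrelevance f2 g2).
Qed.

Definition hom_zero : hom := \0.
Definition hom_opp (f : hom) : hom := \- f.
Definition hom_add (f g : hom) : hom := f \+ g.
Definition hom_scale (c : k) (f : hom) : hom := c \*: f.

Fact hom_addA : associative hom_add.
Proof. by move=> f g h; apply: hom_ext => x /=; rewrite addrA. Qed.
Fact hom_addC : commutative hom_add.
Proof. by move=> f g; apply: hom_ext => x /=; rewrite addrC. Qed.
Fact hom_add0 : left_id hom_zero hom_add.
Proof. by move=> f; apply: hom_ext => x /=; rewrite add0r. Qed.
Fact hom_addN : left_inverse hom_zero hom_opp hom_add.
Proof. by move=> f; apply: hom_ext => x /=; rewrite addNr. Qed.

HB.instance Definition _ :=
  GRing.isZmodule.Build hom hom_addA hom_addC hom_add0 hom_addN.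

Fact hom_scaleA a b f : hom_scale a (hom_scale b f) = hom_scale (a * b) f.
Proof. by apply: hom_ext => x /=; rewrite scalerA. Qed.
Fact hom_scale1 : left_id 1 hom_scale.
Proof. by move=> f; apply: hom_ext => x /=; rewrite scale1r. Qed.
Fact hom_scaleDr : right_distributive hom_scale +%R.
Proof. by move=> a f g; apply: hom_ext => x /=; rewrite scalerDr. Qed.
Fact hom_scaleDl f : {morph hom_scale^~ f : a b / a + b}.
Proof. by move=> a b; apply: hom_ext => x /=; rewrite scalerDl. Qed.

HB.instance Definition _ := GRing.Zmodule_isLmodule.Build k hom
  hom_scaleA hom_scale1 hom_scaleDr hom_scaleDl.

Lemma hom_addE (f g : hom) x : (f + g) x = f x + g x. Proof. by []. Qed.
Lemma hom_scaleE c (f : hom) x : (c *: f) x = c *: f x. Proof. by []. Qed.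

Lemma hom_of (f : U -> V) : linear f -> exists g : hom, g =1 f.
Proof.
move=> lf; pose m := GRing.isLinear.Build k U V *:%R f lf.
by pose g : hom := HB.pack f m; exists g.
Qed.

End HomModule.

Section Tensor.
Variables (k : comNzRingType) (U V : lmodType k).
Notation free := {freeg (U * V)%type / k}.
Notation gen u v := (Freeg [:: (1 : k, (u, v))] : free).

Inductive tensor_rel : free -> Prop :=
| TRel0 : tensor_rel 0
| TRelP c x y : tensor_rel x -> tensor_rel y -> tensor_rel (c *: x + y)
| TRelL c u u' v : tensor_rel (gen (c *: u + u') v - (c *: gen u v + gen u' v))
| TRelR c u v v' : tensor_rel (gen u (c *: v + v') - (c *: gen u v + gen u v')).

Definition tensor_submodule : submodule free := Submodule TRel0 TRelP.

Definition tensor := quotmod tensor_submodule.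
HB.instance Definition _ := GRing.Lmodule.on tensor.

Definition tprod (u : U) (v : V) : tensor := quot_class tensor_submodule (gen u v).

Lemma tprodPl v : linear (tprod^~ v).
Proof.
move=> c u u'; rewrite /tprod -linearP; apply/quot_classP/TRelL.
Qed.

Lemma tprodPr u : linear (tprod u).
Proof.
move=> c v v'; rewrite /tprod -linearP; apply/quot_classP/TRelR.
Qed.

Lemma tensor_span (P : tensor -> Prop) :
    P 0 -> (forall c u v t, P t -> P (c *: tprod u v + t)) -> forall t, P t.
Proof.
move=> P0 PD t; rewrite -[t]quot_reprK -[repr t]freeg_sumE.
elim: (dom _) => [|[u v] s IH]; first by rewrite big_nil raddf0.
rewrite big_cons raddfD /=.
set c := coeff _ _.
have -> : Freeg [:: (c, (u, v))] = c *: gen u v.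
  by apply/eqP/freeg_eqP => z; rewrite coeffZ !coeffU mul1r.
by rewrite linearZ; apply: PD.
Qed.

Variable W : lmodType k.

Definition bilin (beta : U -> V -> W) :=
  (forall v, linear (beta^~ v)) /\ (forall u, linear (beta u)).

(* [tsum beta t] is the sum of the [beta u v] over a representation of [t] as
   a sum of pure tensors [u (x) v], i.e. [beta] extended linearly to [t];
   it is independent of the representation as soon as [beta] is bilinear. *)
Definition tsum (beta : U -> V -> W) (t : tensor) : W :=
  fglift (fun p => beta p.1 p.2) (repr t).

Fact fglift_linear (f : (U * V)%type -> W) : linear (fglift f : free -> W).
Proof.
have B := @lift_is_additive _ _ _ f.
have f0 : fglift f 0 = 0 by have := B 0 0; rewrite !subrr.
have D y z : fglift f (y + z) = fglift f y + fglift f z.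
  by have := B y (0 - z); rewrite (B 0 z) f0 !sub0r !opprK.
have fZ c (x : free) : fglift f (c *: x) = c *: fglift f x.
  rewrite -[c *: x]/(fgscale c x) /fgscale -{3}[x]freeg_sumE.
  elim: (dom x) => [|z s IH]; first by rewrite !big_nil f0 scaler0.
  by rewrite !big_cons !D IH !liftU scalerDr scalerA.
by move=> c x y; rewrite D fZ.
Qed.

Fact tensor_rel_lift beta x y : bilin beta -> tensor_rel (x - y) ->
  fglift (fun p => beta p.1 p.2) x = fglift (fun p => beta p.1 p.2) y.
Proof.
move=> [bl br] /[dup] _; set g := fglift (fun p => beta p.1 p.2).
have gl : linear (g : free -> W) by apply: fglift_linear.
have g0 : g 0 = 0.
  by have := gl (-1) 0 0; rewrite scaler0 addr0 scaleN1r addNr.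
have gB z t : g (z - t) = g z - g t.
  by have := gl (-1) t z; rewrite !scaleN1r [z - t]addrC => ->; rewrite addrC.
have R0 z : tensor_rel z -> g z = 0.
  elim=> // [c z1 z2 _ IHy _ IHz|c u u' v|c u v v'].
  - by rewrite gl IHy IHz scaler0 addr0.
  - by rewrite gB gl /g !liftU /= !scale1r bl subrr.
  - by rewrite gB gl /g !liftU /= !scale1r br subrr.
by move=> /R0; rewrite gB => /eqP; rewrite subr_eq0 => /eqP.
Qed.

Lemma tsum_linear beta : bilin beta -> linear (tsum beta).
Proof.
move=> bb c x y; rewrite /tsum -fglift_linear; apply: (tensor_rel_lift bb).
apply/(@quot_classP _ _ tensor_submodule).
by rewrite linearP /= !quot_reprK.
Qed.

Lemma tsumE beta u v : bilin beta -> tsum beta (tprod u v) = beta u v.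
Proof.
move=> bb; rewrite -[beta u v]scale1r -(liftU (fun p => beta p.1 p.2) 1 (u, v)).
apply: (tensor_rel_lift bb).
by apply/(@quot_classP _ _ tensor_submodule); rewrite quot_reprK.
Qed.

Lemma tsum_param (P : lmodType k) (beta : P -> U -> V -> W) t :
  (forall u v, linear (fun p => beta p u v)) ->
  linear (fun p => tsum (beta p) t).
Proof.
move=> bl c p q; rewrite /tsum -[repr t]Freeg_dom !fglift_Freeg /prelift !big_map /=.
rewrite scaler_sumr -big_split /=; apply: eq_bigr => -[u v] _ /=.
by rewrite bl scalerDr !scalerA mulrC.
Qed.

End Tensor.

Section TensorPower.
Variables (k : comNzRingType) (V : lmodType k).

Fixpoint tpow (n : nat) : lmodType k :=
  if n is m.+1 then tensor V (tpow m) else k^o.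

(* [tpure n [:: v1; ...; vn]] is [v1 (x) ... (x) vn]; it is [0] when the list
   does not have length [n]. *)
Fixpoint tpure (n : nat) (s : seq V) : tpow n :=
  match n, s with
  | 0, [::] => (1 : k^o)
  | m.+1, v :: s' => tprod v (tpure m s')
  | _, _ => 0
  end.

Fixpoint tcat (m n : nat) : tpow m -> tpow n -> tpow (m + n) :=
  match m with
  | 0 => fun (c : k^o) y => (c : k) *: y
  | m'.+1 => fun x y => tsum (fun v t => tprod v (@tcat m' n t y)) x
  end.

(* Transport along [m = n]; the value is [0] when [m <> n]. *)
Definition tpow_cast (m n : nat) (x : tpow m) : tpow n :=
  if m =P n is ReflectT e then ecast i (tpow i) e x else 0.

End TensorPower.

HB.mixin Record isHopfAlgebra (k : comNzRingType) H of GRing.Algebra k H := {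
  coprod : H -> tensor H H;
  counit : H -> k;
  antipode : H -> H;
  coprod_linear : linear coprod;
  counit_linear : scalar counit;
  antipode_linear : linear antipode;
  coprodA : forall h,
    tsum (fun x z => tsum (fun x1 x2 => tprod x1 (tprod x2 z)) (coprod x))
      (coprod h) =
    tsum (fun x z => tsum (fun z1 z2 => tprod x (tprod z1 z2)) (coprod z))
      (coprod h);
  counit_coprodl : forall h, tsum (fun x y => counit x *: y) (coprod h) = h;
  counit_coprodr : forall h, tsum (fun x y => counit y *: x) (coprod h) = h;
  coprod1 : coprod 1 = tprod 1 1;
  coprodM : forall h l, coprod (h * l) =
    tsum (fun h1 h2 => tsum (fun l1 l2 => tprod (h1 * l1) (h2 * l2)) (coprod l))
      (coprod h);
  counit1 : counit 1 = 1;
  counitM : forall h l, counit (h * l) = counit h * counit l;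
  antipodel : forall h,
    tsum (fun x y => antipode x * y) (coprod h) = counit h *: 1;
  antipoder : forall h,
    tsum (fun x y => x * antipode y) (coprod h) = counit h *: 1 }.

#[short(type="hopfAlgType")]
HB.structure Definition HopfAlgebra (k : comNzRingType) :=
  {H of GRing.Algebra k H & isHopfAlgebra k H}.

Section Sweedler.
Variables (k : comNzRingType) (H : hopfAlgType k) (W : lmodType k).

(* [sw2 h (fun h1 h2 => e)] is the Sweedler expression [e] in
   [h^(1) (x) h^(2)], and [sw3] its iteration; [lsw2] and [lsw3] apply them
   simultaneously to all entries of a list. *)
Definition sw2 (h : H) (e : H -> H -> W) : W := tsum e (coprod h).

Definition sw3 (h : H) (e : H -> H -> H -> W) : W :=
  sw2 h (fun h1 h' => tsum (fun h2 h3 => e h1 h2 h3) (coprod h')).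

Fixpoint lsw2 (hs : seq H) (e : seq H -> seq H -> W) : W :=
  match hs with
  | [::] => e [::] [::]
  | h :: hs' => sw2 h (fun h1 h2 => lsw2 hs' (fun s1 s2 => e (h1 :: s1) (h2 :: s2)))
  end.

Fixpoint lsw3 (hs : seq H) (e : seq H -> seq H -> seq H -> W) : W :=
  match hs with
  | [::] => e [::] [::] [::]
  | h :: hs' => sw3 h (fun h1 h2 h3 =>
      lsw3 hs' (fun s1 s2 s3 => e (h1 :: s1) (h2 :: s2) (h3 :: s3)))
  end.

Lemma sw2_linear e : bilin e -> linear (sw2^~ e).
Proof. by move=> be c x y; rewrite /sw2 coprod_linear tsum_linear. Qed.

Lemma sw2_param (P : lmodType k) (e : P -> H -> H -> W) h :
  (forall x y, linear (fun p => e p x y)) -> linear (fun p => sw2 h (e p)).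
Proof. exact: tsum_param. Qed.

Lemma sw3_linear e : (forall y z, linear (fun x => e x y z)) ->
  (forall x z, linear (fun y => e x y z)) -> (forall x y, linear (e x y)) ->
  linear (sw3^~ e).
Proof.
move=> e1 e2 e3; apply: sw2_linear; split=> [v|u].
  by apply: tsum_param => x y; apply: e1.
move=> c x y; rewrite coprod_linear.
by apply: tsum_linear; split=> [v|w]; [apply: e2 | apply: e3].
Qed.

Lemma sw3_param (P : lmodType k) (e : P -> H -> H -> H -> W) h :
  (forall x y z, linear (fun p => e p x y z)) -> linear (fun p => sw3 h (e p)).
Proof.
by move=> el; apply: sw2_param => x y; apply: tsum_param => u v; apply: el.
Qed.

End Sweedler.

Record weak_action (k : comNzRingType) (H : hopfAlgType k) (A : algType k) :=
  WeakAction {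
    wact :> H -> A -> A;
    wact_bilin : bilin wact;
    wactM : forall h a b, wact h (a * b) = sw2 h (fun x y => wact x a * wact y b);
    wact1r : forall h, wact h 1 = counit h *: 1;
    wact1l : forall a, wact 1 a = a }.

Section CrossedProduct.
Variables (k : comNzRingType) (H : hopfAlgType k) (A : algType k).
Variables (w : weak_action H A) (f : {linear tensor H H -> A}).
Notation E := (tensor A H).

Definition crossed_mul (x y : E) : E :=
  tsum (fun a h => tsum (fun b l =>
    sw3 h (fun h1 h2 h3 => sw2 l (fun l1 l2 =>
      tprod (a * w h1 b * f (tprod h2 l1)) (h3 * l2)))) y) x.

Definition is_crossed_product :=
  [/\ associative crossed_mul, left_id (tprod 1 1) crossed_mul
    & right_id (tprod 1 1) crossed_mul].

Let term a b h1 h2 h3 l1 l2 : E :=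
  tprod (a * w h1 b * f (tprod h2 l1)) (h3 * l2).

Fact term_a b h1 h2 h3 l1 l2 : linear (fun a => term a b h1 h2 h3 l1 l2).
Proof. by move=> c u v; rewrite /term !mulrDl -!scalerAl tprodPl. Qed.
Fact term_b a h1 h2 h3 l1 l2 : linear (fun b => term a b h1 h2 h3 l1 l2).
Proof.
by move=> c u v; rewrite /term (wact_bilin w).2 mulrDr mulrDl -scalerAr -scalerAl tprodPl.
Qed.
Fact term_h1 a b h2 h3 l1 l2 : linear (fun h1 => term a b h1 h2 h3 l1 l2).
Proof.
by move=> c u v; rewrite /term (wact_bilin w).1 mulrDr mulrDl -scalerAr -scalerAl tprodPl.
Qed.
Fact term_h2 a b h1 h3 l1 l2 : linear (fun h2 => term a b h1 h2 h3 l1 l2).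
Proof. by move=> c u v; rewrite /term tprodPl linearP mulrDr -scalerAr tprodPl. Qed.
Fact term_h3 a b h1 h2 l1 l2 : linear (fun h3 => term a b h1 h2 h3 l1 l2).
Proof. by move=> c u v; rewrite /term mulrDl -scalerAl tprodPr. Qed.
Fact term_l1 a b h1 h2 h3 l2 : linear (fun l1 => term a b h1 h2 h3 l1 l2).
Proof. by move=> c u v; rewrite /term tprodPr linearP mulrDr -scalerAr tprodPl. Qed.
Fact term_l2 a b h1 h2 h3 l1 : linear (fun l2 => term a b h1 h2 h3 l1 l2).
Proof. by move=> c u v; rewrite /term mulrDr -scalerAr tprodPr. Qed.

Lemma crossed_mul_bilin : bilin crossed_mul.
Proof.
have linb a h l : linear (fun b => sw3 h (fun h1 h2 h3 =>
    sw2 l (fun l1 l2 => term a b h1 h2 h3 l1 l2))).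
  by apply: sw3_param => h1 h2 h3; apply: sw2_param => l1 l2; apply: term_b.
have linl a h b : linear (fun l => sw3 h (fun h1 h2 h3 =>
    sw2 l (fun l1 l2 => term a b h1 h2 h3 l1 l2))).
  apply: sw3_param => h1 h2 h3; apply: sw2_linear.
  by split=> [l2|l1]; [apply: term_l1 | apply: term_l2].
split=> [y|x].
  apply: tsum_linear; split=> [h|a]; apply: tsum_param => b l.
    by apply: sw3_param => h1 h2 h3; apply: sw2_param => l1 l2; apply: term_a.
  apply: sw3_linear => *; apply: sw2_param => l1 l2.
  - exact: term_h1.
  - exact: term_h2.
  - exact: term_h3.
apply: (@tsum_param _ _ _ _ _ (fun y a h => tsum (fun b l =>
  sw3 h (fun h1 h2 h3 => sw2 l (fun l1 l2 => term a b h1 h2 h3 l1 l2))) y)) => a h.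
by apply: tsum_linear; split=> *.
Qed.

Lemma tprod11_neq0 : tprod 1 1 != 0 :> E.
Proof.
pose e (a : A) (h : H) : A := counit h *: a.
have be : bilin e.
  split=> [h|a] c u v; rewrite /e ?counit_linear.
    by rewrite scalerDr !scalerA mulrC.
  by rewrite scalerDl scalerA.
apply/eqP => /(congr1 (tsum e)); rewrite tsumE // /e counit1 scale1r.
have := tsum_linear be (-1) 0 0; rewrite scaler0 addr0 scaleN1r addNr => -> /eqP.
by rewrite oner_eq0.
Qed.

Hypothesis hE : is_crossed_product.

Definition crossed_product : Type := let _ := hE in E.

HB.instance Definition _ := GRing.Lmodule.copy crossed_product E.

Fact crossed_mulDl : left_distributive (crossed_mul : crossed_product -> _) +%R.
Proof. by move=> x y z; have := crossed_mul_bilin.1 z 1 x y; rewrite !scale1r. Qed.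
Fact crossed_mulDr : right_distributive (crossed_mul : crossed_product -> _) +%R.
Proof. by move=> x y z; have := crossed_mul_bilin.2 x 1 y z; rewrite !scale1r. Qed.

HB.instance Definition _ := GRing.Zmodule_isNzRing.Build crossed_product
  (let: And3 a _ _ := hE in a) (let: And3 _ b _ := hE in b)
  (let: And3 _ _ c := hE in c) crossed_mulDl crossed_mulDr tprod11_neq0.

Fact crossed_scaleAl (c : k) (x y : crossed_product) : c *: (x * y) = (c *: x) * y.
Proof.
have B := crossed_mul_bilin.1 y; have B0 := B (-1) 0 0.
rewrite scaler0 addr0 scaleN1r addNr in B0.
by have := B c x 0; rewrite !addr0 B0 addr0 => /esym.
Qed.
Fact crossed_scaleAr (c : k) (x y : crossed_product) : c *: (x * y) = x * (c *: y).
Proof.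
have B := crossed_mul_bilin.2 x; have B0 := B (-1) 0 0.
rewrite scaler0 addr0 scaleN1r addNr in B0.
by have := B c y 0; rewrite !addr0 B0 addr0 => /esym.
Qed.

HB.instance Definition _ :=
  GRing.Lmodule_isLalgebra.Build k crossed_product crossed_scaleAl.
HB.instance Definition _ :=
  GRing.Lalgebra_isAlgebra.Build k crossed_product crossed_scaleAr.

Definition cprod (a : A) (h : H) : crossed_product := tprod a h.

End CrossedProduct.

HB.mixin Record isBimodule (k : comNzRingType) (B : algType k) M
    of GRing.Lmodule k M := {
  lact : B -> M -> M;
  ract : M -> B -> M;
  lact_bilin : bilin lact;
  ract_bilin : bilin ract;
  lact1 : forall m, lact 1 m = m;
  ract1 : forall m, ract m 1 = m;
  lactA : forall x y m, lact x (lact y m) = lact (x * y) m;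
  ractA : forall m x y, ract (ract m x) y = ract m (x * y);
  lractA : forall x m y, ract (lact x m) y = lact x (ract m y) }.

#[short(type="bimodType")]
HB.structure Definition Bimodule (k : comNzRingType) (B : algType k) :=
  {M of GRing.Lmodule k M & isBimodule k B M}.

Section Reduced.
Variables (k : comNzRingType) (B : algType k).

Definition is_scalar (x : B) := exists c : k, x = c *: 1.
Fact is_scalar0 : is_scalar 0. Proof. by exists 0; rewrite scale0r. Qed.
Fact is_scalarP c x y : is_scalar x -> is_scalar y -> is_scalar (c *: x + y).
Proof.
by move=> [a ->] [b ->]; exists (c * a + b); rewrite scalerDl scalerA.
Qed.
Definition scalars : submodule B := Submodule is_scalar0 is_scalarP.

(* [rbar B] is [B / k], with class map [bcl]. *)
Definition rbar : lmodType k := quotmod scalars.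
Definition bcl (x : B) : rbar := quot_class scalars x.

(* The class of [x1 (x) ... (x) xn] in the [n]-fold tensor power of [B / k]. *)
Definition bpure (n : nat) (s : seq B) : tpow rbar n := tpure n (map bcl s).

End Reduced.

Section MultilinearLift.
Variables (k : comNzRingType) (W : lmodType k).

Definition multilinear (V : lmodType k) (n : nat) (g : seq V -> W) :=
  forall s1 s2, (size s1 + size s2).+1 = n -> linear (fun x => g (s1 ++ x :: s2)).

Lemma tpure_linear (V : lmodType k) n (s1 s2 : seq V) :
  linear (fun x => tpure n (s1 ++ x :: s2)).
Proof.
elim: n s1 => [|n IH] [|v s1] c x y /=; rewrite ?scaler0 ?addr0 //.
  exact: tprodPl.
by rewrite IH tprodPr.
Qed.

Lemma tpow_ext (V : lmodType k) n (f g : {linear tpow V n -> W}) :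
  (forall s, size s = n -> f (tpure n s) = g (tpure n s)) -> f = g.
Proof.
move=> fg; apply: hom_ext; elim: n f g fg => [|n IH] f g fg t.
  have -> : t = (t : k) *: tpure 0 [::] by rewrite /GRing.scale /= mulr1.
  by rewrite !linearZ fg.
elim/tensor_span: t => [|c u v t Ht]; first by rewrite !raddf0.
rewrite !linearP Ht; congr (_ *: _ + _).
have [fu fuE] := hom_of (fun c x y =>
  etrans (congr1 f (tprodPr u c x y)) (linearP f c (tprod u x) (tprod u y))).
have [gu guE] := hom_of (fun c x y =>
  etrans (congr1 g (tprodPr u c x y)) (linearP g c (tprod u x) (tprod u y))).
rewrite -fuE -guE; apply: IH => s ss; rewrite fuE guE.
by apply: (fg (u :: s)); rewrite /= ss.
Qed.

Lemma multilinear_lift (V : lmodType k) n (g : seq V -> W) :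
  multilinear n g ->
  exists f : {linear tpow V n -> W}, forall s, size s = n -> f (tpure n s) = g s.
Proof.
elim: n g => [|n IH] g gl.
  have [f fE] : exists f : {linear k^o -> W}, f =1 fun c => (c : k) *: g [::].
    by apply: hom_of => c x y; rewrite scalerDl scalerA.
  by exists f => -[] // _; rewrite /= fE scale1r.
have /choice[F FE] : forall x, exists f : {linear tpow V n -> W},
    forall s, size s = n -> f (tpure n s) = g (x :: s).
  by move=> x; apply: IH => s1 s2 ss; apply: (gl (x :: s1)); rewrite /= addSn ss.
have bF : bilin (fun x t => F x t).
  split=> [t|x]; last exact: linearP.
  move=> c x y /=; rewrite -hom_scaleE -hom_addE; congr (GRing.Linear.sort _ t).
  apply: tpow_ext => s ss; rewrite hom_addE hom_scaleE !FE //.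
  by apply: (gl [::]); rewrite /= add0n ss.
have [f fE] := hom_of (tsum_linear bF).
by exists f => -[|x s] // [ss]; rewrite /= fE tsumE // FE.
Qed.

Variable B : algType k.

Lemma bpure_linear n (s1 s2 : seq B) : linear (fun x => bpure n (s1 ++ x :: s2)).
Proof.
by move=> c x y; rewrite /bpure !map_cat /= /bcl linearP tpure_linear.
Qed.

Lemma bpure_1 n (s1 s2 : seq B) : bpure n (s1 ++ 1 :: s2) = 0.
Proof.
have l0 : bpure n (s1 ++ 0 :: s2) = 0.
  have := bpure_linear n s1 s2 (-1) 0 0.
  by rewrite scaler0 addr0 scaleN1r addNr.
rewrite -[RHS]l0 /bpure !map_cat /=; congr (tpure n (_ ++ _ :: _)).
by apply/quot_classP; rewrite subr0; exists 1; rewrite scale1r.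
Qed.

Lemma bpure_ext n (f g : {linear tpow (rbar B) n -> W}) :
  (forall s, size s = n -> f (bpure n s) = g (bpure n s)) -> f = g.
Proof.
move=> fg; apply: tpow_ext => s ss.
have -> : tpure n s = bpure n (map repr s).
  rewrite /bpure -map_comp (@eq_map _ _ _ id) ?map_id // => x /=.
  exact: quot_reprK.
by apply: fg; rewrite size_map.
Qed.

(* A multilinear map vanishing as soon as one entry is [1] factors through the
   tensor power of [B / k]. *)
Lemma normalized_lift n (g : seq B -> W) : multilinear n g ->
    (forall s1 s2, (size s1 + size s2).+1 = n -> g (s1 ++ 1 :: s2) = 0) ->
  exists f : {linear tpow (rbar B) n -> W},
    forall s, size s = n -> f (bpure n s) = g s.
Proof.
move=> gl g1.
have gE s1 s2 x y : (size s1 + size s2).+1 = n -> bcl x = bcl y ->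
    g (s1 ++ x :: s2) = g (s1 ++ y :: s2).
  move=> ss /quot_classP[c xy].
  have -> : x = c *: 1 + y by rewrite -xy subrK.
  by rewrite gl // g1 // scaler0 add0r.
have gr s : size s = n -> g (map repr (map (@bcl _ B) s)) = g s.
  move=> ss; rewrite -map_comp; set r := _ \o _.
  suff H t u : (size t + size u)%N = n -> g (map r t ++ u) = g (t ++ u).
    by have := H s [::]; rewrite /= addn0 !cats0; apply.
  elim/last_ind: t u => [|t x IH] u //.
  rewrite size_rcons => tu; rewrite map_rcons !cat_rcons.
  rewrite IH /=; last by rewrite addnS -addSn.
  by apply: gE; [rewrite -addSn | exact: quot_reprK].
have [|f fE] := @multilinear_lift (rbar B) n (fun s => g (map repr s)).
  move=> s1 s2 ss c x y; rewrite !map_cat /=.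
  have ss' : (size (map (@repr _ _) s1) + size (map (@repr _ _) s2)).+1 = n.
    by rewrite !size_map; exact: ss.
  rewrite -gl //; apply: gE => //.
  by rewrite /bcl linearP /= !quot_reprK.
by exists f => s ss; rewrite /bpure fE ?size_map // gr.
Qed.

End MultilinearLift.

(* For [s = [:: s1; ...; sn]], [mul_at i s] is [[:: s1; ...; si * s(i+1); ...; sn]]
   (the indices start at 1, as in the formulas below). *)
Definition mul_at (R : nzRingType) (i : nat) (s : seq R) : seq R :=
  take i.-1 s ++ (nth 0 s i.-1 * nth 0 s i) :: drop i.+1 s.

Lemma mul_at_cases (R : nzRingType) i (s1 s2 : seq R) :
    (0 < i <= size s1 + size s2)%N ->
  [\/ exists t1 t2, [/\ forall x, mul_at i (s1 ++ x :: s2) = t1 ++ x :: t2,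
       i != size s1 & i != (size s1).+1],
     exists t1 t2 a, [/\ forall x, mul_at i (s1 ++ x :: s2) = t1 ++ (a * x) :: t2,
       i = size s1 & s1 ++ s2 = t1 ++ a :: t2] |
     exists t1 t2 a, [/\ forall x, mul_at i (s1 ++ x :: s2) = t1 ++ (x * a) :: t2,
       i = (size s1).+1 & s1 ++ s2 = t1 ++ a :: t2] ].
Proof.
case: i => // i /= il; rewrite /mul_at.
have [lt1|] := ltnP i.+1 (size s1).
  constructor 1; exists (take i s1 ++ (s1`_i * s1`_i.+1) :: drop i.+2 s1), s2.
  split=> [x||]; try lia.
  rewrite /= !take_cat !nth_cat drop_cat lt1 ltnW //.
  case: ltnP => l2; first by rewrite -catA cat_cons.
  have -> : (i.+2 - size s1 = 0)%N by lia.
  by rewrite drop0 (drop_oversize l2) -catA.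
rewrite leq_eqVlt => /orP[/eqP e1|l1].
  constructor 2; exists (take i s1), s2, s1`_i; split=> // [x|].
    rewrite /= !take_cat !nth_cat !drop_cat -e1 leqnn ltnn subnn /=.
    by rewrite ltnNge leqnSn /= subSnn /= drop0.
  by rewrite -[s1 in LHS](cat_take_drop i) (drop_nth 0) -?e1 // drop_oversize -?e1 // -catA.
have [e1|n1] := eqVneq i (size s1).
  constructor 3; exists s1, (drop 1 s2), s2`_0; split=> [x|//|].
  - rewrite /= !take_cat !nth_cat !drop_cat e1 ltnn subnn cats0.
    by rewrite !ifN -?leqNgt // 1?ltnW // subSnn (_ : (size s1).+2 - size s1 = 2)%N //; lia.
  - by rewrite e1.
  - by case: (s2) il => [|b s2'] /= il; rewrite ?drop0 //; lia.
constructor 1; exists s1, (mul_at (i - size s1) s2).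
have [m em] : exists m, (i - size s1 = m.+1)%N by exists (i - size s1).-1; lia.
split=> [x||]; try lia.
rewrite /mul_at /= !take_cat !nth_cat !drop_cat !ifN -?leqNgt; try lia.
rewrite (_ : i.+1 - size s1 = m.+2)%N 1?(_ : i.+2 - size s1 = m.+3)%N ?em; try lia.
by rewrite /= -catA.
Qed.

Section Hochschild.
Variables (k : comNzRingType) (B : algType k) (M : bimodType B).

Definition hochschild_cochain (n : nat) : lmodType k :=
  {linear tpow (rbar B) n -> M}.

Definition hochschild_formula n (phi : hochschild_cochain n) (s : seq B) : M :=
  lact (nth 0 s 0) (phi (bpure n (behead s)))
  + \sum_(1 <= i < n.+1) (-1) ^+ i *: phi (bpure n (mul_at i s))
  + (-1) ^+ n.+1 *: ract (phi (bpure n (take n s))) (nth 0 s n).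

Let hterm n (phi : hochschild_cochain n) (s : seq B) (i : nat) : M :=
  if i == 0%N then lact (nth 0 s 0) (phi (bpure n (behead s)))
  else if i == n.+1 then ract (phi (bpure n (take n s))) (nth 0 s n)
  else phi (bpure n (mul_at i s)).

Fact hochschild_formulaE n (phi : hochschild_cochain n) s :
  hochschild_formula phi s = \sum_(0 <= i < n.+2) (-1) ^+ i *: hterm phi s i.
Proof.
rewrite big_nat_recr //= big_ltn // /hterm eqxx /= expr0 scale1r eqxx.
congr (_ + _ + _); apply: eq_big_nat => i /andP[i0 i1].
by rewrite ifN ?ifN //; lia.
Qed.

Let phi_linear n (phi : hochschild_cochain n) t1 t2 z u v :
  phi (bpure n (t1 ++ (z *: u + v) :: t2)) =
    z *: phi (bpure n (t1 ++ u :: t2)) + phi (bpure n (t1 ++ v :: t2)).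
Proof. by rewrite bpure_linear linearP. Qed.

Let phi_1 n (phi : hochschild_cochain n) t1 t2 :
  phi (bpure n (t1 ++ 1 :: t2)) = 0.
Proof. by rewrite bpure_1 raddf0. Qed.

Let lact0 (b : B) : lact b (0 : M) = 0.
Proof.
have := (@lact_bilin k B M).2 b (-1) 0 0.
by rewrite scaler0 addr0 scaleN1r addNr.
Qed.

Let ract0 (b : B) : ract (0 : M) b = 0.
Proof.
have := (@ract_bilin k B M).1 b (-1) 0 0.
by rewrite scaler0 addr0 scaleN1r addNr.
Qed.

Let take_mid n s1 (x : B) s2 : size s1 = n -> take n (s1 ++ x :: s2) = s1.
Proof. exact: take_size_cat. Qed.

Let nth_mid n s1 (x : B) s2 : size s1 = n -> nth 0 (s1 ++ x :: s2) n = x.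
Proof. by move<-; rewrite nth_cat ltnn subnn. Qed.

Let take_nth_right n (s1 s2 : seq B) : (size s1 + size s2 = n)%N -> s2 != [::] ->
  exists t a, forall x,
    take n (s1 ++ x :: s2) = s1 ++ x :: t /\ nth 0 (s1 ++ x :: s2) n = a.
Proof.
case/lastP: s2 => // t a; rewrite size_rcons => ss _; exists t, a => x.
rewrite -rcons_cons -rcons_cat -ss.
have e : (size s1 + (size t).+1 = size (s1 ++ x :: t))%N by rewrite size_cat.
by rewrite e -cats1 take_size_cat // nth_cat ltnn subnn.
Qed.

Fact hochschild_multilinear n (phi : hochschild_cochain n) :
  multilinear n.+1 (hochschild_formula phi).
Proof.
move=> s1 s2 [ss] c x y; rewrite !hochschild_formulaE scaler_sumr -big_split.
apply: eq_big_nat => i /andP[_ iltn] /=.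
rewrite scalerA mulrC -scalerA -scalerDr; congr (_ *: _); rewrite /hterm.
have [lb rb] := (@lact_bilin k B M, @ract_bilin k B M).
case: eqP => [_|/eqP i0].
  case: s1 ss => [|a s1] ss /=; first by rewrite lb.1.
  by rewrite phi_linear lb.2.
case: eqP => [_|/eqP in1].
  have [s20|s20] := eqVneq s2 [::].
    have en : size s1 = n by rewrite -ss s20 addn0.
    by rewrite !nth_mid // !take_mid // rb.2.
  have [t [a ta]] := take_nth_right ss s20.
  have [[[-> ->] [-> ->]] [-> ->]] := (ta (c *: x + y), ta x, ta y).
  by rewrite phi_linear rb.1.
have ibnd : (0 < i <= size s1 + size s2)%N.
  by move: iltn; rewrite lt0n i0 ss ltnS leq_eqVlt (negPf in1).
have [] := mul_at_cases ibnd.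
- by move=> [t1 [t2 [E _ _]]]; rewrite !E phi_linear.
- by move=> [t1 [t2 [a [E _ _]]]]; rewrite !E mulrDr -scalerAr phi_linear.
- by move=> [t1 [t2 [a [E _ _]]]]; rewrite !E mulrDl -scalerAl phi_linear.
Qed.

Fact hochschild_normalized n (phi : hochschild_cochain n) s1 s2 :
  (size s1 + size s2).+1 = n.+1 -> hochschild_formula phi (s1 ++ 1 :: s2) = 0.
Proof.
move=> [ss]; rewrite hochschild_formulaE.
set X := phi (bpure n (s1 ++ s2)); set p := size s1.
have pn : (p <= n)%N by rewrite -ss leq_addr.
have tp : hterm phi (s1 ++ 1 :: s2) p = X.
  rewrite /hterm; case: eqP => [/size0nil e|/eqP p0].
    by rewrite /X e /= lact1.
  rewrite ifN; last by rewrite neq_ltn ltnS pn.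
  have [] := @mul_at_cases B p s1 s2; first by rewrite ss lt0n p0.
  - by move=> [t1 [t2 [_]]]; rewrite eqxx.
  - by move=> [t1 [t2 [a [E _ e]]]]; rewrite E mulr1 /X e.
  - by move=> [t1 [t2 [a [_ e]]]]; case: (n_Sn _ e).
have tp1 : hterm phi (s1 ++ 1 :: s2) p.+1 = X.
  rewrite /hterm /=; case: eqP => [[e]|/eqP np].
    have s20 : s2 = [::] by apply: size0nil; move: ss; rewrite -e => /eqP; rewrite -[X in _ == X]addn0 eqn_add2l => /eqP.
    by rewrite nth_mid // take_mid // /X s20 cats0 ract1.
  have [] := @mul_at_cases B p.+1 s1 s2; first by rewrite ss /= -ltnS ltn_neqAle np ltnS.
  - by move=> [t1 [t2 [_ _]]]; rewrite eqxx.
  - by move=> [t1 [t2 [a [_ e]]]]; case: (n_Sn _ (esym e)).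
  - by move=> [t1 [t2 [a [E _ e]]]]; rewrite E mul1r /X e.
have t0 i : (i < n.+2)%N -> i != p -> i != p.+1 -> hterm phi (s1 ++ 1 :: s2) i = 0.
  move=> iltn ip ip1; rewrite /hterm; case: eqP => [i0|/eqP i0].
    case es1 : s1 => [|a t1]; first by rewrite i0 /p es1 in ip.
    by rewrite /= phi_1 lact0.
  case: eqP => [e|/eqP in1].
    have s20 : s2 != [::].
      by apply/eqP => s20; move: ip1; rewrite /p e -ss s20 addn0 eqxx.
    have [t [a ta]] := take_nth_right ss s20.
    by have [-> ->] := ta 1; rewrite phi_1 ract0.
  have ibnd : (0 < i <= size s1 + size s2)%N.
    by move: iltn; rewrite lt0n i0 ss ltnS leq_eqVlt (negPf in1).
  have [] := mul_at_cases ibnd.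
  - by move=> [t1 [t2 [-> _ _]]]; rewrite phi_1.
  - by move=> [t1 [t2 [a [_ /eqP]]]]; rewrite (negPf ip).
  - by move=> [t1 [t2 [a [_ /eqP]]]]; rewrite (negPf ip1).
rewrite -ltnS in pn.
rewrite big_mkord (bigD1 (Ordinal (ltnW pn : (p < n.+2)%N))) //=.
rewrite (bigD1 (Ordinal (pn : (p.+1 < n.+2)%N))) /=; last by rewrite -val_eqE /=; lia.
rewrite tp tp1 big1 ?addr0 => [|i /andP[]].
  by rewrite exprS mulN1r scaleNr subrr.
by rewrite -!val_eqE /= => ip ip1; rewrite t0 // scaler0.
Qed.

Fact hochschild_diff_ex n : exists b : {linear hochschild_cochain n -> hochschild_cochain n.+1},
  forall phi s, size s = n.+1 -> b phi (bpure n.+1 s) = hochschild_formula phi s.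
Proof.
have /choice[b bE] : forall phi : hochschild_cochain n,
    exists psi : hochschild_cochain n.+1,
    forall s, size s = n.+1 -> psi (bpure n.+1 s) = hochschild_formula phi s.
  by move=> phi; apply: normalized_lift;
    [exact: hochschild_multilinear | exact: hochschild_normalized].
have [lb rb] := (@lact_bilin k B M, @ract_bilin k B M).
have [|b' b'E] := @hom_of k (hochschild_cochain n) (hochschild_cochain n.+1) b.
  move=> c f g; apply: bpure_ext => s ss; rewrite hom_addE hom_scaleE !bE //.
  rewrite !hochschild_formulaE scaler_sumr -big_split.
  apply: eq_bigr => i _ /=; rewrite scalerA mulrC -scalerA -scalerDr.
  congr (_ *: _); rewrite /hterm; case: ifP => _; first by rewrite lb.2.
  by case: ifP => _; first by rewrite rb.1.
by exists b' => phi s ss; rewrite b'E bE.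
Qed.

Definition hochschild_diff n :
    {linear hochschild_cochain n -> hochschild_cochain n.+1} :=
  projT1 (cid (hochschild_diff_ex n)).

Lemma hochschild_diffE n (phi : hochschild_cochain n) s : size s = n.+1 ->
  hochschild_diff n phi (bpure n.+1 s) = hochschild_formula phi s.
Proof. by rewrite /hochschild_diff; case: cid => b /= bE; apply: bE. Qed.

End Hochschild.

Section Submodule.
Variables (k : comNzRingType) (V : lmodType k) (S : submodule V).

Definition submod : Type := {x : V | submodule_pred S x}.
HB.instance Definition _ := SubChoice.on submod.
HB.instance Definition _ := GRing.SubChoice_isSubLmodule.Build k V
  (submodule_pred S) submod (submodule_pred_closed S).

End Submodule.

Section Cohomology.
Variables (k : comNzRingType) (C : nat -> lmodType k).
Variable (d : forall n, {linear C n -> C n.+1}).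

Fact cocycle0 n : d n 0 = 0. Proof. exact: raddf0. Qed.
Fact cocycleP n (c : k) x y : d n x = 0 -> d n y = 0 -> d n (c *: x + y) = 0.
Proof. by rewrite linearP => -> ->; rewrite scaler0 addr0. Qed.
Definition cocycles n : submodule (C n) := Submodule (@cocycle0 n) (@cocycleP n).

Definition is_coboundary n : C n -> Prop :=
  match n with
  | 0 => fun z => z = 0
  | m.+1 => fun z => exists y, z = d m y
  end.

Fact coboundary0 n : is_coboundary (\val (0 : submod (cocycles n))).
Proof. by case: n => [|n] //=; exists 0; rewrite raddf0. Qed.
Fact coboundaryP n (c : k) (x y : submod (cocycles n)) :
  is_coboundary (\val x) -> is_coboundary (\val y) ->
  is_coboundary (\val (c *: x + y)).
Proof.
rewrite linearP; case: n x y => [|n] x y /=.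
  by move=> -> ->; rewrite scaler0 addr0.
by move=> [a ->] [b ->]; exists (c *: a + b); rewrite linearP.
Qed.
Definition coboundaries n : submodule (submod (cocycles n)) :=
  @Submodule _ (submod (cocycles n)) (fun z => is_coboundary (\val z))
    (@coboundary0 n) (@coboundaryP n).

Definition cohomology (n : nat) : lmodType k := quotmod (coboundaries n).

End Cohomology.

Definition lmod_isomorphic (k : comNzRingType) (U V : lmodType k) :=
  exists g : {linear U -> V}, bijective g.

Section DirectProduct.
Variables (k : comNzRingType) (I : Type) (V : I -> lmodType k).

Definition dprod : Type := forall i, V i.
HB.instance Definition _ := gen_eqMixin dprod.
HB.instance Definition _ := gen_choiceMixin dprod.

Definition dprod_zero : dprod := fun i => 0.
Definition dprod_opp (x : dprod) : dprod := fun i => - x i.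
Definition dprod_add (x y : dprod) : dprod := fun i => x i + y i.
Definition dprod_scale (c : k) (x : dprod) : dprod := fun i => c *: x i.

Fact dprod_addA : associative dprod_add.
Proof. by move=> x y z; apply: functional_extensionality_dep => i; apply: addrA. Qed.
Fact dprod_addC : commutative dprod_add.
Proof. by move=> x y; apply: functional_extensionality_dep => i; apply: addrC. Qed.
Fact dprod_add0 : left_id dprod_zero dprod_add.
Proof. by move=> x; apply: functional_extensionality_dep => i; apply: add0r. Qed.
Fact dprod_addN : left_inverse dprod_zero dprod_opp dprod_add.
Proof. by move=> x; apply: functional_extensionality_dep => i; apply: addNr. Qed.

HB.instance Definition _ :=
  GRing.isZmodule.Build dprod dprod_addA dprod_addC dprod_add0 dprod_addN.

Fact dprod_scaleA a b x : dprod_scale a (dprod_scale b x) = dprod_scale (a * b) x.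
Proof. by apply: functional_extensionality_dep => i; apply: scalerA. Qed.
Fact dprod_scale1 : left_id 1 dprod_scale.
Proof. by move=> x; apply: functional_extensionality_dep => i; apply: scale1r. Qed.
Fact dprod_scaleDr : right_distributive dprod_scale +%R.
Proof. by move=> a x y; apply: functional_extensionality_dep => i; apply: scalerDr. Qed.
Fact dprod_scaleDl x : {morph dprod_scale^~ x : a b / a + b}.
Proof. by move=> a b; apply: functional_extensionality_dep => i; apply: scalerDl. Qed.

HB.instance Definition _ := GRing.Zmodule_isLmodule.Build k dprod
  dprod_scaleA dprod_scale1 dprod_scaleDr dprod_scaleDl.

Lemma dprodP c (x y : dprod) i : (c *: x + y) i = c *: x i + y i.
Proof. by []. Qed.

End DirectProduct.

Section CrossedComplex.
Variables (k : comNzRingType) (H : hopfAlgType k) (A : algType k).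
Variables (w : weak_action H A) (f : {linear tensor H H -> A}).
Notation Hb := (tpow (rbar H)).
Notation Ab := (tpow (rbar A)).

(* [wactl hs a] is a^(overline h) for h = h_i (x) ... (x) h_j: the last entry
   acts first. *)
Definition wactl (hs : seq H) (a : A) : A := foldr (fun h b => w h b) a hs.

(* The class of a^(overline h), for a = a_1 (x) ... (x) a_r, in the [r]-fold
   tensor power of [A / k]. On the empty tensor [hs] acts through the counit
   (the 0-th iterate of the coproduct), as is implicit in the Sweedler
   notation. The action a^h of a single [h] is [tact [:: h] a]. *)
Fixpoint tact (hs : seq H) (a : seq A) : Ab (size a) :=
  match a with
  | [::] => (\prod_(h <- hs) counit h : k^o)
  | x :: a' => lsw2 hs (fun s1 s2 => tprod (bcl (wactl s1 x)) (tact s2 a'))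
  end.

(* The class of h (x) a in the tensor product of the [s]-fold tensor power of
   [H / k] and the [r]-fold tensor power of [A / k]. *)
Definition hpure (s r : nat) (hs : seq H) (a : seq A) : tensor (Hb s) (Ab r) :=
  tprod (bpure s hs) (bpure r a).

(* The component [F l r] is F^(l)_r, which is constrained for l >= 2 only. *)
Definition F_family := forall l r, {linear tensor (Hb l) (Ab r) -> Ab (r + l - 1)}.

Definition f2 (h l : H) : A := f (tprod h l).

Definition is_F_family (F : F_family) : Prop :=
  [/\ forall h1 h2,
        F 2%N 0%N (hpure 2 0 [:: h1; h2] [::]) = bpure _ [:: - f2 h1 h2],
      forall l hs, (2 <= l)%N -> size hs = l.+1 ->
        F l.+1 0%N (hpure l.+1 0 hs [::]) =
        \sum_(1 <= j < l.+1) (-1) ^+ j *: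
          lsw2 (take j.-1 hs) (fun u1 u2 =>
          sw2 (nth 0 hs j.-1) (fun x1 x2 =>
          sw2 (nth 0 hs j) (fun y1 y2 =>
            tpow_cast _ (tcat (bpure 1 [:: wactl u1 (f2 x1 y1)])
              (F l 0%N (hpure l 0 (u2 ++ (x2 * y2) :: drop j.+1 hs) [::])))))),
      forall r h1 h2 a, (1 <= r)%N -> size a = r ->
        F 2%N r (hpure 2 r [:: h1; h2] a) =
        \sum_(0 <= i < r.+1) (-1) ^+ i.+1 *:
          sw3 h1 (fun x1 x2 x3 => sw3 h2 (fun y1 y2 y3 =>
            tpow_cast _ (tcat (tact [:: x1; y1] (take i a))
              (tcat (bpure 1 [:: f2 x2 y2]) (tact [:: x3 * y3] (drop i a))))))
    & forall l r hs a, (2 <= l)%N -> (1 <= r)%N -> size hs = l.+1 -> size a = r ->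
        F l.+1 r (hpure l.+1 r hs a) =
        \sum_(1 <= j < l.+1) \sum_(0 <= i < r.+1) (-1) ^+ (i * l + j) *:
          lsw3 (take j.-1 hs) (fun u1 u2 u3 =>
          sw3 (nth 0 hs j.-1) (fun x1 x2 x3 =>
          sw3 (nth 0 hs j) (fun y1 y2 y3 =>
          lsw2 (drop j.+1 hs) (fun v1 v2 =>
            tpow_cast _ (tcat (tact (u1 ++ x1 :: y1 :: v1) (take i a))
              (tcat (bpure 1 [:: wactl u2 (f2 x2 y2)])
                (F l (r - i)%N (hpure l (r - i) (u3 ++ (x3 * y3) :: v2) (drop i a)))))))))].

Hypothesis hE : is_crossed_product w f.
Notation E := (crossed_product hE).
Notation "a # h" := (cprod hE a h) (at level 35).
Variable M : bimodType E.

Definition crossed_cochain (s r : nat) : lmodType k :=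
  {linear tensor (Hb s) (Ab r) -> M}.

(* The component [d r s l] is d^(rs)_l, which is constrained only for
   0 <= l <= s and r + l > 0; the remaining components are not used in
   [dhat_total]. On the constrained range the conditions below determine [F]
   and [d] uniquely, the classes [hpure s r hs a] being generators. *)
Definition dhat_family := forall r s l,
  {linear crossed_cochain (s - l) (r + l - 1) -> crossed_cochain s r}.

Definition dhat0_formula (r s : nat) (phi : crossed_cochain (s - 0) (r + 0 - 1))
    (hs : seq H) (a : seq A) : M :=
  lsw2 hs (fun h1 h2 =>
    lact (wactl h1 (nth 0 a 0) # 1) (phi (hpure _ _ h2 (behead a))))
  + (-1) ^+ r *: ract (phi (hpure _ _ hs (take r.-1 a))) (nth 0 a r.-1 # 1)
  + \sum_(1 <= i < r) (-1) ^+ i *: phi (hpure _ _ hs (mul_at i a)).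

Definition dhat1_formula (r s : nat) (phi : crossed_cochain (s - 1) (r + 1 - 1))
    (hs : seq H) (a : seq A) : M :=
  (-1) ^+ r *: lact (1 # nth 0 hs 0) (phi (hpure _ _ (behead hs) a))
  + (-1) ^+ (r + s) *: sw2 (nth 0 hs s.-1) (fun x1 x2 =>
      ract (phi (tprod (bpure _ (take s.-1 hs)) (tpow_cast _ (tact [:: x1] a))))
        (1 # x2))
  + \sum_(1 <= i < s) (-1) ^+ (r + i) *:
      lsw2 (take i.-1 hs) (fun u1 u2 =>
      sw2 (nth 0 hs i.-1) (fun x1 x2 =>
      sw2 (nth 0 hs i) (fun y1 y2 =>
        lact (wactl u1 (f2 x1 y1) # 1)
          (phi (hpure _ _ (u2 ++ (x2 * y2) :: drop i.+1 hs) a))))).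

Definition dhatl_formula (F : F_family) (r s l : nat)
    (phi : crossed_cochain (s - l) (r + l - 1)) (hs : seq H) (a : seq A) : M :=
  (-1) ^+ (l * (r + s)) *: lsw2 (drop (s - l) hs) (fun t1 t2 =>
    ract (phi (tprod (bpure _ (take (s - l) hs)) (F l r (hpure l r t1 a))))
      (1 # \prod_(h <- t2) h)).

Definition is_dhat_family (F : F_family) (d : dhat_family) : Prop :=
  forall r s hs a, size hs = s -> size a = r ->
  [/\ (0 < r)%N -> forall phi, d r s 0%N phi (hpure s r hs a) = dhat0_formula phi hs a,
      (1 <= s)%N -> forall phi, d r s 1%N phi (hpure s r hs a) = dhat1_formula phi hs a
    & forall l, (2 <= l <= s)%N ->
        forall phi, d r s l phi (hpure s r hs a) = dhatl_formula F phi hs a].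

Definition bidegree (n : nat) : Type := {p : nat * nat | (p.1 + p.2)%N == n}.

Definition bidegree_of n r s (e : (r + s)%N = n) : bidegree n :=
  exist _ (r, s) (introT eqP e).

(* [Xhat n] is the direct sum over [r + s = n] of the
   [crossed_cochain s r]; the index is the pair [(r, s)]. *)
Definition Xhat (n : nat) : lmodType k :=
  dprod (fun p : bidegree n => crossed_cochain (\val p).2 (\val p).1).

Definition Xcomp n (phi : Xhat n) (s r : nat) : crossed_cochain s r :=
  if (r + s)%N =P n is ReflectT e then phi (bidegree_of e) else 0.

Definition dhat_fun (d : dhat_family) n (phi : Xhat n) : Xhat n.+1 := fun p =>
  let r := (\val p).1 in let s := (\val p).2 in
  \sum_(0 <= l < s.+1 | (0 < r + l)%N) d r s l (Xcomp phi (s - l) (r + l - 1)).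

Fact dhat_linear d n : linear (@dhat_fun d n).
Proof.
move=> c x y; apply: functional_extensionality_dep => p; rewrite dprodP /dhat_fun.
have XcompP s r : Xcomp (c *: x + y) s r = c *: Xcomp x s r + Xcomp y s r.
  by rewrite /Xcomp; case: eqP => // _; rewrite scaler0 addr0.
rewrite scaler_sumr -big_split; apply: eq_bigr => l _ /=.
by rewrite XcompP linearP.
Qed.

Definition dhat_total (d : dhat_family) n : {linear Xhat n -> Xhat n.+1} :=
  HB.pack_for {linear Xhat n -> Xhat n.+1} (@dhat_fun d n)
    (GRing.isLinear.Build _ _ _ _ _ (@dhat_linear d n)).

End CrossedComplex.

(* Main.v *)
(* Write E = A # H. Up to the signs (-1)^(rs), the differential of Xhat is the
   sum of a left part, whose terms x (x) v' carry a coefficient x in E on the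
   left (x is a^h, f(h_j, h_(j+1))^h or h_1), and of a right part. The left part
   has a uniform recursion: prepending h to the word multiplies the coefficient
   x by 1 # h in E and splits the product into an element of A, the new
   coefficient, and an element of H, the new first letter.

   Feeding the left part into the standard contraction of the bar resolution
   gives maps g from the mixed words (h, a) to words in E, by
   g(v) = sum [x] g(v') over the terms x (x) v' of the left part. They commute
   with the differentials because F satisfies the same recursion, with letters
   of A only. Restriction along g is onto, with an explicit right inverse, which
   transports b^2 = 0 to d^2 = 0. Its kernel is acyclic by dimension shifting:
   M embeds into the coinduced bimodule Hom_k(E, M), for which both complexes
   have explicit contractions. *)

From HB Require Import structures.
Require Import Defs.
From mathcomp Require Import all_boot all_algebra boolp.
From mathcomp.multinomials Require Import freeg.
From mathcomp Require Import zify.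

Set Implicit Arguments.
Unset Strict Implicit.
Unset Printing Implicit Defensive.

Import GRing.Theory.
Local Open Scope ring_scope.

(** * Linear functions and formal sums *)

(** Over an arbitrary commutative ring [E], [H] and [A] need not be flat, so tensor products are not
    exact. Cochains are therefore handled as functions on lists, linear in every slot and zero when
    a letter is [1]; the embedding of M into Hom_k(E, M) is usable because it splits over k. Degrees
    are lengths of lists, which avoids casts between tensor powers.

    Two identities carry the comparison. The square of the left part reduces to the products of two
    letters of A, and the left and right parts anticommute up to these same products. The cocycle
    and twisted module conditions on f never appear separately: they enter as associativity of E,
    and only the normalization of f is extracted.

    The definition of F handles in one step the entries of [a] that cross the word and the next
    value of f. Here letters of A are emitted one at a time until a single letter of H is left, and
    a^h becomes the case l = 1 of F. That last letter carries the product of the second Sweedler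
    factors of the word; the counit removes it when F itself is wanted. *)

Section LinearFunctions.
Variables (k : comNzRingType) (U V : lmodType k) (g : U -> V).
Hypothesis gl : linear g.

Lemma lin0 : g 0 = 0.
Proof. by have := gl (-1) 0 0; rewrite scaler0 addr0 scaleN1r addNr. Qed.
Lemma linD x y : g (x + y) = g x + g y.
Proof. by have := gl 1 x y; rewrite !scale1r. Qed.
Lemma linZ c x : g (c *: x) = c *: g x.
Proof. by have := gl c x 0; rewrite !addr0 lin0 addr0. Qed.
Lemma linN x : g (- x) = - g x.
Proof. by rewrite -scaleN1r linZ scaleN1r. Qed.
Lemma linB x y : g (x - y) = g x - g y.
Proof. by rewrite linD linN. Qed.

End LinearFunctions.

Section LinearClosure.
Variables (k : comNzRingType) (U V W : lmodType k).

Lemma linear_add (f g : U -> V) : linear f -> linear g -> linear (fun x => f x + g x).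
Proof. by move=> lf lg c x y; rewrite lf lg scalerDr addrACA. Qed.
Lemma linear_opp (f : U -> V) : linear f -> linear (fun x => - f x).
Proof. by move=> lf c x y; rewrite lf opprD scalerN. Qed.
Lemma linear_sub (f g : U -> V) : linear f -> linear g -> linear (fun x => f x - g x).
Proof. by move=> lf lg; apply: linear_add lf (linear_opp lg). Qed.
Lemma linear_scale c (f : U -> V) : linear f -> linear (fun x => c *: f x).
Proof. by move=> lf a x y; rewrite lf scalerDr !scalerA mulrC. Qed.
Lemma linear_comp (f : V -> W) (g : U -> V) : linear f -> linear g ->
  linear (fun x => f (g x)).
Proof. by move=> lf lg c x y; rewrite lg lf. Qed.
Lemma linear_zero : linear (fun _ : U => 0 : V).
Proof. by move=> c x y; rewrite scaler0 addr0. Qed.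

End LinearClosure.

Section FormalSums.
Variable k : comNzRingType.

(* A formal linear combination of elements of [X], to be evaluated by [ev] on
   functions with values in any [k]-module; summation indices become explicit,
   so that linearity in the function and interchange of sums are free. *)
Definition fsum (X : Type) : Type := seq (k * X).

Definition ev (W : lmodType k) (X : Type) (g : X -> W) (m : fsum X) : W :=
  \sum_(p <- m) p.1 *: g p.2.

Definition fscale (X : Type) (c : k) (m : fsum X) : fsum X :=
  [seq (c * p.1, p.2) | p <- m].

Definition fmap (X Y : Type) (g : X -> Y) (m : fsum X) : fsum Y :=
  [seq (p.1, g p.2) | p <- m].

Definition fbind (X Y : Type) (m : fsum X) (g : X -> fsum Y) : fsum Y :=
  flatten [seq fscale p.1 (g p.2) | p <- m].

Section Ev.
Variables (W : lmodType k) (X Y : Type).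
Implicit Types (g : X -> W) (m : fsum X).

Lemma ev_nil g : ev g [::] = 0. Proof. exact: big_nil. Qed.
Lemma ev_cons g c x m : ev g ((c, x) :: m) = c *: g x + ev g m.
Proof. exact: big_cons. Qed.
Lemma ev_seq1 g c x : ev g [:: (c, x)] = c *: g x.
Proof. exact: big_seq1. Qed.
Lemma ev_cat g m1 m2 : ev g (m1 ++ m2) = ev g m1 + ev g m2.
Proof. exact: big_cat. Qed.
Lemma ev_scale g c m : ev g (fscale c m) = c *: ev g m.
Proof.
by rewrite /ev big_map scaler_sumr; apply: eq_bigr => p _; rewrite scalerA.
Qed.

End Ev.

Section Ev.
Variables (W : lmodType k) (X Y : Type).
Implicit Types (g : X -> W) (m : fsum X).

Lemma ev_map (g : Y -> W) (h : X -> Y) m : ev g (fmap h m) = ev (fun x => g (h x)) m.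
Proof. exact: big_map. Qed.
Lemma ev_bind (g : Y -> W) (h : X -> fsum Y) m :
  ev g (fbind m h) = ev (fun x => ev g (h x)) m.
Proof.
rewrite /ev /fbind big_flatten big_map; apply: eq_bigr => p _.
exact: ev_scale.
Qed.
Lemma ev_lin g g' c m : ev (fun x => c *: g x + g' x) m = c *: ev g m + ev g' m.
Proof.
rewrite /ev scaler_sumr -big_split; apply: eq_bigr => p _ /=.
by rewrite scalerDr !scalerA mulrC.
Qed.
Lemma eq_ev g g' m : g =1 g' -> ev g m = ev g' m.
Proof. by move=> e; apply: eq_bigr => p _; rewrite e. Qed.
Lemma ev0 m : ev (fun _ => 0 : W) m = 0.
Proof. by rewrite /ev big1 // => p _; rewrite scaler0. Qed.
Lemma evD g g' m : ev (fun x => g x + g' x) m = ev g m + ev g' m.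
Proof. by rewrite -[ev g m]scale1r -ev_lin; apply: eq_ev => x; rewrite scale1r. Qed.
Lemma evZ c g m : ev (fun x => c *: g x) m = c *: ev g m.
Proof. by rewrite -[RHS]addr0 -(ev0 m) -ev_lin; apply: eq_ev => x; rewrite addr0. Qed.
Lemma evN g m : ev (fun x => - g x) m = - ev g m.
Proof. by rewrite -scaleN1r -evZ; apply: eq_ev => x; rewrite scaleN1r. Qed.
Lemma evB g g' m : ev (fun x => g x - g' x) m = ev g m - ev g' m.
Proof. by rewrite evD evN. Qed.
Lemma ev_param (P : lmodType k) (g : P -> X -> W) m :
  (forall x, linear (fun p => g p x)) -> linear (fun p => ev (g p) m).
Proof. by move=> gl c p q; rewrite -ev_lin; apply: eq_ev => x; rewrite gl. Qed.
Lemma ev_linear (V : lmodType k) (h : W -> V) g m :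
  linear h -> h (ev g m) = ev (fun x => h (g x)) m.
Proof.
move=> hl; elim: m => [|[c x] m IH]; first by rewrite !ev_nil (lin0 hl).
by rewrite !ev_cons hl IH.
Qed.
End Ev.

Lemma ev_exchange (W : lmodType k) (X Y : Type) (g : X -> Y -> W) (m : fsum X)
  (m' : fsum Y) :
  ev (fun x => ev (g x) m') m = ev (fun y => ev (g^~ y) m) m'.
Proof.
elim: m => [|[c x] m IH].
  by rewrite ev_nil -[LHS](ev0 W m'); apply: eq_ev => y; rewrite ev_nil.
by rewrite ev_cons IH -ev_lin; apply: eq_ev => y; rewrite ev_cons.
Qed.

(** Built on the chosen representative [repr t], hence in general not additive in [t]; linearity in
    the tensor is recovered from [tsum_linear] when the summand is bilinear. *)
Definition tensor_terms (U V : lmodType k) (t : tensor U V) : fsum (U * V) :=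
  [seq (coeff z (repr t), z) | z <- dom (repr t)].

Lemma tsum_ev (U V W : lmodType k) (b : U -> V -> W) t :
  tsum b t = ev (fun p => b p.1 p.2) (tensor_terms t).
Proof.
rewrite /tsum -[in LHS](Freeg_dom (repr t)) fglift_Freeg /prelift /ev /tensor_terms.
by rewrite !big_map.
Qed.

Section TensorSums.
Variables (U V W : lmodType k).
Implicit Types (b : U -> V -> W) (t : tensor U V).

Lemma eq_tsum b b' t : (forall u v, b u v = b' u v) -> tsum b t = tsum b' t.
Proof. by move=> e; rewrite !tsum_ev; apply: eq_ev => p; rewrite e. Qed.

Lemma tsum0 t : tsum (fun _ _ => 0 : W) t = 0.
Proof. by rewrite tsum_ev ev0. Qed.
Lemma tsumD b b' t : tsum (fun u v => b u v + b' u v) t = tsum b t + tsum b' t.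
Proof. by rewrite !tsum_ev evD. Qed.
Lemma tsumN b t : tsum (fun u v => - b u v) t = - tsum b t.
Proof. by rewrite !tsum_ev evN. Qed.
Lemma tsumZ c b t : tsum (fun u v => c *: b u v) t = c *: tsum b t.
Proof. by rewrite !tsum_ev evZ. Qed.

Lemma tsum_comp (W' : lmodType k) (h : W -> W') b t :
  linear h -> h (tsum b t) = tsum (fun u v => h (b u v)) t.
Proof. by move=> hl; rewrite !tsum_ev ev_linear. Qed.

Lemma ev_tsum (X : Type) (b : X -> U -> V -> W) t (m : fsum X) :
  ev (fun x => tsum (b x) t) m = tsum (fun u v => ev (fun x => b x u v) m) t.
Proof. by rewrite tsum_ev -ev_exchange; apply: eq_ev => x; rewrite tsum_ev. Qed.

Lemma tensor_ext (g g' : tensor U V -> W) : linear g -> linear g' ->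
  (forall u v, g (tprod u v) = g' (tprod u v)) -> g =1 g'.
Proof.
move=> gl gl' e t; elim/tensor_span: t => [|c u v t IH].
  by rewrite (lin0 gl) (lin0 gl').
by rewrite gl gl' e IH.
Qed.

Lemma tsum_tprod (g : tensor U V -> W) t : linear g ->
  tsum (fun u v => g (tprod u v)) t = g t.
Proof.
move=> gl; have b : bilin (fun u v => g (tprod u v)).
  by split=> [v|u]; apply: (linear_comp gl); [apply: tprodPl | apply: tprodPr].
by apply: (tensor_ext (tsum_linear b) gl) => u v; rewrite tsumE.
Qed.

End TensorSums.

Lemma tsum_exchange (U V U' V' W : lmodType k) (b : U -> V -> U' -> V' -> W)
  (t : tensor U V) (t' : tensor U' V') :
  tsum (fun u v => tsum (b u v) t') t =
    tsum (fun u' v' => tsum (fun u v => b u v u' v') t) t'.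
Proof. by rewrite tsum_ev ev_tsum; apply: eq_tsum => u' v'; rewrite tsum_ev. Qed.

End FormalSums.

Section Slots.
Variable k : comNzRingType.

(** Unlike [multilinear], the condition is imposed in every length at once, so that a single
    function on lists can stand for a cochain of one degree or of all degrees together. *)
Definition slotlin (W V : lmodType k) (g : seq V -> W) :=
  forall s1 s2, linear (fun x => g (s1 ++ x :: s2)).

Definition slotnorm (W : lmodType k) (B : algType k) (g : seq B -> W) :=
  forall s1 s2, g (s1 ++ 1 :: s2) = 0.

Lemma slotlin_cons (W V : lmodType k) (g : seq V -> W) v :
  slotlin g -> slotlin (fun s => g (v :: s)).
Proof. by move=> gl s1 s2; apply: (gl (v :: s1)). Qed.

Lemma slotnorm_cons (W : lmodType k) (B : algType k) (g : seq B -> W) v :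
  slotnorm g -> slotnorm (fun s => g (v :: s)).
Proof. by move=> gn s1 s2; apply: (gn (v :: s1)). Qed.

End Slots.

(** * The crossed product *)

Section Sweedler.
Variables (k : comNzRingType) (H : hopfAlgType k) (W : lmodType k).

Lemma eq_sw2 (e e' : H -> H -> W) h : (forall x y, e x y = e' x y) -> sw2 h e = sw2 h e'.
Proof. exact: eq_tsum. Qed.

Lemma sw2_counitl (g : H -> W) h : linear g -> sw2 h (fun x y => counit x *: g y) = g h.
Proof.
move=> gl; rewrite -[in RHS](counit_coprodl h) (tsum_comp _ _ gl).
by apply: eq_tsum => u v; rewrite (linZ gl).
Qed.

Lemma sw2_counitr (g : H -> W) h : linear g -> sw2 h (fun x y => counit y *: g x) = g h.
Proof.
move=> gl; rewrite -[in RHS](counit_coprodr h) (tsum_comp _ _ gl).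
by apply: eq_tsum => u v; rewrite (linZ gl).
Qed.

Lemma sw2_one (e : H -> H -> W) : bilin e -> sw2 1 e = e 1 1.
Proof. by move=> be; rewrite /sw2 coprod1 tsumE. Qed.

Lemma sw2_coassoc (e : H -> H -> H -> W) h :
  (forall y z, linear (fun x => e x y z)) -> (forall x z, linear (fun y => e x y z)) ->
  (forall x y, linear (e x y)) ->
  sw2 h (fun x z => sw2 x (fun x1 x2 => e x1 x2 z)) =
  sw2 h (fun x z => sw2 z (fun z1 z2 => e x z1 z2)).
Proof.
move=> e1 e2 e3.
pose e' x (t : tensor H H) := tsum (e x) t.
have be' : bilin e'.
  split=> [t|x]; last by apply: tsum_linear; split=> *; [apply: e2 | apply: e3].
  by apply: tsum_param => y z; apply: e1.
have l' := tsum_linear be'.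
have := congr1 (tsum e') (coprodA h).
rewrite !(tsum_comp _ _ l') => E.
transitivity (tsum (fun x z => tsum e'
  (tsum (fun x1 x2 => tprod x1 (tprod x2 z)) (coprod x))) (coprod h)).
  apply: eq_tsum => x z; rewrite (tsum_comp _ _ l'); apply: eq_tsum => x1 x2.
  by rewrite tsumE // /e' tsumE.
rewrite E; apply: eq_tsum => x z; rewrite (tsum_comp _ _ l'); apply: eq_tsum => z1 z2.
by rewrite tsumE // /e' tsumE.
Qed.

Lemma sw2M (e : H -> H -> W) x y : bilin e ->
  sw2 (x * y) e = sw2 x (fun x1 x2 => sw2 y (fun y1 y2 => e (x1 * y1) (x2 * y2))).
Proof.
move=> be; have l := tsum_linear be.
rewrite /sw2 coprodM (tsum_comp _ _ l); apply: eq_tsum => x1 x2.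
by rewrite (tsum_comp _ _ l); apply: eq_tsum => y1 y2; rewrite tsumE.
Qed.

End Sweedler.

Section CrossedProduct.
Variables (k : comNzRingType) (H : hopfAlgType k) (A : algType k).
Variables (w : weak_action H A) (f : {linear tensor H H -> A}).

Lemma crossed_mulE a h b l : crossed_mul w f (tprod a h) (tprod b l) =
  sw3 h (fun h1 h2 h3 => sw2 l (fun l1 l2 =>
    tprod (a * w h1 b * f (tprod h2 l1)) (h3 * l2))).
Proof.
rewrite /crossed_mul.
rewrite tsumE; last first.
  split=> [h'|a']; apply: tsum_param => b' l'.
    by apply: sw3_param => h1 h2 h3; apply: sw2_param => l1 l2; apply: term_a.
  apply: sw3_linear => *; apply: sw2_param => l1 l2.
  - exact: term_h1.
  - exact: term_h2.
  - exact: term_h3.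
rewrite tsumE //; split=> [l'|b'].
  by apply: sw3_param => h1 h2 h3; apply: sw2_param => l1 l2; apply: term_b.
apply: sw3_param => h1 h2 h3; apply: sw2_linear.
by split=> [l2|l1]; [apply: term_l1 | apply: term_l2].
Qed.

Hypothesis hE : is_crossed_product w f.
Notation E := (crossed_product hE).
Notation "a # h" := (cprod hE a h) (at level 35).

Lemma cprod_linl h : linear (fun a => a # h : E). Proof. exact: tprodPl. Qed.
Lemma cprod_linr a : linear (fun h => a # h : E). Proof. exact: tprodPr. Qed.

Definition esum (W : lmodType k) (K : A -> H -> W) (x : E) : W :=
  tsum K (x : tensor A H).

Lemma esumE (W : lmodType k) (K : A -> H -> W) a h : bilin K -> esum K (a # h) = K a h.
Proof. exact: tsumE. Qed.

Lemma esum_linear (W : lmodType k) (K : A -> H -> W) : bilin K -> linear (esum K).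
Proof. exact: tsum_linear. Qed.

Lemma eq_esum (W : lmodType k) (K K' : A -> H -> W) (x : E) :
  (forall a h, K a h = K' a h) -> esum K x = esum K' x.
Proof. exact: eq_tsum. Qed.

Lemma esum_cprod (W : lmodType k) (g : E -> W) x : linear g -> esum (fun a h => g (a # h))
  x = g x.
Proof. exact: tsum_tprod. Qed.

Lemma cprod_ext (W : lmodType k) (g g' : E -> W) : linear g -> linear g' ->
  (forall a h, g (a # h) = g' (a # h)) -> g =1 g'.
Proof. exact: tensor_ext. Qed.

Lemma wactlin h : linear (w h). Proof. exact: (wact_bilin w).2. Qed.
Lemma wactlinl a : linear (fun h => w h a). Proof. exact: (wact_bilin w).1. Qed.
Lemma f2_linl l : linear (fun h => f2 f h l).
Proof. by move=> c x y; rewrite /f2 tprodPl linearP. Qed.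
Lemma f2_linr h : linear (f2 f h).
Proof. by move=> c x y; rewrite /f2 tprodPr linearP. Qed.

Lemma counit_lin (W : lmodType k) (x : W) : linear (fun h : H => counit h *: x).
Proof. by move=> c u v; rewrite counit_linear scalerDl scalerA. Qed.
Lemma linear_counit (W : lmodType k) (h : H) : linear (fun x : W => counit h *: x).
Proof. exact: linear_scale. Qed.

Let e0 (a : A) (h : H) : A := counit h *: a.
Let be0 : bilin e0.
Proof.
split=> [h|a]; first exact: linear_counit.
by move=> c x y; rewrite /e0 counit_linear scalerDl scalerA.
Qed.

Lemma f2_1l l : f2 f 1 l = counit l *: 1.
Proof.
have [_ u1 _] := hE.
have := congr1 (tsum e0) (u1 (tprod 1 l)).
rewrite crossed_mulE [in RHS]tsumE // /e0 => <-.
rewrite /sw3 sw2_one; last first.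
  split=> [h'|h1].
    apply: tsum_param => h2 h3; apply: sw2_param => l1 l2; exact: term_h1.
  apply: sw2_linear; split=> *; apply: sw2_param => l1 l2; first exact: term_h2.
  exact: term_h3.
rewrite coprod1 tsumE; last first.
  split=> *; apply: sw2_param => l1 l2; first exact: term_h2.
  exact: term_h3.
rewrite (tsum_comp _ _ (tsum_linear be0)).
under eq_tsum => l1 l2 do rewrite tsumE // mul1r wact1l mul1r /e0 mul1r.
by rewrite -(sw2_counitr (g := f2 f 1)) //; apply: f2_linr.
Qed.


Lemma f2_1r h : f2 f h 1 = counit h *: 1.
Proof.
have [_ _ u1] := hE.
have := congr1 (tsum e0) (u1 (tprod 1 h)).
rewrite crossed_mulE [in RHS]tsumE // /e0 => <-.
have -> : sw3 h (fun h1 h2 h3 => sw2 1 (fun l1 l2 =>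
    tprod (1 * w h1 1 * f (tprod h2 l1)) (h3 * l2))) =
    sw3 h (fun h1 h2 h3 => counit h1 *: tprod (f2 f h2 1) h3).
  apply: eq_tsum => h1 h'; apply: eq_tsum => h2 h3.
  rewrite sw2_one; last by split=> *; [apply: term_l1 | apply: term_l2].
  by rewrite mul1r wact1r mulr1 -scalerAl mul1r (linZ (tprodPl _)).
have b1 : bilin (fun h2 h3 => tprod (f2 f h2 1) h3 : tensor A H).
  by split=> *; [apply: (linear_comp (tprodPl _)); apply: f2_linl | apply: tprodPr].
have -> : sw3 h (fun h1 h2 h3 => counit h1 *: tprod (f2 f h2 1) h3) =
    sw2 h (fun h1 h2 => tprod (f2 f h1 1) h2).
  rewrite -[RHS](sw2_counitl (g := fun h => sw2 h (fun h1 h2 => tprod (f2 f h1 1) h2))).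
    by apply: eq_tsum => h1 h'; rewrite tsumZ.
  exact: sw2_linear.
rewrite (tsum_comp _ _ (tsum_linear be0)).
under eq_tsum => l1 l2 do rewrite tsumE // /e0.
by rewrite -(sw2_counitr (g := (f2 f)^~ 1)) //; apply: f2_linl.
Qed.

Lemma cprodAl a b h : (a # 1) * (b # h) = (a * b) # h :> E.
Proof.
rewrite -[LHS]/(crossed_mul w f (tprod a 1) (tprod b h)) crossed_mulE.
rewrite /sw3 sw2_one; last first.
  split=> [h'|h1].
    apply: tsum_param => h2 h3; apply: sw2_param => l1 l2; exact: term_h1.
  apply: sw2_linear; split=> *; apply: sw2_param => l1 l2; first exact: term_h2.
  exact: term_h3.
rewrite coprod1 tsumE; last first.
  split=> *; apply: sw2_param => l1 l2; first exact: term_h2.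
  exact: term_h3.
under eq_sw2 => l1 l2 do
  rewrite -/(f2 f _ _) f2_1l mul1r wact1l -scalerAr mulr1 (linZ (tprodPl _)).
exact: (sw2_counitl _ (tprodPr _)).
Qed.

Lemma cprodHA h a : (1 # h) * (a # 1) = sw2 h (fun x y => w x a # y) :> E.
Proof.
rewrite -[LHS]/(crossed_mul w f (tprod 1 h) (tprod a 1)) crossed_mulE.
apply: eq_tsum => h1 h'.
under eq_tsum => h2 h3.
  rewrite sw2_one; last by split=> *; [apply: term_l1 | apply: term_l2].
  rewrite -/(f2 f _ _) f2_1r mul1r mulr1 -scalerAr mulr1 (linZ (tprodPl _)).
  over.
exact: (sw2_counitl _ (tprodPr _)).
Qed.

Lemma cprodHH h l : (1 # h) * (1 # l) =
  sw2 h (fun x1 x2 => sw2 l (fun y1 y2 => f2 f x1 y1 # (x2 * y2))) :> E.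
Proof.
rewrite -[LHS]/(crossed_mul w f (tprod 1 h) (tprod 1 l)) crossed_mulE.
pose g h := sw2 h (fun x1 x2 => sw2 l (fun y1 y2 => f2 f x1 y1 # (x2 * y2))).
have gl : linear g.
  apply: sw2_linear; split=> [x2|x1].
    apply: sw2_param => y1 y2; apply: (linear_comp (cprod_linl _)); exact: f2_linl.
  apply: sw2_param => y1 y2 c u v.
  by rewrite mulrDl -scalerAl cprod_linr.
rewrite -[RHS](sw2_counitl _ gl).
apply: eq_tsum => h1 h'; rewrite -tsumZ; apply: eq_tsum => h2 h3.
rewrite -tsumZ; apply: eq_tsum => l1 l2.
by rewrite mul1r wact1r -scalerAl mul1r (linZ (tprodPl _)).
Qed.

Lemma cprod_decomp a h : a # h = (a # 1) * (1 # h) :> E.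
Proof. by rewrite cprodAl mulr1. Qed.

End CrossedProduct.

(** * Left and right parts of the differential *)

Section Rho.
Variables (k : comNzRingType) (B : algType k).

(** The bar differential of [e :: s] without its leftmost term. The second component of a pair is
    the coefficient that acts on the right; it is [1] except in the last term. The action stays
    abstract below, so that the same sums serve words in [E] and words in [A]. *)
Fixpoint rho_terms (e : B) (s : seq B) : fsum k (seq B * B) :=
  match s with
  | [::] => [:: (-1, ([::], e))]
  | e2 :: s' => (-1, (e * e2 :: s', 1)) ::
      fscale (-1) (fmap (fun p => (e :: p.1, p.2)) (rho_terms e2 s'))
  end.

Variables (V W : lmodType k) (act : V -> B -> W).

Definition rho (g : seq B -> V) (e : B) (s : seq B) : W :=
  ev (fun p => act (g p.1) p.2) (rho_terms e s).

Lemma rho_nil g e : rho g e [::] = - act (g [::]) e.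
Proof. by rewrite /rho ev_seq1 scaleN1r. Qed.

Lemma rho_cons g e e2 s :
  rho g e (e2 :: s) = - act (g (e * e2 :: s)) 1 - rho (fun t => g (e :: t)) e2 s.
Proof. by rewrite /rho ev_cons ev_scale ev_map !scaleN1r. Qed.

Lemma eq_rho g g' e s : (forall t, size t = size s -> g t = g' t) ->
  rho g e s = rho g' e s.
Proof.
elim: s e g g' => [|e2 s IH] e g g' gg; first by rewrite !rho_nil gg.
rewrite !rho_cons gg //; congr (_ - _).
by apply: IH => t st; apply: gg; rewrite /= st.
Qed.

End Rho.

Section LeftPart.
Variables (k : comNzRingType) (H : hopfAlgType k) (A : algType k).
Variables (w : weak_action H A) (f : {linear tensor H H -> A}).
Hypothesis hE : is_crossed_product w f.
Notation E := (crossed_product hE).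
Notation "a # h" := (cprod hE a h) (at level 35).

(* [left_terms hs a] lists the terms [x (x) (hs', a')] of the left part. Besides
   [1 # h] itself, the terms for [h :: hs] come from those for [hs]: when [x] is
   a letter of [A] the product [(1 # h) * x] is the action of [h] on [x], and
   when [x] is the next letter of [H] it merges the two letters through [f]. *)
Fixpoint left_terms (hs : seq H) (a : seq A) : fsum k (E * (seq H * seq A)) :=
  match hs with
  | [::] => if a is a1 :: a' then [:: (1, (a1 # 1, ([::], a')))] else [::]
  | h :: hs' => (1, (1 # h, (hs', a))) :: fscale (-1) (fbind (left_terms hs' a)
      (fun p => fmap (fun q : A * H => (q.1 # 1, (q.2 :: p.2.1, p.2.2)))
        (tensor_terms ((1 # h) * p.1 : tensor A H))))
  end.

(* The terms of the left part whose coefficient [x] lies in [A]. *)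
Definition leftA_terms (hs : seq H) (a : seq A) : fsum k (A * (seq H * seq A)) :=
  match hs with
  | [::] => if a is a1 :: a' then [:: (1, (a1, ([::], a')))] else [::]
  | h :: hs' => fscale (-1) (fbind (left_terms hs' a)
      (fun p => fmap (fun q : A * H => (q.1, (q.2 :: p.2.1, p.2.2)))
        (tensor_terms ((1 # h) * p.1 : tensor A H))))
  end.

(* For [l = size hs], [r = size a] and [n = r + l - 1], the terms of
   [(-1)^r F^(l)_r(h^(1) (x) a) (x) h_1^(2) ... h_l^(2)]. *)
Fixpoint F_terms (n : nat) (hs : seq H) (a : seq A) : fsum k (seq A * H) :=
  match n with
  | 0 => if (hs, a) is ([:: h], [::]) then [:: (1, ([::], h))] else [::]
  | m.+1 => fbind (leftA_terms hs a) (fun p =>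
      fmap (fun q => (p.1 :: q.1, q.2)) (F_terms m p.2.1 p.2.2))
  end.

Fixpoint shuffle_terms (n : nat) (hs : seq H) (a : seq A) : fsum k (seq E) :=
  match n with
  | 0 => if (hs, a) is ([::], [::]) then [:: (1, [::])] else [::]
  | m.+1 => fbind (left_terms hs a) (fun p => fmap (cons p.1) (shuffle_terms m p.2.1 p.2.2))
  end.

Section Values.
Variable W : lmodType k.
Implicit Types (K : E -> seq H -> seq A -> W) (KA : A -> seq H -> seq A -> W).

Definition left_op K hs a := ev (fun p => K p.1 p.2.1 p.2.2) (left_terms hs a).
Definition leftA_op KA hs a := ev (fun p => KA p.1 p.2.1 p.2.2) (leftA_terms hs a).
Definition F_op n (K : seq A -> H -> W) hs a := ev (fun p => K p.1 p.2) (F_terms n hs a).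
Definition shuffle_op n (K : seq E -> W) hs a := ev K (shuffle_terms n hs a).

Definition twistA (h : H) KA (z : E) (hs : seq H) (a : seq A) : W :=
  esum (fun c g => KA c (g :: hs) a) ((1 # h) * z).
Definition twist h K := twistA h (fun c => K (c # 1)).

Lemma left_op_nil K : left_op K [::] [::] = 0. Proof. exact: ev_nil. Qed.
Lemma left_op_nil_cons K a1 a : left_op K [::] (a1 :: a) = K (a1 # 1) [::] a.
Proof. by rewrite /left_op ev_seq1 scale1r. Qed.
Lemma left_op_cons K h hs a : left_op K (h :: hs) a = K (1 # h) hs a - left_op (twist h K)
  hs a.
Proof.
rewrite /left_op ev_cons scale1r ev_scale ev_bind scaleN1r; congr (_ - _).
by apply: eq_ev => p; rewrite ev_map /twist /twistA /esum tsum_ev.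
Qed.

Lemma leftA_op_nil KA : leftA_op KA [::] [::] = 0. Proof. exact: ev_nil. Qed.
Lemma leftA_op_nil_cons KA a1 a : leftA_op KA [::] (a1 :: a) = KA a1 [::] a.
Proof. by rewrite /leftA_op ev_seq1 scale1r. Qed.
Lemma leftA_op_cons KA h hs a : leftA_op KA (h :: hs) a = - left_op (twistA h KA) hs a.
Proof.
rewrite /leftA_op /left_op ev_scale ev_bind scaleN1r; congr (- _).
by apply: eq_ev => p; rewrite ev_map /twistA /esum tsum_ev.
Qed.

Lemma F_opS n (K : seq A -> H -> W) hs a :
  F_op n.+1 K hs a = leftA_op (fun x hs' a' => F_op n (fun c => K (x :: c)) hs' a') hs a.
Proof. by rewrite /F_op /= ev_bind; apply: eq_ev => p; rewrite ev_map. Qed.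
Lemma F_op0 (K : seq A -> H -> W) h : F_op 0 K [:: h] [::] = K [::] h.
Proof. by rewrite /F_op /= ev_seq1 scale1r. Qed.
Lemma F_op0_degree (K : seq A -> H -> W) hs a : (size hs + size a != 1)%N ->
  F_op 0 K hs a = 0.
Proof. by case: hs a => [|h [|h' hs]] [|a1 a] //= _; rewrite /F_op /= ev_nil. Qed.

Lemma shuffle_opD n (K K' : seq E -> W) hs a : shuffle_op n (fun s => K s + K' s) hs a =
  shuffle_op n K hs a + shuffle_op n K' hs a.
Proof. exact: evD. Qed.
Lemma shuffle_opN n (K : seq E -> W) hs a : shuffle_op n (fun s => - K s) hs a =
  - shuffle_op n K hs a.
Proof. exact: evN. Qed.
Lemma shuffle_opS n (K : seq E -> W) hs a :
  shuffle_op n.+1 K hs a = left_op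
    (fun x hs' a' => shuffle_op n (fun s => K (x :: s)) hs' a') hs a.
Proof. by rewrite /shuffle_op /= ev_bind; apply: eq_ev => p; rewrite ev_map. Qed.
Lemma shuffle_op0 (K : seq E -> W) : shuffle_op 0 K [::] [::] = K [::].
Proof. by rewrite /shuffle_op /= ev_seq1 scale1r. Qed.
Lemma shuffle_op0_degree (K : seq E -> W) hs a : (size hs + size a != 0)%N ->
  shuffle_op 0 K hs a = 0.
Proof. by case: hs a => [|h hs] [|a1 a] //= _; rewrite /shuffle_op /= ev_nil. Qed.

Lemma eq_left_op K K' hs a : (forall z hs' a', K z hs' a' = K' z hs' a') ->
  left_op K hs a = left_op K' hs a.
Proof. by move=> e; apply: eq_ev => p; rewrite e. Qed.

Lemma left_op_esum (K : A -> H -> E -> seq H -> seq A -> W) (x : E) hs a :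
  left_op (fun z hs' a' => esum (fun c g => K c g z hs' a') x) hs a =
  esum (fun c g => left_op (K c g) hs a) x.
Proof. exact: (@ev_tsum _ _ _ _ _ (fun (p :
E * (seq H * seq A)) c g => K c g p.1 p.2.1 p.2.2)). Qed.

Lemma left_opD K K' hs a : left_op (fun z hs' a' => K z hs' a' + K' z hs' a') hs a =
  left_op K hs a + left_op K' hs a.
Proof. exact: evD. Qed.
Lemma left_opN K hs a : left_op (fun z hs' a' => - K z hs' a') hs a = - left_op K hs a.
Proof. exact: evN. Qed.
Lemma left_opZ c K hs a : left_op (fun z hs' a' => c *: K z hs' a') hs a = c *:
  left_op K hs a.
Proof. exact: evZ. Qed.
Lemma left_opB K K' hs a : left_op (fun z hs' a' => K z hs' a' - K' z hs' a') hs a =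
  left_op K hs a - left_op K' hs a.
Proof. exact: evB. Qed.

(* The products of two consecutive letters of [A] pushed through [hs]: the only
   part of the square of [left_op] that does not cancel. *)
Fixpoint product_op hs K a : W :=
  match hs with
  | [::] => if a is a1 :: a2 :: a' then K ((a1 * a2) # 1) [::] a' else 0
  | h :: hs' => product_op hs' (twist h K) a
  end.

Definition slotlin2 (P : seq H -> seq A -> W) :=
  (forall a, slotlin (P^~ a)) /\ (forall hs, slotlin (P hs)).
Definition slotnorm2 (P : seq H -> seq A -> W) :=
  (forall a, slotnorm (P^~ a)) /\ (forall hs, slotnorm (P hs)).
Definition E_multilinear K := (forall hs a, linear (fun z => K z hs a))
  /\ (forall z, slotlin2 (K z)).
Definition A_multilinear KA := (forall hs a, linear (fun z => KA z hs a))
  /\ (forall z, slotlin2 (KA z)).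

Lemma E_multilinear_A K : E_multilinear K -> A_multilinear (fun c => K (c # 1)).
Proof.
move=> [Kz Ks]; split=> [hs a|z]; last exact: Ks.
exact: (linear_comp (Kz hs a) (cprod_linl _ _)).
Qed.

Lemma A_multilinear_bilin KA hs a : A_multilinear KA -> bilin (fun c g => KA c (g :: hs) a).
Proof. by move=> [Kz Ks]; split=> [g|c]; [apply: Kz | apply: (Ks c).1 [::] hs]. Qed.

Lemma mul_linl (y : E) : linear (fun x : E => x * y).
Proof. by move=> c u v; rewrite mulrDl -scalerAl. Qed.
Lemma mul_linr (x : E) : linear (fun y : E => x * y).
Proof. by move=> c u v; rewrite mulrDr -scalerAr. Qed.

Lemma esum_param (P : lmodType k) (K : P -> A -> H -> W) (x : E) :
  (forall c g, linear (fun p => K p c g)) -> linear (fun p => esum (K p) x).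
Proof. exact: tsum_param. Qed.

Lemma twistA_E_multilinear h KA : A_multilinear KA -> E_multilinear (twistA h KA).
Proof.
move=> K1; have [Kz Ks] := K1; split=> [hs a|z].
  exact: (linear_comp (esum_linear (A_multilinear_bilin hs a K1)) (@mul_linr _)).
split=> [a s1 s2|hs s1 s2]; apply: esum_param => c g.
  exact: ((Ks c).1 a (g :: s1) s2).
exact: (Ks c).2.
Qed.

Lemma twist_E_multilinear h K : E_multilinear K -> E_multilinear (twist h K).
Proof. by move=> K1; apply: twistA_E_multilinear; apply: E_multilinear_A. Qed.

Lemma twistA_linh KA z hs a : A_multilinear KA -> linear (fun h => twistA h KA z hs a).
Proof.
move=> K1; apply: (linear_comp (esum_linear (A_multilinear_bilin hs a K1))).
by apply: (linear_comp (@mul_linl z)); apply: cprod_linr.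
Qed.

End Values.
End LeftPart.

Arguments left_op : simpl never.
Arguments leftA_op : simpl never.
Arguments F_op : simpl never.
Arguments shuffle_op : simpl never.
Arguments rho : simpl never.

Section LeftSquare.
Variables (k : comNzRingType) (H : hopfAlgType k) (A : algType k).
Variables (w : weak_action H A) (f : {linear tensor H H -> A}).
Hypothesis hE : is_crossed_product w f.
Notation E := (crossed_product hE).
Notation "a # h" := (cprod hE a h) (at level 35).
Notation Kfun W := (E -> seq H -> seq A -> W).
Notation KAfun W := (A -> seq H -> seq A -> W).

Section Values.
Variable W : lmodType k.
Implicit Types (K : Kfun W) (KA : KAfun W).

Lemma left_op_slotlin2 K : E_multilinear K -> slotlin2 (left_op K).
Proof.
suff L K0 : E_multilinear K0 -> forall hs, slotlin (left_op K0 hs).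
  move=> Kl; split=> [a s1|hs]; last exact: L.
  elim: s1 K Kl => [|h s1 IH] K Kl s2 c x y; have [Kz Ks] := Kl.
    have K1 hs a' : linear (fun h => K (1 # h) hs a').
      exact: (linear_comp (Kz hs a') (@cprod_linr _ _ _ _ _ hE 1)).
    rewrite /= !left_op_cons K1 scalerBr addrACA; congr (_ + _).
    rewrite -opprD; congr (- _).
    rewrite -ev_lin; apply: eq_ev => p; apply: twistA_linh.
    exact: E_multilinear_A.
  by rewrite /= !left_op_cons (Ks _).1 (IH _ (twist_E_multilinear h Kl))
    scalerBr addrACA -opprD.
move=> Kl hs; elim: hs K0 Kl => [|h hs IH] K0 Kl s1 s2 c x y; have [Kz Ks] := Kl.
  case: s1 => [|a s1] /=; rewrite !left_op_nil_cons.
    by rewrite cprod_linl Kz.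
  exact: (Ks _).2.
by rewrite !left_op_cons (Ks _).2 (IH _ (twist_E_multilinear h Kl)) scalerBr addrACA -opprD.
Qed.

Lemma leftA_op_slotlinA KA h hs : A_multilinear KA -> slotlin (leftA_op hE KA (h :: hs)).
Proof.
move=> Kl s1 s2 c x y; rewrite !leftA_op_cons
  (left_op_slotlin2 (twistA_E_multilinear _ h Kl)).2.
by rewrite opprD scalerN.
Qed.

Lemma leftA_op_slotlinH KA a : A_multilinear KA -> slotlin ((leftA_op hE KA)^~ a).
Proof.
move=> Kl [|h s1] s2 c x y; rewrite /= !leftA_op_cons.
  rewrite scalerN -opprD -ev_lin; congr (- _).
  by apply: eq_ev => p; apply: twistA_linh.
by rewrite (left_op_slotlin2 (twistA_E_multilinear _ h Kl)).1 opprD scalerN.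
Qed.

Lemma leftA_op_slotlin2 KA : A_multilinear KA -> slotlin2 (leftA_op hE KA).
Proof.
move=> Kl; split=> [a|]; first exact: leftA_op_slotlinH.
case=> [|h hs]; last exact: leftA_op_slotlinA.
by case=> [|a s1] s2 c x y /=; rewrite !leftA_op_nil_cons ?Kl.1 // (Kl.2 _).2.
Qed.

Lemma shuffle_op_slotlin2 n (K : seq E -> W) : slotlin K -> slotlin2 (shuffle_op n K).
Proof.
elim: n K => [|n IH] K Kl.
  by split=> [a|hs] s1 s2 c x y; rewrite !shuffle_op0_degree ?scaler0 ?addr0 ?size_cat //=
    ?addnS.
pose K' x := shuffle_op n (fun s => K (x :: s)).
have Kl' : E_multilinear K'.
  split=> [hs a|z]; last by apply: IH; apply: slotlin_cons.
  by apply: ev_param => s; apply: (Kl [::]).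
have [L1 L2] := left_op_slotlin2 Kl'.
by split=> [a|hs] s1 s2 c x y; rewrite !shuffle_opS; [apply: L1 | apply: L2].
Qed.

(** Both sides split [x * y]: on the left [x] is first written as a sum of
    [c # g = (c # 1) * (1 # g)], and only [(1 # g) * y] is split afterwards. *)
Lemma esum_assoc K x y hs a : E_multilinear K ->
  esum (fun c g => esum (fun c' g' => K ((c # 1) * (c' # 1)) (g' :: hs) a) ((1 # g) * y)) x
  = esum (fun c g => K (c # 1) (g :: hs) a) (x * y).
Proof.
move=> Kl; have Bb := A_multilinear_bilin hs a (E_multilinear_A Kl).
have Bl := @esum_linear _ _ _ _ _ hE _ _ Bb.
have E1 c z : esum (fun c' g' => K ((c # 1) * (c' # 1)) (g' :: hs) a) z =
    esum (fun c g => K (c # 1) (g :: hs) a) ((c # 1) * z).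
  move: z; apply: cprod_ext.
  - apply: esum_linear; split=> [g|c'].
      apply: (linear_comp (Kl.1 _ _)); apply: (linear_comp (@mul_linr _ _ _ _ _ hE _)).
      exact: cprod_linl.
    exact: (Kl.2 _).1 _ [::] hs.
  - exact: (linear_comp Bl (@mul_linr _ _ _ _ _ hE _)).
  move=> c' g'; rewrite cprodAl !esumE //; first by rewrite cprodAl.
  by split=> [g|b]; [apply: (linear_comp (Kl.1 _ _));
    apply: (linear_comp (@mul_linr _ _ _ _ _ hE _));
      exact: cprod_linl | exact: (Kl.2 _).1 _ [::] hs].
rewrite -(esum_cprod x (linear_comp Bl (@mul_linl _ _ _ _ _ hE y))).
by apply: eq_esum => c g; rewrite E1 (cprod_decomp hE c g) mulrA.
Qed.

(* Only the products [a1 * a2] survive in the square of [left_op]: all other terms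
   cancel by associativity of the crossed product. *)
Lemma left_op_square K hs a : E_multilinear K ->
  left_op (fun x => left_op (fun y => K (x * y))) hs a = product_op hs K a.
Proof.
elim: hs K => [|h hs IH] K Kl.
  case: a => [|a1 [|a2 a]];
    rewrite ?left_op_nil ?left_op_nil_cons ?left_op_nil ?left_op_nil_cons //.
  by rewrite cprodAl.
rewrite left_op_cons /= -(IH _ (twist_E_multilinear h Kl)); have [Kz Ks] := Kl.
(* Once [(1 # h) * z] is split into terms [c # g], the inner operator expands along the new letter
   [g]. Its head terms regroup to [K ((1 # h) * z)] and cancel the head term of the outer operator;
   the rest is the square for [twist h K]. *)
suff -> : left_op (twist h (fun x => left_op (fun y => K (x * y)))) hs a =
    left_op (fun y => K ((1 # h) * y))
      hs a - left_op (fun x => left_op (fun y => twist h K (x * y))) hs a.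
  by rewrite subKr.
rewrite -left_opB; apply: eq_left_op => z hs2 a2.
rewrite -(esum_cprod ((1 # h) * z) (Kz hs2 a2)).
have -> : left_op (fun y => twist h K (z * y)) hs2 a2 = esum (fun c g =>
    left_op (fun y hs3 a3 => esum (fun c' g' => K ((c # 1) * (c' # 1)) (g' :: hs3) a3)
      ((1 # g) * y)) hs2 a2) ((1 # h) * z).
  by rewrite -left_op_esum; apply: eq_left_op => y hs3 a3; rewrite esum_assoc //
    /twist /twistA mulrA.
rewrite /esum -tsumN -tsumD; apply: eq_tsum => c g.
by rewrite left_op_cons -cprod_decomp.
Qed.
End Values.
End LeftSquare.

Section Bimodule.
Variables (k : comNzRingType) (B : algType k) (M : bimodType B).

Lemma lactlin x : linear (@lact k B M x). Proof. exact: (@lact_bilin k B M).2. Qed.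
Lemma lactlinl m : linear (fun x : B => lact x m : M). Proof. exact:
  (@lact_bilin k B M).1. Qed.
Lemma ractlin x : linear (fun m : M => ract m x). Proof. exact: (@ract_bilin k B M).1. Qed.
Lemma ractlinr m : linear (@ract k B M m). Proof. exact: (@ract_bilin k B M).2. Qed.

End Bimodule.

Section RightPart.
Variables (k : comNzRingType) (H : hopfAlgType k) (A : algType k).
Variables (w : weak_action H A) (f : {linear tensor H H -> A}).
Hypothesis hE : is_crossed_product w f.
Notation E := (crossed_product hE).
Notation "a # h" := (cprod hE a h) (at level 35).

(** Since cochains are functions on lists of all lengths, identities known in a single degree reach
    [left_op] through this congruence. The bound on [size hs'] is what later identifies the index l
    of a component of the differential. *)
Lemma eq_left_op_size (W : lmodType k) (K K' : E -> seq H -> seq A -> W) hs a :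
  (forall z hs' a', (size hs' <= size hs)%N ->
     (size hs' + size a').+1 = (size hs + size a)%N -> K z hs' a' = K' z hs' a') ->
  left_op K hs a = left_op K' hs a.
Proof.
elim: hs K K' => [|h hs IH] K K' e.
  by case: a e => [|a1 a] e; rewrite ?left_op_nil ?left_op_nil_cons ?e.
rewrite !left_op_cons e //; congr (_ - _); apply: IH => z hs' a' le_hs sz.
by apply: eq_esum => c g; rewrite e //= addSn sz.
Qed.

Lemma eq_leftA_op_size (W : lmodType k) (K K' : A -> seq H -> seq A -> W) hs a :
  (forall z hs' a', (size hs' <= size hs)%N ->
     (size hs' + size a').+1 = (size hs + size a)%N -> K z hs' a' = K' z hs' a') ->
  leftA_op hE K hs a = leftA_op hE K' hs a.
Proof.
case: hs => [|h hs] e.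
  by case: a e => [|a1 a] e; rewrite ?leftA_op_nil ?leftA_op_nil_cons ?e.
rewrite !leftA_op_cons; congr (- _); apply: eq_left_op_size => z hs' a' le_hs sz.
by apply: eq_esum => c g; rewrite e //= addSn sz.
Qed.

Lemma eq_shuffle_op (W : lmodType k) n (K K' : seq E -> W) hs a :
  (forall s, size s = n -> K s = K' s) -> shuffle_op n K hs a = shuffle_op n K' hs a.
Proof.
elim: n K K' hs a => [|n IH] K K' hs a e.
  case: (posnP (size hs + size a)) => [|n0]; last by rewrite !shuffle_op0_degree -?lt0n.
  by case: hs a => [|h hs] [|a1 a] //= _; rewrite !shuffle_op0 e.
by rewrite !shuffle_opS; apply: eq_left_op => z hs' a'; apply: IH => s ss; rewrite e //= ss.
Qed.

Lemma eq_F_op (W : lmodType k) n (K K' : seq A -> H -> W) hs a :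
  (forall c y, size c = n -> K c y = K' c y) -> F_op hE n K hs a = F_op hE n K' hs a.
Proof.
elim: n K K' hs a => [|n IH] K K' hs a e; last first.
  rewrite !F_opS; apply: eq_leftA_op_size => z hs' a' _ _.
  by apply: IH => c y sc; rewrite e //= sc.
have [e1|n1] := eqVneq (size hs + size a)%N 1%N; last by rewrite !F_op0_degree.
case: hs a e1 => [|h [|h' hs]] [|a1 a] //= _; last by rewrite !F_op0 e.
by rewrite /F_op /= !ev_nil.
Qed.

(* The terms [(hs', a') (x) y] of the right part, with all signs: the products
   [a_i a_(i+1)], the right multiplication by the last entry of [a], and the maps
   F^(l) for l >= 1, where F^(1)(h (x) a) is [a^h]. *)
Fixpoint right_terms (hs : seq H) (a : seq A) : fsum k ((seq H * seq A) * E) :=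
  match hs with
  | [::] => if a is a1 :: a' then
      fmap (fun p => (([::], p.1), p.2 # 1)) (rho_terms a1 a') else [::]
  | h :: hs' =>
      fscale ((-1) ^+ (size hs' + size a).+1)
        (fmap (fun q => (([::], q.1), 1 # q.2)) (F_terms hE (size hs' + size a) hs a))
      ++ fscale (-1) (fmap (fun p => ((h :: p.1.1, p.1.2), p.2)) (right_terms hs' a))
  end.

Variable M : bimodType E.

Definition ract_base (m : M) (b : A) : M := ract m (b # 1).

Lemma ract_base1 (m : M) : ract_base m 1 = m. Proof. exact: ract1. Qed.

Definition right_op (P : seq H -> seq A -> M) hs a : M :=
  ev (fun p => ract (P p.1.1 p.1.2) p.2) (right_terms hs a).

Lemma right_op_nil P : right_op P [::] [::] = 0. Proof. exact: ev_nil. Qed.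
Lemma right_op_nil_cons P a1 a : right_op P [::] (a1 :: a) = rho ract_base (P [::]) a1 a.
Proof. by rewrite /right_op /= ev_map. Qed.
Lemma right_op_cons P h hs a : right_op P (h :: hs) a =
  (-1) ^+ (size hs + size a).+1 *:
    F_op hE (size hs + size a) (fun c y => ract (P [::] c) (1 # y)) (h :: hs) a
  - right_op (fun hs' => P (h :: hs')) hs a.
Proof. by rewrite /right_op /= ev_cat !ev_scale !ev_map scaleN1r. Qed.

Lemma eq_right_op_size P P' hs a :
  (forall hs' a', (size hs' <= size hs)%N ->
     (size hs' + size a').+1 = (size hs + size a)%N -> P hs' a' = P' hs' a') ->
  right_op P hs a = right_op P' hs a.
Proof.
elim: hs P P' => [|h hs IH] P P' e.
  case: a e => [|a1 a] e; first by rewrite !right_op_nil.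
  by rewrite !right_op_nil_cons; apply: eq_rho => t st; apply: e; rewrite //= st.
rewrite !right_op_cons; congr (_ *: _ - _).
  by apply: eq_F_op => c y sc; rewrite e //= sc addSn.
by apply: IH => hs' a' le_hs sz; rewrite e //= addSn sz.
Qed.

Lemma right_opD P P' hs a : right_op (fun h x => P h x + P' h x) hs a = right_op P hs a +
  right_op P' hs a.
Proof. by rewrite /right_op -evD; apply: eq_ev => p; rewrite (linD (ractlin _)). Qed.
Lemma right_opN P hs a : right_op (fun h x => - P h x) hs a = - right_op P hs a.
Proof. by rewrite /right_op -evN; apply: eq_ev => p; rewrite (linN (ractlin _)). Qed.
Lemma right_op_esum (P : A -> H -> seq H -> seq A -> M) (x : E) hs a :
  right_op (fun h' a' => esum (fun c g => P c g h' a') x) hs a =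
    esum (fun c g => right_op (P c g) hs a) x.
Proof.
rewrite /right_op /esum -ev_tsum; apply: eq_ev => p.
by rewrite (tsum_comp _ _ (ractlin _)).
Qed.

Arguments right_op : simpl never.

(** The two parts work at opposite ends of a word and anticommute, with two points of contact. When
    no letter of H is left, the product [a1 * a2] in the right part changes the letter read by the
    left part, which leaves [product_op]. When F consumes the whole word, the left part reads the
    first letter emitted by F, and the recursion for F accounts for it. *)
Lemma right_op_left_op (P : E -> seq H -> seq A -> M) hs a :
  right_op (left_op P) hs a = - left_op (fun x => right_op (P x)) hs a - product_op hs P a.
Proof.
elim: hs P => [|h hs IH] P.
  case: a => [|a1 [|a2 a]] /=.
  - by rewrite right_op_nil left_op_nil subr0 oppr0.
  - by rewrite right_op_nil_cons rho_nil left_op_nil left_op_nil_cons right_op_nil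
    /ract_base (lin0 (ractlin _)) subr0.
  - rewrite right_op_nil_cons rho_cons !left_op_nil_cons.
    rewrite right_op_nil_cons {1}/ract_base -[1 # 1]/(1 : E) ract1 addrC; congr (- _ - _).
    by apply: eq_rho => t _; rewrite left_op_nil_cons.
rewrite right_op_cons.
have -> : right_op (fun hs' => left_op P (h :: hs')) hs a = right_op (P (1 # h))
  hs a - right_op (left_op (twist h P)) hs a.
  by rewrite -right_opN -right_opD; apply: eq_right_op_size => hs' a' _ _;
    rewrite left_op_cons.
rewrite IH left_op_cons /=.
suff -> : left_op (twist h (fun x => right_op (P x))) hs a =
    (-1) ^+ (size hs + size a).+1 *: F_op hE (size hs + size a)
      (fun c y => ract (left_op P [::] c) (1 # y)) (h :: hs) a
    - left_op (fun x => right_op (twist h P x)) hs a.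
  by rewrite !opprB !addrA addrAC.
have [e0|n0] := posnP (size hs + size a)%N.
  case: hs a {IH} e0 => [|h' hs] [|a1 a] //= _.
  by rewrite !left_op_nil F_op0 left_op_nil (lin0 (ractlin _)) scaler0 subr0.
set m := (size hs + size a).-1.
have em : (size hs + size a)%N = m.+1 by rewrite prednK.
rewrite em F_opS leftA_op_cons exprS mulN1r scaleNr scalerN opprK -left_opZ -left_opB.
apply: eq_left_op_size => z hs2 a2 _; rewrite em => -[sz].
rewrite {2}/twist /twistA right_op_esum /twist /twistA /esum -tsumZ -tsumN -tsumD.
apply: eq_tsum => c g; rewrite right_op_cons sz; congr (_ *: _ - _).
by apply: eq_F_op => c' y _; rewrite left_op_nil_cons.
Qed.

End RightPart.

(** * The bar complex and its restriction to mixed words *)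

Section Bar.
Variables (k : comNzRingType) (B : algType k) (M : bimodType B).
Implicit Types P : seq B -> M.

Definition rhoM P e s : M := rho (@ract k B M) P e s.

Definition bar P (s : seq B) : M :=
  if s is e :: s' then lact e (P s') + rhoM P e s' else 0.

Lemma eq_bar P P' s : (forall t, (size t).+1 = size s -> P t = P' t) -> bar P s = bar P' s.
Proof.
case: s => [|e s] pp //=; rewrite pp //; congr (_ + _).
by apply: eq_rho => t st; rewrite pp ?st.
Qed.

Lemma rhoM_nil P e : rhoM P e [::] = - ract (P [::]) e.
Proof. exact: rho_nil. Qed.
Lemma rhoM_cons P e e2 s :
  rhoM P e (e2 :: s) = - P (e * e2 :: s) - rhoM (fun t => P (e :: t)) e2 s.
Proof. by rewrite /rhoM rho_cons ract1. Qed.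

Lemma rhoMD P P' e s : rhoM (fun t => P t + P' t) e s = rhoM P e s + rhoM P' e s.
Proof. by rewrite /rhoM /rho -evD; apply: eq_ev => p; rewrite (linD (ractlin _)). Qed.
Lemma rhoMN P e s : rhoM (fun t => - P t) e s = - rhoM P e s.
Proof. by rewrite /rhoM /rho -evN; apply: eq_ev => p; rewrite (linN (ractlin _)). Qed.
Lemma rhoM_lact P x e s : rhoM (fun t => lact x (P t)) e s = lact x (rhoM P e s).
Proof.
rewrite /rhoM /rho (ev_linear _ _ (lactlin x)); apply: eq_ev => p.
by rewrite lractA.
Qed.

Lemma rhoM_rhoM P e1 e2 s : rhoM (rhoM P e1) e2 s = - rhoM P (e1 * e2) s.
Proof.
elim: s P e1 e2 => [|e3 s IH] P e1 e2.
  by rewrite !rhoM_nil (linN (ractlin _)) ractA !opprK.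
rewrite rhoM_cons rhoM_cons opprD !opprK.
have -> : rhoM (fun t => rhoM P e1 (e2 :: t)) e3 s =
    rhoM (fun t => - P (e1 * e2 :: t)) e3 s - rhoM (rhoM (fun t => P (e1 :: t)) e2) e3 s.
  by rewrite -rhoMN -rhoMD; apply: eq_rho => t _; rewrite rhoM_cons.
by rewrite IH rhoMN rhoM_cons !opprD !opprK mulrA -!addrA; congr (_ + _);
  rewrite addrCA subrr addr0.
Qed.

Lemma bar_bar P s : bar (bar P) s = 0.
Proof.
case: s => [|e1 [|e2 s]] //=.
  by rewrite rhoM_nil /= (lin0 (lactlin _)) (lin0 (ractlin _)) subr0.
rewrite rhoM_cons /=.
have -> : rhoM (fun t => lact e1 (P t) + rhoM P e1 t) e2 s =
    lact e1 (rhoM P e2 s) + rhoM (rhoM P e1) e2 s.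
  by rewrite rhoMD rhoM_lact.
rewrite rhoM_rhoM (linD (lactlin _)) lactA opprD [- (_ - _)]opprD opprK addrACA.
by rewrite !addrA subrr add0r addrK addNr.
Qed.

(** Makes the head letter of [rhoM] a slot like the others, so that one induction on the prefix
    covers all positions. *)
Let rr P (s : seq B) : M := if s is e :: s' then rhoM P e s' else 0.

Let rr_slotlin P : slotlin P -> slotlin (rr P).
Proof.
move=> Pl s1; elim: s1 P Pl => [|e s1 IH] P Pl [|e2 s2] c x y /=.
- by rewrite !rhoM_nil ractlinr opprD scalerN.
- rewrite !rhoM_cons mulrDl -scalerAl (Pl [::]).
  have -> : rhoM (fun t => P (c *: x + y :: t)) e2 s2 =
      c *: rhoM (fun t => P (x :: t)) e2 s2 + rhoM (fun t => P (y :: t)) e2 s2.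
    rewrite /rhoM /rho -ev_lin; apply: eq_ev => p.
    by rewrite (Pl [::]) (ractlin _).
  by rewrite scalerBr scalerN addrACA -!opprD.
- case: s1 IH => [|b s1] IH /=; rewrite !(rhoM_cons P).
    have /= -> := IH _ (slotlin_cons e Pl) [::] c x y.
    rewrite mulrDr -scalerAr (Pl [::]).
    by rewrite scalerBr scalerN addrACA -!opprD.
  have /= -> := IH _ (slotlin_cons e Pl) [::] c x y.
  rewrite (Pl (e * b :: s1)).
  by rewrite scalerBr scalerN addrACA -!opprD.
- case: s1 IH => [|b s1] IH /=; rewrite !(rhoM_cons P).
    have /= -> := IH _ (slotlin_cons e Pl) (e2 :: s2) c x y.
    rewrite mulrDr -scalerAr (Pl [::]).
    by rewrite scalerBr scalerN addrACA -!opprD.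
  have /= -> := IH _ (slotlin_cons e Pl) (e2 :: s2) c x y.
  rewrite (Pl (e * b :: s1)).
  by rewrite scalerBr scalerN addrACA -!opprD.
Qed.

Lemma bar_slotlin P : slotlin P -> slotlin (bar P).
Proof.
move=> Pl [|e s1] s2 c x y.
  have /= -> := rr_slotlin Pl [::] s2 c x y.
  by rewrite lactlinl scalerDr addrACA.
have /= -> := rr_slotlin Pl (e :: s1) s2 c x y.
by rewrite Pl lactlin scalerDr addrACA.
Qed.

Let rho0 (e : B) (s : seq B) : rhoM (fun _ => 0) e s = 0.
Proof.
by rewrite /rhoM /rho -[RHS](ev0 M (rho_terms e s)); apply: eq_ev => p;
  rewrite (lin0 (ractlin _)).
Qed.

Lemma rhoM_1 P s : slotnorm P -> rhoM P 1 s = - P s.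
Proof.
move=> Pn; case: s => [|e s]; first by rewrite rhoM_nil ract1.
rewrite rhoM_cons mul1r -[RHS]addr0; congr (_ + _).
rewrite -oppr0 -(rho0 e s); congr (- _); apply: eq_rho => t _; exact: (Pn [::] t).
Qed.

Lemma rhoM_norm P e s1 s2 : slotnorm P -> rhoM P e (s1 ++ 1 :: s2) = 0.
Proof.
elim: s1 P e => [|b s1 IH] P e Pn /=; rewrite rhoM_cons.
  rewrite mulr1 rhoM_1; last exact: slotnorm_cons.
  by rewrite subrr.
by rewrite (Pn (e * b :: s1)) (IH _ _ (slotnorm_cons e Pn)) oppr0 addr0.
Qed.

Lemma bar_norm P : slotnorm P -> slotnorm (bar P).
Proof.
move=> Pn [|e s1] s2 /=; first by rewrite lact1 rhoM_1 ?subrr.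
by rewrite Pn (lin0 (lactlin _)) rhoM_norm ?addr0.
Qed.

End Bar.

Section ChainMap.
Variables (k : comNzRingType) (H : hopfAlgType k) (A : algType k).
Variables (w : weak_action H A) (f : {linear tensor H H -> A}).
Hypothesis hE : is_crossed_product w f.
Notation E := (crossed_product hE).
Notation "a # h" := (cprod hE a h) (at level 35).

Definition shuffle (W : lmodType k) (P : seq E -> W) hs a := shuffle_op (size hs + size a)
  P hs a.

Lemma shuffle_step (W : lmodType k) (P : seq E -> W) hs a : (0 < size hs + size a)%N ->
  shuffle P hs a = left_op (fun x => shuffle (fun s => P (x :: s))) hs a.
Proof.
case E0 : (size hs + size a)%N => [|n] // _; rewrite /shuffle E0 shuffle_opS.
by apply: eq_left_op_size => z hs' a' _; rewrite E0 => -[->].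
Qed.

Lemma eq_product_op_size (W : lmodType k) (K K' : E -> seq H -> seq A -> W) hs a :
  (forall z hs' a', (size hs' + size a').+2 = (size hs + size a)%N -> K z hs' a' =
    K' z hs' a') ->
  product_op hs K a = product_op hs K' a.
Proof.
elim: hs K K' => [|h hs IH] K K' e /=.
  by case: a e => [|a1 [|a2 a]] e //; rewrite e.
by apply: IH => z hs' a' sz; apply: eq_esum => c g; rewrite e //= addSn sz.
Qed.

Variable M : bimodType E.
Implicit Types (P : seq E -> M) (Q : seq H -> seq A -> M).

(* The total differential of Xhat, up to the signs [(-1) ^+ (r * s)]. *)
Definition mixed_diff Q hs a : M := left_op (fun x hs' a' => lact x (Q hs' a')) hs a +
  right_op Q hs a.

Lemma eq_mixed_diff_size Q Q' hs a :
  (forall hs' a', (size hs' <= size hs)%N ->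
     (size hs' + size a').+1 = (size hs + size a)%N -> Q hs' a' = Q' hs' a') ->
  mixed_diff Q hs a = mixed_diff Q' hs a.
Proof.
move=> e; congr (_ + _); last exact: eq_right_op_size.
by apply: eq_left_op_size => z hs' a' le_hs sz; rewrite e.
Qed.

(** Induction on the degree. With [shuffle] expanded once under [right_op], [right_op_left_op]
    produces a lower right part and the products of two letters, and [left_op_square] rewrites these
    products with two nested [left_op]. The two contributions are the two terms of [rhoM_cons]. *)
Lemma shuffle_op_rhoM n P hs a : slotlin P -> (size hs + size a)%N = n.+1 ->
  left_op (fun x => shuffle_op n (rhoM P x)) hs a = right_op (shuffle P) hs a.
Proof.
elim: n P hs a => [|n IH] P hs a Pl sz.
  case: hs a sz => [|h [|h' hs]] [|a1 [|a2 a]] //= _.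
    by rewrite left_op_nil_cons shuffle_op0 right_op_nil_cons rhoM_nil rho_nil /shuffle /=
      shuffle_op0.
  rewrite left_op_cons left_op_nil shuffle_op0 rhoM_nil right_op_cons right_op_nil F_op0
    /shuffle /= shuffle_op0.
  by rewrite scaleN1r.
pose K z := shuffle_op n (fun s => P (z :: s)).
have Kl : E_multilinear K.
  split=> [hs' a'|z]; last by apply: shuffle_op_slotlin2; apply: slotlin_cons.
  by apply: ev_param => s; apply: (Pl [::]).
have -> : right_op (shuffle P) hs a =
  right_op (left_op (fun x => shuffle (fun s => P (x :: s)))) hs a.
  by apply: eq_right_op_size => hs' a' _; rewrite sz => -[e]; rewrite shuffle_step // e.
rewrite right_op_left_op.
have -> : product_op hs (fun x => shuffle (fun s => P (x :: s))) a = product_op hs K a.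
  by apply: eq_product_op_size => z hs' a'; rewrite sz /shuffle => -[->].
rewrite -left_op_square // -left_opN -left_opB.
apply: eq_left_op_size => x hs' a' _; rewrite sz => -[sz'].
rewrite -(IH _ _ _ (slotlin_cons x Pl) sz') shuffle_opS -left_opN -left_opB; apply:
  eq_left_op => y hs2 a2.
rewrite /K -!shuffle_opN -shuffle_opD.
by apply: eq_ev => s; rewrite rhoM_cons addrC.
Qed.

Theorem shuffle_bar P hs a : slotlin P -> shuffle (bar P) hs a = mixed_diff (shuffle P)
  hs a.
Proof.
move=> Pl; case E0 : (size hs + size a)%N => [|n].
  case: hs a E0 => [|h hs] [|a1 a] //= _.
  by rewrite /shuffle /= shuffle_op0 /mixed_diff left_op_nil right_op_nil addr0.
rewrite /mixed_diff -(shuffle_op_rhoM Pl E0) -left_opD /shuffle E0 shuffle_opS; apply: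
  eq_left_op_size => x hs' a' _.
rewrite E0 => -[->]; rewrite {1}/shuffle_op evD; congr (_ + _).
by rewrite /shuffle_op (ev_linear _ _ (lactlin x)).
Qed.

End ChainMap.

(** * Normalization, and an explicit right inverse of the restriction to mixed words *)

Section RightInverse.
Variables (k : comNzRingType) (H : hopfAlgType k) (A : algType k).
Variables (w : weak_action H A) (f : {linear tensor H H -> A}).
Hypothesis hE : is_crossed_product w f.
Notation E := (crossed_product hE).
Notation "a # h" := (cprod hE a h) (at level 35).

Section Values.
Variable W : lmodType k.
Implicit Types (K : E -> seq H -> seq A -> W) (KA : A -> seq H -> seq A -> W).

Lemma eq_spl0 (K : A -> H -> W) (x : E) : (forall a h, K a h = 0) -> esum K x = 0.
Proof. by move=> K0; rewrite (eq_esum _ K0) /esum tsum0. Qed.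

Lemma left_op_zero hs a : left_op (fun (_ : E) _ _ => 0 : W) hs a = 0.
Proof. exact: ev0. Qed.

Lemma left_op_vanish K hs a : (forall c hs a, K (c # 1) hs a = 0) ->
  (forall h hs a, K (1 # h) hs a = 0) -> left_op K hs a = 0.
Proof.
move=> K1 K2; case: hs => [|h hs].
  by case: a => [|a1 a]; rewrite ?left_op_nil ?left_op_nil_cons.
rewrite left_op_cons K2 sub0r; apply/eqP; rewrite oppr_eq0; apply/eqP.
by rewrite -[RHS](left_op_zero hs a); apply: eq_left_op => z hs2 a2; apply: eq_spl0.
Qed.

Lemma left_op_vanish_cons K h0 hs a : (forall c h hs a, K (c # 1) (h :: hs) a = 0) ->
  (forall h hs a, K (1 # h) hs a = 0) -> left_op K (h0 :: hs) a = 0.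
Proof.
move=> K1 K2; rewrite left_op_cons K2 sub0r; apply/eqP; rewrite oppr_eq0; apply/eqP.
by rewrite -[RHS](left_op_zero hs a); apply: eq_left_op => z hs2 a2; apply: eq_spl0.
Qed.

Lemma twistA_A h KA c hs a : A_multilinear KA ->
  twistA h KA (c # 1) hs a = sw2 h (fun x y => KA (w x c) (y :: hs) a).
Proof.
move=> Kl; have B := A_multilinear_bilin hs a Kl.
rewrite /twistA cprodHA /sw2 (tsum_comp _ _ (@esum_linear _ _ _ _ _ hE _ _ B)).
by apply: eq_tsum => x y; rewrite esumE.
Qed.

Lemma twistA_H h g KA hs a : A_multilinear KA ->
  twistA h KA (1 # g) hs a =
    sw2 h (fun x1 x2 => sw2 g (fun y1 y2 => KA (f2 f x1 y1) (x2 * y2 :: hs) a)).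
Proof.
move=> Kl; have B := A_multilinear_bilin hs a Kl; have Bl := @esum_linear _ _ _ _ _ hE _ _
  B.
rewrite /twistA cprodHH /sw2 (tsum_comp _ _ Bl).
apply: eq_tsum => x1 x2; rewrite (tsum_comp _ _ Bl).
by apply: eq_tsum => y1 y2; rewrite esumE.
Qed.

Lemma twistA_1 h KA hs a : A_multilinear KA -> twistA h KA (1 : E) hs a = KA 1 (h :: hs) a.
Proof. by move=> Kl; rewrite /twistA mulr1 esumE //; apply: A_multilinear_bilin. Qed.

Lemma twistA_1A KA c hs a : A_multilinear KA -> twistA 1 KA (c # 1) hs a = KA c (1 :: hs) a.
Proof. by move=> Kl; rewrite /twistA mul1r esumE //; apply: A_multilinear_bilin. Qed.

Lemma twistA_1H KA h hs a : A_multilinear KA -> twistA 1 KA (1 # h) hs a = KA 1 (h :: hs) a.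
Proof. by move=> Kl; rewrite /twistA mul1r esumE //; apply: A_multilinear_bilin. Qed.

(** A letter [1] of the word has three possible fates: it stays in the word, it becomes the
    coefficient, or it is absorbed by a neighbour, which leaves [1] as coefficient. Each of them is
    killed by a hypothesis. *)
Lemma left_op_normH K a : E_multilinear K -> (forall hs a, K 1 hs a = 0) ->
  (forall z a, slotnorm ((K z)^~ a)) -> slotnorm ((left_op K)^~ a).
Proof.
move=> + + + s1; elim: s1 K => [|h s1 IH] K Kl K1 Kn s2 /=; have KA := E_multilinear_A Kl.
  rewrite left_op_cons K1 sub0r left_op_vanish ?oppr0 // => [c|h] hs' a'.
    by rewrite /twist twistA_1A //; apply: (Kn _ _ [::]).
  by rewrite /twist twistA_1H // K1.
rewrite left_op_cons (Kn _ _ s1) (IH (twist h K)) ?subr0 //.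
- exact: twist_E_multilinear.
- by move=> hs' a'; rewrite /twist twistA_1 // K1.
- by move=> z a' t1 t2; apply: eq_spl0 => c g; apply: (Kn _ _ (g :: t1)).
Qed.

Lemma left_op_normA K hs : E_multilinear K -> (forall hs a, K 1 hs a = 0) ->
  (forall z hs, slotnorm (K z hs)) -> slotnorm (left_op K hs).
Proof.
elim: hs K => [|h hs IH] K Kl K1 Kn s1 s2; have KA := E_multilinear_A Kl.
  by case: s1 => [|b s1] /=; rewrite left_op_nil_cons ?K1 //; apply: Kn.
rewrite left_op_cons Kn (IH (twist h K)) ?subr0 //.
- exact: twist_E_multilinear.
- by move=> hs' a'; rewrite /twist twistA_1 // K1.
- by move=> z hs' t1 t2; apply: eq_spl0 => c g; apply: Kn.
Qed.

(** The one-letter word is excluded because normalization fails there at the start of the recursion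
    for F: [F_op 0 K [:: 1] [::]] is [K [::] 1]. *)
Lemma leftA_op_normH KA a s1 s2 : A_multilinear KA -> (forall hs a, KA 1 hs a = 0) ->
  (forall z a s1 s2, (0 < size s1 + size s2)%N -> KA z (s1 ++ 1 :: s2) a = 0) ->
  (0 < size s1 + size s2)%N -> leftA_op hE KA (s1 ++ 1 :: s2) a = 0.
Proof.
move=> Kl K1 Kn; case: s1 => [|h s1] /= sz; rewrite leftA_op_cons.
  case: s2 sz => // h s2 _; rewrite left_op_vanish_cons ?oppr0 // => [c g hs a'|g hs a'].
    by rewrite twistA_1A // (Kn _ _ [::]).
  by rewrite twistA_1H // K1.
rewrite left_op_normH ?oppr0 //.
- exact: twistA_E_multilinear.
- by move=> hs' a'; rewrite twistA_1 // K1.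
- by move=> z a' t1 t2; apply: eq_spl0 => c g; apply: (Kn _ _ (g :: t1)).
Qed.

Lemma leftA_op_normA KA hs : A_multilinear KA -> (forall hs a, KA 1 hs a = 0) ->
  (forall z hs, slotnorm (KA z hs)) -> slotnorm (leftA_op hE KA hs).
Proof.
move=> Kl K1 Kn; case: hs => [|h hs] s1 s2.
  by case: s1 => [|b s1] /=; rewrite leftA_op_nil_cons ?K1 //; apply: Kn.
rewrite leftA_op_cons left_op_normA ?oppr0 //.
- exact: twistA_E_multilinear.
- by move=> hs' a'; rewrite twistA_1 // K1.
- by move=> z hs' t1 t2; apply: eq_spl0 => c g; apply: Kn.
Qed.

Lemma F_op_linH n (K : seq A -> H -> W) : (forall y, slotlin (K^~ y)) ->
  (forall c, linear (K c)) -> slotlin2 (F_op hE n K).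
Proof.
elim: n K => [|n IH] K Kc Ky.
  split=> [a|hs] s1 s2 c x y.
    have [e1|n1] := eqVneq (size (s1 ++ x :: s2) + size a)%N 1%N; last first.
      by rewrite !F_op0_degree ?scaler0 ?addr0 //; move: n1; rewrite !size_cat.
    case: s1 s2 a e1 => [|h s1] [|h2 s2] [|a1 a] //=; rewrite ?size_cat /= ?addnS //.
    by rewrite !F_op0 Ky.
  have [e1|n1] := eqVneq (size hs + size (s1 ++ x :: s2))%N 1%N; last first.
    by rewrite !F_op0_degree ?scaler0 ?addr0 //; move: n1; rewrite !size_cat.
  by case: hs e1 => [|h hs]; rewrite /= size_cat /= ?addnS //; case: s1 => [|b s1];
    case: s2 => [|b' s2] //; rewrite /F_op /= !ev_nil scaler0 addr0.
pose K' x := F_op hE n (fun c => K (x :: c)).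
have Kl : A_multilinear K'.
  split=> [hs a|z]; last by apply: IH => *;
    [apply: (@slotlin_cons _ _ _ (K^~ _)) | apply: Ky].
  by apply: ev_param => p; apply: (Kc _ [::]).
have [L1 L2] := leftA_op_slotlin2 hE Kl.
by split=> [a|hs] s1 s2 c x y; rewrite !F_opS; [apply: L1 | apply: L2].
Qed.

Lemma RF0_cons (K : seq A -> H -> W) hs s1 x s2 : F_op hE 0 K hs (s1 ++ x :: s2) = 0.
Proof. by case: hs => [|h [|h' hs]]; case: s1 => [|b s1] //=; rewrite /F_op /= ev_nil. Qed.

Lemma F_op_norm n (K : seq A -> H -> W) : (forall y, slotlin (K^~ y)) ->
  (forall c, linear (K c)) -> (forall y, slotnorm (K^~ y)) ->
  (forall a s1 s2, (0 < size s1 + size s2)%N -> F_op hE n K (s1 ++ 1 :: s2) a = 0) /\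
  (forall hs, slotnorm (F_op hE n K hs)).
Proof.
elim: n K => [|n IH] K Kc Ky Kn.
  split=> [a s1 s2|hs] sz; last by move=> s2; rewrite RF0_cons.
  by rewrite F_op0_degree // size_cat /= addnS addSn eqSS -lt0n ltn_addr.
pose K' x := F_op hE n (fun c => K (x :: c)).
have Kx x : (forall y, slotlin (fun c => K (x :: c) y)) by move=> y; apply:
  (@slotlin_cons _ _ _ (K^~ y)).
have Kl : A_multilinear K'.
  split=> [hs a|z]; last by apply: F_op_linH => *; [apply: Kx | apply: Ky].
  by apply: ev_param => p; apply: (Kc _ [::]).
have K1 hs a : K' 1 hs a = 0.
  by rewrite /K' /F_op -[RHS](ev0 W (F_terms hE n hs a)); apply: eq_ev => p; apply:
    (Kn _ [::]).
have Nx x y : slotnorm (fun c => K (x :: c) y) by apply: (@slotnorm_cons _ _ _ (K^~ y)).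
have IH' x := IH (fun c => K (x :: c)) (Kx x) (fun c => Ky _) (Nx x).
split=> [a s1 s2 sz|hs s1 s2]; rewrite F_opS.
  by rewrite (leftA_op_normH _ Kl) // => z a' t1 t2; apply: (IH' z).1.
by rewrite (leftA_op_normA _ Kl) // => z hs'; apply: (IH' z).2.
Qed.

Lemma shuffle_op_norm n (P : seq E -> W) : slotlin P -> slotnorm P ->
  slotnorm2 (shuffle_op n P).
Proof.
elim: n P => [|n IH] P Pl Pn.
  by split=> [a|hs] s1 s2; rewrite shuffle_op0_degree // size_cat /=; lia.
pose K x := shuffle_op n (fun s => P (x :: s)).
have Kl : E_multilinear K.
  split=> [hs a|z]; last by apply: shuffle_op_slotlin2; apply: slotlin_cons.
  by apply: ev_param => s; apply: (Pl [::]).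
have K1 hs a : K 1 hs a = 0.
  by rewrite /K /shuffle_op -[RHS](ev0 W (shuffle_terms hE n hs a)); apply: eq_ev => p;
    apply: (Pn [::]).
have IH' x := IH _ (slotlin_cons x Pl) (slotnorm_cons x Pn).
split=> [a|hs] s1 s2; rewrite shuffle_opS.
  by rewrite (left_op_normH _ Kl) // => z a'; apply: (IH' z).1.
by rewrite (left_op_normA _ Kl) // => z hs'; apply: (IH' z).2.
Qed.

End Values.

Definition E_cochain (W : lmodType k) (P : seq E -> W) := slotlin P /\ slotnorm P.
Definition HA_cochain (W : lmodType k) (Q : seq H -> seq A -> W) :=
  slotlin2 Q /\ slotnorm2 Q.

Lemma shuffle_cochain (W : lmodType k) (P : seq E -> W) : E_cochain P ->
  HA_cochain (shuffle P).
Proof.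
move=> [Pl Pn]; split; split=> [a|hs] s1 s2.
- move=> c x y; rewrite /shuffle !size_cat /=; exact: (shuffle_op_slotlin2 _ Pl).1.
- move=> c x y; rewrite /shuffle !size_cat /=; exact: (shuffle_op_slotlin2 _ Pl).2.
- exact: (shuffle_op_norm _ Pl Pn).1.
- exact: (shuffle_op_norm _ Pl Pn).2.
Qed.

Variable M : bimodType E.
Implicit Types (P : seq E -> M) (Q : seq H -> seq A -> M).

(** A letter [c # h] counts as the letter [c] of [A], when no letter of [H] follows, plus [c] acting
    on the value at the word that starts with [h]. For a normalized [Q] the first part vanishes at
    [1 # h] and the second at [c # 1]. *)
Definition peel Q (x : E) (hs : seq H) (a : seq A) : M :=
  esum (fun c h => (if hs is [::] then counit h *: Q [::] (c :: a) else 0)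
    + lact (c # 1) (Q (h :: hs) a)) x.

Fixpoint shuffle_section Q (s : seq E) : M := if s is e :: s'
  then shuffle_section (peel Q e) s' else Q [::] [::].

Lemma lact_cprod_lin (m : M) : linear (fun c => lact (c # 1) m).
Proof. exact: (linear_comp (lactlinl m) (cprod_linl _ _)). Qed.

Lemma peel_bilin Q hs a : slotlin2 Q -> bilin (fun c h =>
  (if hs is [::] then counit h *: Q [::] (c :: a) else 0) + lact (c # 1) (Q (h :: hs) a)).
Proof.
move=> [Q1 Q2]; split=> [h|c]; apply: linear_add.
- case: hs => [|_ _]; last exact: linear_zero.
  by apply: (linear_scale _ (Q2 _ [::] a)).
- exact: lact_cprod_lin.
- case: hs => [|_ _]; last exact: linear_zero.
  exact: counit_lin.
- exact: (linear_comp (lactlin _) (Q1 _ [::] hs)).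
Qed.

Lemma peelE Q c h hs a : slotlin2 Q -> peel Q (c # h) hs a =
  (if hs is [::] then counit h *: Q [::] (c :: a) else 0) + lact (c # 1) (Q (h :: hs) a).
Proof. by move=> Ql; rewrite /peel esumE //; apply: peel_bilin. Qed.

Lemma peel_cochain Q x : HA_cochain Q -> HA_cochain (peel Q x).
Proof.
move=> [[Q1 Q2] [N1 N2]]; split; split=> [a|hs] s1 s2.
- apply: esum_param => c h; apply: linear_add.
    by case: s1 => [|? ?]; apply: linear_zero.
  exact: (linear_comp (lactlin _) (Q1 _ (h :: s1) s2)).
- apply: esum_param => c h; apply: linear_add.
    case: hs => [|_ _]; last exact: linear_zero.
    exact: (linear_scale _ (Q2 _ (c :: s1) s2)).
  exact: (linear_comp (lactlin _) (Q2 _ s1 s2)).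
- apply: eq_spl0 => c h; rewrite (N1 _ (h :: s1)) (lin0 (lactlin _)) addr0.
  by case: s1.
- apply: eq_spl0 => c h; rewrite (N2 _ s1) (lin0 (lactlin _)) addr0.
  by case: hs => //; rewrite (N2 _ (c :: s1)) scaler0.
Qed.

Lemma peel1 Q hs a : HA_cochain Q -> peel Q 1 hs a = 0.
Proof.
move=> [Ql [N1 N2]]; rewrite /peel esumE; last exact: peel_bilin.
rewrite (N1 _ [::]) (lin0 (lactlin _)) addr0.
by case: hs => //; rewrite (N2 _ [::]) scaler0.
Qed.

(* [peel Q] is the cochain whose [left_op] is [Q]: the two kinds of letters [1 # h]
   and [a # 1] must produce [Q (h :: hs) a] and [Q [::] (a :: a')]. *)
Lemma left_op_peel Q hs a : HA_cochain Q -> (0 < size hs + size a)%N -> left_op (peel Q)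
  hs a = Q hs a.
Proof.
move=> Qc; have [Ql [N1 N2]] := Qc; case: hs => [|h hs].
  case: a => // a1 a _; rewrite left_op_nil_cons peelE //.
  by rewrite counit1 scale1r (N1 _ [::]) (lin0 (lactlin _)) addr0.
move=> _; rewrite left_op_cons peelE //.
rewrite -[_ # _]/(1 : E) lact1.
have -> : left_op (twist h (peel Q)) hs a = 0.
  rewrite -[RHS](left_op_zero M hs a); apply: eq_left_op => z hs2 a2; apply: eq_spl0 => c g.
  by rewrite peelE // (N1 _ [::]) (lin0 (lactlin _)) addr0.
rewrite subr0; case: hs => [|h' hs']; last by rewrite add0r.
by rewrite (N2 _ [::]) scaler0 add0r.
Qed.

Lemma shuffle_section_lin (V : lmodType k) (Q : V -> seq H -> seq A -> M) s :
  (forall hs a, linear (fun v => Q v hs a)) -> linear (fun v => shuffle_section (Q v) s).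
Proof.
elim: s Q => [|e s IH] Q Ql /=; first exact: Ql.
apply: IH => hs a; apply: esum_param => c h; apply: linear_add.
  by case: hs => [|_ _]; [apply: linear_scale | apply: linear_zero].
exact: (linear_comp (lactlin _) (Ql _ _)).
Qed.

Lemma peel_linear Q hs a : slotlin2 Q -> linear (fun x => peel Q x hs a).
Proof. by move=> Ql; apply: esum_linear; apply: peel_bilin. Qed.

Lemma shuffle_section_cochain Q : HA_cochain Q -> E_cochain (shuffle_section Q).
Proof.
move=> Qc; split=> s1; elim: s1 Q Qc => [|e s1 IH] Q Qc s2.
- by apply: shuffle_section_lin => hs a; apply: peel_linear; exact: Qc.1.
- exact: (IH _ (peel_cochain e Qc)).
- rewrite /=; have -> : peel Q 1 = fun _ _ => 0.
    by apply/funext=> hs; apply/funext=> a; apply: peel1.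
  apply: (@lin0 k M M (fun v => shuffle_section (fun _ _ => v) s2)).
  by apply: (@shuffle_section_lin M (fun v _ _ => v)).
- exact: (IH _ (peel_cochain e Qc)).
Qed.

Lemma shuffle_sectionK Q hs a : HA_cochain Q -> shuffle (shuffle_section Q) hs a = Q hs a.
Proof.
have [n] := ubnP (size hs + size a); elim: n hs a Q => // n IH hs a Q le_n Qc.
have [e0|n0] := posnP (size hs + size a)%N.
  by case: hs a e0 {le_n} => [|h hs] [|a1 a] //= _; rewrite /shuffle /= shuffle_op0.
rewrite shuffle_step // -[RHS]left_op_peel //; apply: eq_left_op_size => z hs' a' _ sz.
by apply: IH; [rewrite -ltnS sz | exact: peel_cochain].
Qed.

End RightInverse.

(** * Coinduced bimodules *)

Definition mklin (k : comNzRingType) (U V : lmodType k) (g : U -> V) (gl : linear g) :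
    {linear U -> V} :=
  HB.pack_for {linear U -> V} g (GRing.isLinear.Build k U V *:%R g gl).

Lemma mklinE (k : comNzRingType) (U V : lmodType k) (g : U -> V) (gl : linear g) x :
  mklin gl x = g x.
Proof. by []. Qed.

Section Coinduced.
Variables (k : comNzRingType) (B : algType k) (M : bimodType B).

Definition coind : Type := {linear B -> M}.
HB.instance Definition _ := GRing.Lmodule.on coind.

Lemma coindE c (u v : coind) e : (c *: u + v) e = c *: u e + v e.
Proof. by []. Qed.

Fact coind_lact_lin (x : B) (u : coind) : linear (fun e => u (e * x)).
Proof. by move=> c a b; rewrite mulrDl -scalerAl linearP. Qed.
Fact coind_ract_lin (u : coind) (y : B) : linear (fun e => ract (u e) y).
Proof. by move=> c a b; rewrite linearP ractlin. Qed.

Definition coind_lact x (u : coind) : coind := mklin (coind_lact_lin x u).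
Definition coind_ract (u : coind) y : coind := mklin (coind_ract_lin u y).

Fact coind_lact_bilin : bilin coind_lact.
Proof.
split=> [u|x] c y z; apply: hom_ext => e; rewrite coindE //=.
by rewrite mulrDr -scalerAr linearP.
Qed.
Fact coind_ract_bilin : bilin coind_ract.
Proof.
split=> [u|x] c y z; apply: hom_ext => e; rewrite coindE /=.
  by rewrite ractlin.
by rewrite ractlinr.
Qed.
Fact coind_lact1 u : coind_lact 1 u = u.
Proof. by apply: hom_ext => e /=; rewrite mulr1. Qed.
Fact coind_ract1 u : coind_ract u 1 = u.
Proof. by apply: hom_ext => e /=; rewrite ract1. Qed.
Fact coind_lactA x y u : coind_lact x (coind_lact y u) = coind_lact (x * y) u.
Proof. by apply: hom_ext => e /=; rewrite mulrA. Qed.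
Fact coind_ractA u x y : coind_ract (coind_ract u x) y = coind_ract u (x * y).
Proof. by apply: hom_ext => e /=; rewrite ractA. Qed.
Fact coind_lractA x u y : coind_ract (coind_lact x u) y = coind_lact x (coind_ract u y).
Proof. exact: hom_ext. Qed.

HB.instance Definition _ := isBimodule.Build k B coind coind_lact_bilin coind_ract_bilin
  coind_lact1 coind_ract1 coind_lactA coind_ractA coind_lractA.

Lemma rbar_lift (V : lmodType k) (g : B -> V) : linear g -> g 1 = 0 ->
  linear (fun t : rbar B => g (repr t)) /\ forall e, g (repr (bcl e)) = g e.
Proof.
move=> gl g1; have gE e e' : bcl e = bcl e' -> g e = g e'.
  move=> /quot_classP[c e1]; have -> : e = c *: 1 + e' by rewrite -e1 subrK.
  by rewrite gl g1 scaler0 add0r.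
split=> [c x y|e]; last by apply: gE; apply: quot_reprK.
by rewrite -gl; apply: gE; rewrite /bcl linearP /= !quot_reprK.
Qed.

Lemma rbar_ext (V : lmodType k) (u v : {linear rbar B -> V}) :
  (forall e, u (bcl e) = v (bcl e)) -> u = v.
Proof. by move=> uv; apply: hom_ext => t; rewrite -[t]quot_reprK; apply: uv. Qed.

Lemma bcl_lin : linear (@bcl k B).
Proof. exact: quot_class_linear. Qed.
Lemma bcl1 : bcl (1 : B) = 0.
Proof.
rewrite -(lin0 bcl_lin); apply/quot_classP; exists 1.
by rewrite subr0 scale1r.
Qed.

(* The quotient of [coind] by the submodule of all [e |-> e m], realised by
   the linear maps vanishing at [1]. *)
Definition coquo : Type := {linear rbar B -> M}.
HB.instance Definition _ := GRing.Lmodule.on coquo.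

Lemma coquoE c (u v : coquo) e : (c *: u + v) e = c *: u e + v e.
Proof. by []. Qed.

Fact coquo_fun_lin (x : B) (q : coquo) :
  linear (fun e => q (bcl (e * x)) - lact e (q (bcl x))).
Proof.
apply: linear_sub; last exact: lactlinl.
by move=> c a b; rewrite mulrDl -scalerAl bcl_lin linearP.
Qed.
Fact coquo_fun1 (x : B) (q : coquo) : q (bcl (1 * x)) - lact 1 (q (bcl x)) = 0.
Proof. by rewrite mul1r lact1 subrr. Qed.
Fact coquo_ract_lin (q : coquo) (y : B) : linear (fun t => ract (q t) y).
Proof. by move=> c a b; rewrite linearP ractlin. Qed.

(** The action induced by [coind]: for [u] with [u 1 = 0] the translate [e |-> u (e * x)] has value
    [u x] at [1], and subtracting [e |-> lact e (u x)] returns to the maps that vanish at [1]. *)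
Definition coquo_lact x (q : coquo) : coquo :=
  mklin (rbar_lift (coquo_fun_lin x q) (coquo_fun1 x q)).1.
Definition coquo_ract (q : coquo) y : coquo := mklin (coquo_ract_lin q y).

Lemma coquo_lactE x q e : coquo_lact x q (bcl e) = q (bcl (e * x)) - lact e (q (bcl x)).
Proof. exact: (rbar_lift (coquo_fun_lin x q) (coquo_fun1 x q)).2. Qed.

Fact coquo_lact_bilin : bilin coquo_lact.
Proof.
split=> [u|x] c y z; apply: rbar_ext => e; rewrite coquoE !coquo_lactE.
  rewrite mulrDr -scalerAr !bcl_lin !linearP lactlin scalerBr.
  by rewrite addrACA -opprD.
by rewrite !coquoE lactlin scalerBr addrACA -opprD.
Qed.
Fact coquo_ract_bilin : bilin coquo_ract.
Proof.
split=> [u|x] c y z; apply: rbar_ext => e; rewrite coquoE /=.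
  by rewrite ractlin.
by rewrite ractlinr.
Qed.
Fact coquo_lact1 u : coquo_lact 1 u = u.
Proof.
by apply: rbar_ext => e; rewrite coquo_lactE mulr1 bcl1 linear0 (lin0 (lactlin _)) subr0.
Qed.
Fact coquo_ract1 u : coquo_ract u 1 = u.
Proof. by apply: hom_ext => e /=; rewrite ract1. Qed.
Fact coquo_lactA x y u : coquo_lact x (coquo_lact y u) = coquo_lact (x * y) u.
Proof.
apply: rbar_ext => e; rewrite !coquo_lactE (linB (lactlin _)) lactA mulrA opprB.
by rewrite addrA subrK.
Qed.
Fact coquo_ractA u x y : coquo_ract (coquo_ract u x) y = coquo_ract u (x * y).
Proof. by apply: hom_ext => e /=; rewrite ractA. Qed.
Fact coquo_lractA x u y : coquo_ract (coquo_lact x u) y = coquo_lact x (coquo_ract u y).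
Proof.
apply: rbar_ext => e; rewrite coquo_lactE.
rewrite -[LHS]/(ract (coquo_lact x u (bcl e)) y) coquo_lactE (linB (ractlin _)).
by rewrite lractA.
Qed.

HB.instance Definition _ := isBimodule.Build k B coquo coquo_lact_bilin coquo_ract_bilin
  coquo_lact1 coquo_ract1 coquo_lactA coquo_ractA coquo_lractA.

End Coinduced.

Section BimoduleMaps.
Variables (k : comNzRingType) (B : algType k).

Definition bimorphism (M N : bimodType B) (g : M -> N) :=
  [/\ linear g, forall x m, g (lact x m) = lact x (g m)
    & forall m x, g (ract m x) = ract (g m) x].

Lemma bar_bimorphism (M N : bimodType B) (g : M -> N) (P : seq B -> M) s :
  bimorphism g -> bar (fun t => g (P t)) s = g (bar P s).
Proof.
move=> [gl gL gR]; case: s => [|e s] /=; first by rewrite (lin0 gl).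
rewrite (linD gl) gL; congr (_ + _).
by rewrite /rhoM /rho (ev_linear _ _ gl); apply: eq_ev => p; rewrite gR.
Qed.

Variable M : bimodType B.

Fact coind_in_lin (m : M) : linear (fun e : B => lact e m).
Proof. exact: lactlinl. Qed.
Definition coind_in (m : M) : coind M := mklin (coind_in_lin m).

Fact coind_quo_lin (u : coind M) : linear (fun e => u e - lact e (u 1)).
Proof. by apply: linear_sub; [exact: linearP | exact: lactlinl]. Qed.
Fact coind_quo1 (u : coind M) : u 1 - lact 1 (u 1) = 0.
Proof. by rewrite lact1 subrr. Qed.
Definition coind_quo (u : coind M) : coquo M :=
  mklin (rbar_lift (coind_quo_lin u) (coind_quo1 u)).1.
Lemma coind_quoE u e : coind_quo u (bcl e) = u e - lact e (u 1).
Proof. exact: (rbar_lift (coind_quo_lin u) (coind_quo1 u)).2. Qed.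

Fact coquo_lift_lin (q : coquo M) : linear (fun e : B => q (bcl e)).
Proof. by move=> c x y; rewrite bcl_lin linearP. Qed.
(** Only a k-linear section of [coind_quo]. That suffices to lift cochains with values in [coquo M],
    since being a cochain involves no action on the coefficients. *)
Definition coquo_lift (q : coquo M) : coind M := mklin (coquo_lift_lin q).

Lemma coquo_liftK q : coind_quo (coquo_lift q) = q.
Proof.
by apply: rbar_ext => e; rewrite coind_quoE /= bcl1 linear0 (lin0 (lactlin _)) subr0.
Qed.

Lemma coind_in_bimorphism : bimorphism coind_in.
Proof.
split=> [c x y|x m|m x]; apply: hom_ext => e; rewrite ?coindE /=.
- exact: lactlin.
- exact: lactA.
- by rewrite lractA.
Qed.

Lemma coind_quo_bimorphism : bimorphism coind_quo.
Proof.
split=> [c x y|x m|m x]; apply: rbar_ext => e; rewrite ?coquoE ?coquo_lactE !coind_quoE.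
- by rewrite !coindE lactlin scalerBr addrACA -opprD.
- rewrite -[lact x m e]/(m (e * x)) -[lact x m 1]/(m (1 * x)) mul1r.
  by rewrite (linB (lactlin _)) lactA opprB addrA subrK.
- rewrite -[LHS]/(ract (m e) x - lact e (ract (m 1) x)).
  by rewrite -[RHS]/(ract (coind_quo m (bcl e)) x) coind_quoE (linB (ractlin _)) lractA.
Qed.

Lemma coquo_lift_linear : linear coquo_lift.
Proof. by move=> c x y; apply: hom_ext => e. Qed.

Lemma coind_eval_linear (e : B) : linear (fun u : coind M => u e).
Proof. by []. Qed.

Lemma coind_quo0 u : coind_quo u = 0 -> u = coind_in (u 1).
Proof.
move=> u0; apply: hom_ext => e /=; apply/eqP; rewrite -subr_eq0.
by rewrite -coind_quoE u0.
Qed.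

End BimoduleMaps.

Section CoinducedAcyclic.
Variables (k : comNzRingType) (H : hopfAlgType k) (A : algType k).
Variables (w : weak_action H A) (f : {linear tensor H H -> A}).
Hypothesis hE : is_crossed_product w f.
Notation E := (crossed_product hE).
Notation "a # h" := (cprod hE a h) (at level 35).

Lemma shuffle_linear (V W : lmodType k) (g : V -> W) (P : seq E -> V) hs a :
  linear g -> shuffle (fun s => g (P s)) hs a = g (shuffle P hs a).
Proof. by move=> gl; rewrite /shuffle /shuffle_op (ev_linear _ _ gl). Qed.

Lemma eq_shuffle (W : lmodType k) (P P' : seq E -> W) hs a :
  (forall s, size s = (size hs + size a)%N -> P s = P' s) -> shuffle P hs a = shuffle P'
    hs a.
Proof. exact: eq_shuffle_op. Qed.

Lemma E_cochain_lin (V W : lmodType k) (g : V -> W) (P : seq E -> V) :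
  linear g -> E_cochain P -> E_cochain (fun s => g (P s)).
Proof.
move=> gl [Pl Pn]; split=> s1 s2; first exact: (linear_comp gl (Pl s1 s2)).
by rewrite Pn (lin0 gl).
Qed.

Lemma E_cochain_sub (W : lmodType k) (P P' : seq E -> W) :
  E_cochain P -> E_cochain P' -> E_cochain (fun s => P s - P' s).
Proof.
move=> [Pl Pn] [Pl' Pn']; split=> s1 s2; first exact: linear_sub.
by rewrite Pn Pn' subrr.
Qed.

Lemma HA_cochain_add (W : lmodType k) (P P' : seq H -> seq A -> W) :
  HA_cochain P -> HA_cochain P' -> HA_cochain (fun hs a => P hs a + P' hs a).
Proof.
move=> [[l1 l2] [n1 n2]] [[l1' l2'] [n1' n2']].
split; split=> [a|hs] s1 s2.
- exact: (linear_add (l1 a s1 s2) (l1' a s1 s2)).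
- exact: (linear_add (l2 hs s1 s2) (l2' hs s1 s2)).
- by rewrite (n1 a s1 s2) (n1' a s1 s2) addr0.
- by rewrite (n2 hs s1 s2) (n2' hs s1 s2) addr0.
Qed.

Lemma HA_cochain_sub (W : lmodType k) (P P' : seq H -> seq A -> W) :
  HA_cochain P -> HA_cochain P' -> HA_cochain (fun hs a => P hs a - P' hs a).
Proof.
move=> [[l1 l2] [n1 n2]] [[l1' l2'] [n1' n2']].
split; split=> [a|hs] s1 s2.
- exact: (linear_sub (l1 a s1 s2) (l1' a s1 s2)).
- exact: (linear_sub (l2 hs s1 s2) (l2' hs s1 s2)).
- by rewrite (n1 a s1 s2) (n1' a s1 s2) subrr.
- by rewrite (n2 hs s1 s2) (n2' hs s1 s2) subrr.
Qed.

Lemma bar_cochain (M : bimodType E) (P : seq E -> M) : E_cochain P -> E_cochain (bar P).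
Proof. by move=> [Pl Pn]; split; [apply: bar_slotlin | apply: bar_norm]. Qed.

Lemma barB (M : bimodType E) (P P' : seq E -> M) s :
  bar (fun s => P s - P' s) s = bar P s - bar P' s.
Proof.
case: s => [|e s] /=; first by rewrite subrr.
by rewrite (linB (lactlin _)) rhoMD rhoMN opprD addrACA.
Qed.

Section General.
Variable M : bimodType E.
Implicit Types Q : seq H -> seq A -> M.

Lemma mixed_diffD Q Q' hs a : mixed_diff (fun h x => Q h x + Q' h x) hs a =
  mixed_diff Q hs a + mixed_diff Q' hs a.
Proof.
rewrite /mixed_diff right_opD addrACA -left_opD; congr (_ + _); apply: eq_left_op => z hs'
  a'.
by rewrite (linD (lactlin _)).
Qed.
Lemma mixed_diffN Q hs a : mixed_diff (fun h x => - Q h x) hs a = - mixed_diff Q hs a.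
Proof.
rewrite /mixed_diff right_opN opprD -left_opN; congr (_ + _); apply: eq_left_op => z hs' a'.
by rewrite (linN (lactlin _)).
Qed.

(** Writes [mixed_diff] through the bar complex. Multilinearity, normalization and the vanishing of
    the square are then inherited from [bar], without any identity between the maps F. *)
Lemma mixed_diff_shuffle Q hs a : HA_cochain Q -> mixed_diff Q hs a =
  shuffle (bar (shuffle_section Q)) hs a.
Proof.
move=> Qc; rewrite shuffle_bar; last exact: (shuffle_section_cochain Qc).1.
by apply: eq_mixed_diff_size => hs' a' _ _; rewrite shuffle_sectionK.
Qed.

Lemma mixed_diff_cochain Q : HA_cochain Q -> HA_cochain (mixed_diff Q).
Proof.
move=> Qc; have -> : mixed_diff Q = shuffle (bar (shuffle_section Q)).
  by apply/funext=> hs; apply/funext=> a; apply: mixed_diff_shuffle.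
exact: shuffle_cochain (bar_cochain (shuffle_section_cochain Qc)).
Qed.

Lemma mixed_diff_square Q hs a : HA_cochain Q -> mixed_diff (mixed_diff Q) hs a = 0.
Proof.
move=> Qc; have -> : mixed_diff Q = shuffle (bar (shuffle_section Q)).
  by apply: funext => hs0; apply: funext => a0; apply: mixed_diff_shuffle.
rewrite -shuffle_bar; last exact: (bar_cochain (shuffle_section_cochain Qc)).1.
rewrite /shuffle /shuffle_op -[RHS](ev0 M (shuffle_terms hE (size hs + size a) hs a)).
by apply: eq_ev => s; apply: bar_bar.
Qed.

End General.

Section Contraction.
Variable M : bimodType E.
Implicit Types Q : seq H -> seq A -> coind M.

Lemma right_op_coind Q hs a e : right_op Q hs a e = right_op (fun hs a => Q hs a e) hs a.
Proof. by rewrite /right_op (ev_linear _ _ (@coind_eval_linear _ _ M e)). Qed.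

Lemma mixed_diff_coind Q hs a e : mixed_diff Q hs a e =
  left_op (fun x hs a => Q hs a (e * x)) hs a + right_op (fun hs a => Q hs a e) hs a.
Proof.
rewrite -right_op_coind -[LHS]/(_ + _) /=; congr (_ + _).
by rewrite /left_op (ev_linear _ _ (@coind_eval_linear _ _ M e)).
Qed.

Fact cone_bilin Q hs a : HA_cochain Q -> bilin (fun c h => Q (h :: hs) a (c # 1)).
Proof.
move=> [[l1 _] _]; split=> [h|c] x y z.
  by rewrite cprod_linl linearP.
exact: (linear_comp (@coind_eval_linear _ _ M _) (l1 _ [::] hs)).
Qed.

Fact cone0_bilin Q a : HA_cochain Q ->
  bilin (fun c (h : H) => counit h *: (Q [::] (c :: a) 1)).
Proof.
move=> [[_ l2] _]; split=> [h|c]; last exact: counit_lin.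
by apply: linear_scale; apply: (linear_comp (@coind_eval_linear _ _ M _) (l2 _ [::] a)).
Qed.

Lemma cochain_at Q e : HA_cochain Q -> HA_cochain (fun hs a => Q hs a e).
Proof.
move=> [[l1 l2] [n1 n2]]; split; split=> [a|hs] s1 s2.
- exact: (linear_comp (@coind_eval_linear _ _ M e) (l1 a s1 s2)).
- exact: (linear_comp (@coind_eval_linear _ _ M e) (l2 hs s1 s2)).
- by rewrite (n1 a s1 s2).
- by rewrite (n2 hs s1 s2).
Qed.

Lemma mklin_esum_cochain (Q : seq H -> seq A -> A -> H -> M)
    (b : forall hs a, bilin (Q hs a)) :
  (forall c h, HA_cochain (fun hs a => Q hs a c h)) ->
  HA_cochain (fun hs a => mklin (@esum_linear _ _ _ _ _ hE _ _ (b hs a)) : coind M).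
Proof.
move=> Qc; split; split=> [a|hs] s1 s2.
- move=> c x y; apply: hom_ext => e; rewrite coindE /=.
  exact: (@esum_param k H A w f hE M _ (fun x => Q (s1 ++
    x :: s2) a) e (fun c' h => (Qc c' h).1.1 a s1 s2)).
- move=> c x y; apply: hom_ext => e; rewrite coindE /=.
  exact: (@esum_param k H A w f hE M _ (fun x => Q hs (s1 ++
    x :: s2)) e (fun c' h => (Qc c' h).1.2 hs s1 s2)).
- by apply: hom_ext => e /=; apply: eq_spl0 => c h; exact: ((Qc c h).2.1 a s1 s2).
- by apply: hom_ext => e /=; apply: eq_spl0 => c h; exact: ((Qc c h).2.2 hs s1 s2).
Qed.

(* [X] contracts the row of the words without letters of [H]; after subtracting
   its boundary, [(hs, a) |-> (c # h |-> Q (h :: hs) a c)] is a contraction. *)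
Lemma coind_acyclic n Q : HA_cochain Q ->
  (forall hs a, (size hs + size a)%N = n.+2 -> mixed_diff Q hs a = 0) ->
  exists2 R, HA_cochain R & forall hs a, (size hs + size a)%N = n.+1 ->
    mixed_diff R hs a = Q hs a.
Proof.
move=> Qc dQ.
have b0 (hs : seq H) a : bilin
  (fun c (h : H) => if hs is [::] then counit h *: (Q [::] (c :: a) 1) else 0).
  case: hs => [|_ _]; first exact: cone0_bilin.
  by split=> *; apply: linear_zero.
pose X hs a : coind M := mklin (@esum_linear _ _ _ _ _ hE _ _ (b0 hs a)).
have Xc : HA_cochain X.
  apply: mklin_esum_cochain => c h; have [[l1 l2] [n1 n2]] := cochain_at 1 Qc.
  split; split=> [a|[|h' hs]] s1 s2.
  - by case: s1 => [|? ?]; apply: linear_zero.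
  - exact: (linear_scale _ (l2 _ (c :: s1) s2)).
  - exact: linear_zero.
  - by case: s1.
  - by rewrite (n2 _ (c :: s1)) scaler0.
  - by [].
have XE a c : X [::] a (c # 1) = Q [::] (c :: a) 1.
  by rewrite /X mklinE esumE /= ?counit1 ?scale1r; last exact: (b0 [::] a).
(* The cocycle condition on the word [[:: c, a1 & a]], evaluated at [1]: the left term is the value
   at [c # 1], and the remaining terms are exactly the boundary of [X]. *)
have Q0 a c : size a = n.+1 -> Q [::] a (c # 1) = mixed_diff X [::] a (c # 1).
  case: a => // a1 a [sa].
  have /(congr1 (fun u : coind M => u 1)) := dQ [::] [:: c, a1 & a]
    (congr1 (fun m => m.+2) sa).
  rewrite !mixed_diff_coind !left_op_nil_cons !right_op_nil_cons rho_cons mul1r cprodAl XE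
    ract_base1.
  move=> /eqP; rewrite addr_eq0 opprB opprK addrC => /eqP ->.
  by congr (_ + _); apply: eq_rho => t _; rewrite XE.
pose Q1 hs a := Q hs a - mixed_diff X hs a.
have Q1c : HA_cochain Q1 by apply: HA_cochain_sub => //; apply: mixed_diff_cochain.
have dQ1 hs a : (size hs + size a)%N = n.+2 -> mixed_diff Q1 hs a = 0.
  by move=> sz; rewrite /Q1 mixed_diffD mixed_diffN mixed_diff_square // dQ // subrr.
have Q10 a c : size a = n.+1 -> Q1 [::] a (c # 1) = 0.
  by move=> sa; rewrite /Q1 -[LHS]/(_ - _) /= Q0 // subrr.
have b1 hs a := cone_bilin hs a Q1c.
pose S hs a : coind M := mklin (@esum_linear _ _ _ _ _ hE _ _ (b1 hs a)).
have SE hs a c h : S hs a (c # h) = Q1 (h :: hs) a (c # 1) by rewrite /S mklinE esumE.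
have Sc : HA_cochain S.
  apply: mklin_esum_cochain => c h; have [[l1 l2] [n1 n2]] := cochain_at (c # 1) Q1c.
  split; split=> [a|hs] s1 s2.
  - exact: (l1 _ (h :: s1)).
  - exact: l2.
  - exact: (n1 _ (h :: s1)).
  - exact: n2.
exists (fun hs a => X hs a + S hs a); first exact: HA_cochain_add.
move=> hs a sz; rewrite mixed_diffD.
suff -> : mixed_diff S hs a = Q1 hs a by rewrite /Q1 addrC subrK.
apply: hom_ext; apply: cprod_ext; [exact: linearP | exact: linearP | move=> c h].
have /(congr1 (fun u : coind M => u (c # 1))) := dQ1 (h :: hs) a (congr1 succn sz).
rewrite mixed_diff_coind left_op_cons right_op_cons -cprod_decomp.
(* The term in which F consumes the whole word [h :: hs] is the obstruction to contracting [Q]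
   directly. It vanishes for [Q1], which is zero at the arguments [c # 1] on words without letters
   of [H]. *)
have -> : F_op hE (size hs + size a) (fun d y => ract (Q1 [::] d (c # 1)) (1 # y))
  (h :: hs) a = 0.
  transitivity (F_op hE (size hs + size a) (fun _ _ => 0 : M) (h :: hs) a); last exact: ev0.
  by apply: eq_F_op => d y sd; rewrite Q10 ?sd // (lin0 (ractlin _)).
rewrite scaler0 sub0r => /eqP; rewrite -addrA -opprD subr_eq0 => /eqP ->.
rewrite mixed_diff_coind; congr (_ + _); last first.
  by apply: eq_right_op_size => hs' a' _ _; rewrite SE.
apply: eq_left_op => x hs' a'.
have SEl z : esum (fun c' g => Q1 (g :: hs') a' ((c # 1) * (c' # 1))) z = S hs' a'
  ((c # 1) * z).
  move: z; apply: cprod_ext.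
  - apply: esum_linear; split=> [g|c'].
      exact: (linear_comp (@linearP _ _ _ _ _)
        (linear_comp (@mul_linr _ _ _ _ _ hE _) (cprod_linl _ _))).
    exact: (linear_comp (@coind_eval_linear _ _ M _) (Q1c.1.1 _ [::] hs')).
  - exact: (linear_comp (@linearP _ _ _ _ _) (@mul_linr _ _ _ _ _ hE _)).
  move=> c' g; rewrite cprodAl SE esumE; first by rewrite cprodAl.
  split=> [g'|c2].
    exact: (linear_comp (@linearP _ _ _ _ _)
      (linear_comp (@mul_linr _ _ _ _ _ hE _) (cprod_linl _ _))).
  exact: (linear_comp (@coind_eval_linear _ _ M _) (Q1c.1.1 _ [::] hs')).
by rewrite /twist /twistA SEl mulrA -cprod_decomp.
Qed.

End Contraction.
End CoinducedAcyclic.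

(** * Acyclicity of the kernel of the restriction *)

Section KernelAcyclic.
Variables (k : comNzRingType) (H : hopfAlgType k) (A : algType k).
Variables (w : weak_action H A) (f : {linear tensor H H -> A}).
Hypothesis hE : is_crossed_product w f.
Notation E := (crossed_product hE).
Notation "a # h" := (cprod hE a h) (at level 35).

Lemma shuffleB (W : lmodType k) (P P' : seq E -> W) hs a :
  shuffle (fun s => P s - P' s) hs a = shuffle P hs a - shuffle P' hs a.
Proof. exact: evB. Qed.

Lemma mixed_diff0 (M : bimodType E) (Q : seq H -> seq A -> M) hs a :
  (forall hs' a', (size hs' + size a').+1 = (size hs + size a)%N -> Q hs' a' = 0) ->
  mixed_diff Q hs a = 0.
Proof.
move=> Q0; have -> : mixed_diff Q hs a = mixed_diff (fun _ _ => 0) hs a.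
  by apply: eq_mixed_diff_size => hs' a' _; apply: Q0.
have := mixed_diffD (fun _ _ => 0 : M) (fun _ _ => 0) hs a.
have -> : (fun (_ : seq H) (_ : seq A) => (0 : M) + 0) = fun _ _ => 0.
  by apply: funext => x; apply: funext => y; rewrite addr0.
by move/eqP; rewrite -{1}[mixed_diff _ _ _]addr0 (inj_eq (addrI _)) eq_sym => /eqP.
Qed.

(* Dimension shifting: [M] embeds into the coinduced module [coind M], for
   which the kernel of [shuffle] is acyclic, with quotient [coquo M]. *)
Theorem ker_acyclic n (M : bimodType E) (P : seq E -> M) : E_cochain P ->
  (forall s, size s = n.+1 -> bar P s = 0) ->
  (forall hs a, (size hs + size a)%N = n -> shuffle P hs a = 0) ->
  if n is m.+1 then
    exists T, [/\ E_cochain T, forall s, size s = n -> bar T s = P s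
      & forall hs a, (size hs + size a)%N = m -> shuffle T hs a = 0]
  else P [::] = 0.
Proof.
elim: n M P => [|n IH] M P Pc bP gP.
  by have := gP [::] [::] erefl; rewrite /shuffle shuffle_op0.
have [Pl Pn] := Pc; case: n IH bP gP => [|n] IH bP gP.
  exists (fun _ => 0); split.
  - by split=> s1 s2; first exact: linear_zero.
  - move=> [|x [|y s]] // _; rewrite /= rhoM_nil (lin0 (lactlin _)) (lin0 (ractlin _))
    subr0.
    apply/esym; move: x; apply: cprod_ext; [exact: (Pl [::]) | exact: linear_zero |].
    (* A cocycle of degree 1 is a derivation; it vanishes on [a # 1] and on [1 # h], hence on their
       product. *)
    move=> a h; rewrite cprod_decomp.
    have := bP [:: a # 1; 1 # h] erefl; rewrite /= rhoM_cons rhoM_nil.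
    have -> : P [:: 1 # h] = 0.
      by rewrite -(gP [:: h] [::] erefl)
        /shuffle shuffle_opS left_op_cons left_op_nil shuffle_op0 subr0.
    have -> : P [:: a # 1] = 0.
      by rewrite -(gP [::] [:: a] erefl) /shuffle shuffle_opS left_op_nil_cons shuffle_op0.
    rewrite (lin0 (lactlin _)) (lin0 (ractlin _)) add0r oppr0 subr0 => /eqP.
    by rewrite oppr_eq0 => /eqP.
  - by move=> hs a _; apply: ev0.
have [jl _ _] := coind_in_bimorphism M.
have [ql _ _] := coind_quo_bimorphism M.
have evl := @coind_eval_linear _ _ M.
have T0l s : linear (fun e => P (e :: s)) by apply: (Pl [::]).
(* The contraction of the bar complex with coinduced coefficients: the first letter becomes the
   argument. Its boundary is [P] pushed into [coind M]. *)
pose T0 s : coind M := mklin (T0l s).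
have T0c : E_cochain T0.
  split=> s1 s2; last by apply: hom_ext => e; apply: (Pn (e :: s1)).
  by move=> c x y; apply: hom_ext => e; rewrite coindE; apply: (Pl (e :: s1)).
have bT0 s : size s = n.+2 -> bar T0 s = coind_in (P s).
  case: s => // e1 s [ss]; apply: hom_ext => e.
  have := bP [:: e, e1 & s] (congr1 (fun m => m.+2) ss).
  rewrite /= rhoM_cons => /eqP; rewrite addr_eq0 => /eqP ->.
  rewrite opprB opprK -[LHS]/(P (e * e1 :: s) + rhoM T0 e1 s e) addrC; congr (_ + _).
  by rewrite /rhoM /rho (ev_linear _ _ (evl e)).
have dT0 hs a : (size hs + size a)%N = n.+2 -> mixed_diff (shuffle T0) hs a = 0.
  move=> sz; rewrite -shuffle_bar; last exact: T0c.1.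
  rewrite (@eq_shuffle _ _ _ _ _ hE _ _ (fun s => coind_in (P s))) => [|s ss];
    last by rewrite bT0 // ss.
  by rewrite (shuffle_linear _ _ _ jl) gP // (lin0 jl).
have [R Rc RE] := coind_acyclic (shuffle_cochain T0c) dT0.
(* [T0] need not restrict to zero, but its restriction is a cocycle of the mixed complex, hence a
   coboundary. Lifting a primitive along the section corrects [T0] without changing its boundary. *)
pose T1 s := T0 s - bar (shuffle_section R) s.
have T1c : E_cochain T1 by apply: E_cochain_sub => //;
  apply/bar_cochain/shuffle_section_cochain.
have gT1 hs a : (size hs + size a)%N = n.+1 -> shuffle T1 hs a = 0.
  by move=> sz; rewrite (shuffleB T0 (bar (shuffle_section R))) -mixed_diff_shuffle //
    RE // subrr.
have bT1 s : bar T1 s = bar T0 s by rewrite /T1 barB bar_bar subr0.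
(* Modulo [M], [T1] is a cocycle in the kernel of the restriction, one degree below [P] and with
   coefficients in [coquo M]; this is why the induction quantifies over [M]. *)
have [|s ss|hs a sz|T2 [T2c bT2 gT2]] := IH (coquo M) (fun s => coind_quo (T1 s)).
- exact: E_cochain_lin.
- rewrite (bar_bimorphism _ _ (coind_quo_bimorphism M)) bT1 bT0 //.
  by apply: rbar_ext => e; rewrite coind_quoE /= lact1 subrr.
- by rewrite (shuffle_linear _ _ _ ql) gT1 // (lin0 ql).
have liftl := @coquo_lift_linear _ _ M.
(* The corrected cochain is zero modulo [M], so its values come from [M] and evaluation at [1]
   recovers them. *)
pose T3 s := T1 s - bar (fun s => coquo_lift (T2 s)) s.
have liftc : E_cochain (fun s => coquo_lift (T2 s)) by apply: E_cochain_lin.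
have T3c : E_cochain T3 by apply: E_cochain_sub => //; apply: bar_cochain.
have T3E s : size s = n.+1 -> T3 s = coind_in (T3 s 1).
  move=> ss; apply: coind_quo0; rewrite /T3 (linB ql)
    -(bar_bimorphism _ _ (coind_quo_bimorphism M)).
  rewrite -bT2 // -[X in X - _]add0r; apply/eqP; rewrite add0r subr_eq0; apply/eqP.
  by apply: eq_bar => t _; rewrite coquo_liftK.
exists (fun s => T3 s 1); split.
- exact: (E_cochain_lin (evl 1) T3c).
- move=> s ss; have := bT0 s ss; rewrite -bT1.
  have <- : bar T3 s = bar T1 s by rewrite /T3 barB bar_bar subr0.
  rewrite (@eq_bar _ _ _ _ (fun s => coind_in (T3 s 1))) => [|t st]; last first.
    by apply: T3E; apply: succn_inj; rewrite st.
  rewrite (bar_bimorphism _ _ (coind_in_bimorphism M)) =>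
    /(congr1 (fun u : coind M => u 1)) /=.
  by rewrite !lact1.
move=> hs a sz; rewrite (shuffle_linear _ _ _ (evl 1)).
rewrite (shuffleB T1) shuffle_bar; last exact: liftc.1.
rewrite gT1 // sub0r mixed_diff0 ?oppr0 // => hs' a'; rewrite sz => -[sz'].
by rewrite (shuffle_linear _ _ _ liftl) gT2 // (lin0 liftl).
Qed.

End KernelAcyclic.

(** * Surjective cochain maps with acyclic kernel *)

Section CohomologyIso.
Variables (k : comNzRingType) (C X : nat -> lmodType k).
Variables (b : forall n, {linear C n -> C n.+1}) (d : forall n, {linear X n -> X n.+1}).
Variable g : forall n, {linear C n -> X n}.
Hypothesis bb : forall n x, b n.+1 (b n x) = 0.
Hypothesis gb : forall n x, g n.+1 (b n x) = d n (g n x).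
Hypothesis gs : forall n y, exists x, g n x = y.
Hypothesis ker0 : forall x, b 0 x = 0 -> g 0 x = 0 -> x = 0.
Hypothesis kerS : forall n x, b n.+1 x = 0 -> g n.+1 x = 0 ->
  exists2 y, g n y = 0 & x = b n y.

(** One direction is compatibility with the differentials, the other lifts a primitive by
    surjectivity and corrects it by acyclicity of the kernel. Together they make the induced map on
    classes well defined and injective. *)
Lemma coboundary_iff n (x : C n) : b n x = 0 ->
  is_coboundary b x <-> is_coboundary d (g n x).
Proof.
case: n x => [|m] x bx /=; split.
- by move=> ->; rewrite linear0.
- exact: ker0.
- by move=> [y ->]; exists (g m y); rewrite gb.
- move=> [y gy]; have [v gv] := gs y.
  have [||u gu xu] := @kerS m (x - b m v).
  + by rewrite linearB bx bb subrr.
  + by rewrite linearB gb gv gy subrr.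
  by exists (u + v); rewrite linearD -xu subrK.
Qed.

Theorem cohomology_iso n : lmod_isomorphic (cohomology b n) (cohomology d n).
Proof.
have cocP (z : submod (cocycles b n)) : b n (\val z) = 0.
  by have /asboolP := valP z.
have cocP' (z : submod (cocycles d n)) : d n (\val z) = 0.
  by have /asboolP := valP z.
have mem (z : submod (cocycles b n)) : submodule_pred (cocycles d n) (g n (\val z)).
  by apply/asboolP; rewrite /= -gb cocP linear0.
pose g1 z : submod (cocycles d n) := Sub (g n (\val z)) (mem z).
have g1E z : \val (g1 z) = g n (\val z) by rewrite SubK.
have g1l : linear g1.
  move=> c x y; apply: val_inj.
  transitivity (c *: \val (g1 x) + \val (g1 y)); last by rewrite linearP.
  rewrite !g1E -linearP; congr (g n _); exact: linearP.
pose cl := quot_class (coboundaries d n); pose cl0 := quot_class (coboundaries b n).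
have cobP z : is_coboundary b (\val z) <-> is_coboundary d (\val (g1 z)).
  by rewrite g1E; apply: coboundary_iff.
have clE x y : cl0 x = cl0 y <-> cl (g1 x) = cl (g1 y).
  rewrite /cl /cl0 !quot_classP.
  by rewrite -(linB g1l); exact: cobP.
have G1 : linear (fun t : cohomology b n => cl (g1 (repr t))).
  move=> c x y; rewrite -linearP -g1l; apply/clE.
  by rewrite /cl0 linearP /= !quot_reprK.
exists (mklin G1).
have inj : injective (mklin G1).
  by move=> x y /= /clE; rewrite /cl0 !quot_reprK.
have surj y : exists x, mklin G1 x = y.
  have [x gx] := gs (\val (repr y : submod (cocycles d n))).
  have gbx : g n.+1 (b n x) = 0 by rewrite gb gx cocP'.
  (* A preimage [x] of a cocycle need not be a cocycle, but [b x] is a cocycle in the kernel of [g],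
     so [x] can be corrected by an element of that kernel. *)
  have [v gv bv] := kerS (bb x) gbx.
  have zP : submodule_pred (cocycles b n) (x - v).
    by apply/asboolP; rewrite /= linearB bv subrr.
  pose z : submod (cocycles b n) := Sub (x - v) zP.
  exists (cl0 z); rewrite mklinE -[RHS]quot_reprK.
  have -> : repr y = g1 z by apply: val_inj; rewrite g1E SubK linearB gv subr0.
  by apply/clE; rewrite /cl0 quot_reprK.
have [h hK] := choice surj.
by exists h => // x; apply: inj; rewrite hK.
Qed.

End CohomologyIso.

(** * Sweedler expressions on lists *)

Section ListSweedler.
Variables (k : comNzRingType) (H : hopfAlgType k).

Fixpoint lsw2_terms (hs : seq H) : fsum k (seq H * seq H) :=
  match hs with
  | [::] => [:: (1, ([::], [::]))]
  | h :: hs' => fbind (tensor_terms (coprod h)) (fun p =>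
      fmap (fun q => (p.1 :: q.1, p.2 :: q.2)) (lsw2_terms hs'))
  end.

Lemma lsw2_ev (W : lmodType k) hs (e : seq H -> seq H -> W) :
  lsw2 hs e = ev (fun p => e p.1 p.2) (lsw2_terms hs).
Proof.
elim: hs e => [|h hs IH] e /=; first by rewrite ev_seq1 scale1r.
rewrite ev_bind /sw2 tsum_ev; apply: eq_ev => p.
by rewrite IH ev_map.
Qed.

Section Values.
Variable W : lmodType k.

Lemma eq_lsw2 hs (e e' : seq H -> seq H -> W) :
  (forall s1 s2, size s1 = size hs -> size s2 = size hs -> e s1 s2 = e' s1 s2) ->
  lsw2 hs e = lsw2 hs e'.
Proof.
elim: hs e e' => [|h hs IH] e e' ee; first exact: ee.
apply: eq_sw2 => x y; apply: IH => s1 s2 e1 e2.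
by apply: ee; rewrite /= ?e1 ?e2.
Qed.

Lemma lsw2_sw2 hs h (e : seq H -> seq H -> H -> H -> W) :
  lsw2 hs (fun s1 s2 => sw2 h (e s1 s2)) =
    sw2 h (fun x y => lsw2 hs (fun s1 s2 => e s1 s2 x y)).
Proof.
by rewrite lsw2_ev ev_tsum; apply: eq_sw2 => x y; rewrite lsw2_ev.
Qed.

Lemma lsw2_param (P : lmodType k) hs (e : P -> seq H -> seq H -> W) :
  (forall s1 s2, linear (fun p => e p s1 s2)) -> linear (fun p => lsw2 hs (e p)).
Proof. by move=> el c x y; rewrite !lsw2_ev -ev_lin; apply: eq_ev => p; rewrite el. Qed.

Lemma lsw2_linear (V : lmodType k) (g : W -> V) hs (e : seq H -> seq H -> W) :
  linear g -> g (lsw2 hs e) = lsw2 hs (fun s1 s2 => g (e s1 s2)).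
Proof. by move=> gl; rewrite !lsw2_ev (ev_linear _ _ gl). Qed.

Lemma lsw2Z hs c (e : seq H -> seq H -> W) :
  lsw2 hs (fun s1 s2 => c *: e s1 s2) = c *: lsw2 hs e.
Proof. by rewrite !lsw2_ev evZ. Qed.

Lemma lsw2D hs (e e' : seq H -> seq H -> W) :
  lsw2 hs (fun s1 s2 => e s1 s2 + e' s1 s2) = lsw2 hs e + lsw2 hs e'.
Proof. by rewrite !lsw2_ev evD. Qed.

Lemma lsw2_slotlin (e : seq H -> seq H -> W) : (forall s, slotlin (e^~ s)) ->
  (forall s, slotlin (e s)) -> slotlin (fun hs => lsw2 hs e).
Proof.
move=> + + s1; elim: s1 e => [|h s1 IH] e e1 e2 s2 /=.
  apply: sw2_linear; split=> [y|x]; apply: lsw2_param => t1 t2.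
    exact: (e1 _ [::]).
  exact: (e2 _ [::]).
apply: sw2_param => x y; apply: IH => s.
  exact: slotlin_cons (e1 _).
exact: slotlin_cons (e2 _).
Qed.

Lemma lsw2_coassoc hs (e : seq H -> seq H -> seq H -> W) :
  (forall s t, slotlin (fun r => e r s t)) -> (forall r t, slotlin (fun s => e r s t)) ->
  (forall r s, slotlin (e r s)) ->
  lsw2 hs (fun s t => lsw2 s (fun s1 s2 => e s1 s2 t)) =
  lsw2 hs (fun s t => lsw2 t (e s)).
Proof.
elim: hs e => [|h hs IH] e e1 e2 e3 //=.
under eq_sw2 => x y do rewrite lsw2_sw2.
under [RHS]eq_sw2 => x y do rewrite lsw2_sw2.
rewrite -sw2_coassoc.
- apply: eq_sw2 => x z; apply: eq_sw2 => x1 x2.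
  apply: (IH (fun r s t => e (x1 :: r) (x2 :: s) (z :: t))) => *.
  + exact: slotlin_cons (e1 _ _).
  + exact: slotlin_cons (e2 _ _).
  + exact: slotlin_cons (e3 _ _).
- by move=> y z; apply: lsw2_param => s1 s2; apply: lsw2_param => t1 t2; apply:
  (e1 _ _ [::]).
- by move=> x z; apply: lsw2_param => s1 s2; apply: lsw2_param => t1 t2; apply:
  (e2 _ _ [::]).
- by move=> x y; apply: lsw2_param => s1 s2; apply: lsw2_param => t1 t2; apply:
  (e3 _ _ [::]).
Qed.

Lemma lsw2_counitl hs (g : seq H -> W) : slotlin g ->
  lsw2 hs (fun s1 s2 => (\prod_(h <- s1) counit h) *: g s2) = g hs.
Proof.
elim: hs g => [|h hs IH] g gl /=; first by rewrite big_nil scale1r.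
rewrite -[RHS](sw2_counitl h (gl [::] hs)); apply: eq_sw2 => x y.
rewrite /= -[in RHS](IH (fun s => g (y :: s)) (slotlin_cons y gl)) -lsw2Z.
by apply: eq_lsw2 => s1 s2 _ _; rewrite big_cons scalerA.
Qed.

Lemma lsw2_counitr hs (g : seq H -> W) : slotlin g ->
  lsw2 hs (fun s1 s2 => counit (\prod_(h <- s2) h) *: g s1) = g hs.
Proof.
elim: hs g => [|h hs IH] g gl /=; first by rewrite big_nil counit1 scale1r.
rewrite -[RHS](sw2_counitr h (gl [::] hs)); apply: eq_sw2 => x y.
rewrite /= -[in RHS](IH (fun s => g (x :: s)) (slotlin_cons x gl)) -lsw2Z.
by apply: eq_lsw2 => s1 s2 _ _; rewrite big_cons counitM scalerA.
Qed.

End Values.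
End ListSweedler.

(** * The terms of the left part as explicit Sweedler sums *)

Section PushMerge.
Variables (k : comNzRingType) (H : hopfAlgType k) (A : algType k).
Variables (w : weak_action H A) (f : {linear tensor H H -> A}).
Hypothesis hE : is_crossed_product w f.
Notation E := (crossed_product hE).
Notation "a # h" := (cprod hE a h) (at level 35).

Section Values.
Variable W : lmodType k.
Implicit Types (K : E -> seq H -> seq A -> W) (KA : A -> seq H -> seq A -> W).

Definition push_twist h KA : A -> seq H -> seq A -> W := fun x => twistA h KA (x # 1).

(* [push_op] and [merge_op] are the two kinds of terms of [leftA_op]: the first
   entry of [a] moved to the left of [hs], and the products of adjacent entries
   of [hs], with their signs. *)
Fixpoint push_op hs KA a : W :=
  match hs with
  | [::] => if a is a1 :: a' then KA a1 [::] a' else 0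
  | h :: hs' => push_op hs' (push_twist h KA) a
  end.

Fixpoint merge_op hs KA a : W :=
  match hs with
  | [::] => 0
  | h :: hs' => (if hs' is h2 :: hs2 then - twistA h KA (1 # h2) hs2 a else 0)
    - merge_op hs' (push_twist h KA) a
  end.

(** Sorts the terms by the origin of the coefficient: the letter [1 # h], a value of f, or an entry
    of [a]. The first two kinds belong to the component l = 1 of the differential, the third to the
    component l = 0. *)
Lemma left_op_split K hs a : left_op K hs a =
  (if hs is h :: hs' then K (1 # h) hs' a else 0)
  + (merge_op hs (fun c => K (c # 1)) a + (-1) ^+
    size hs *: push_op hs (fun c => K (c # 1)) a).
Proof.
elim: hs K => [|h hs IH] K.
  by case: a => [|a1 a]; rewrite ?left_op_nil ?left_op_nil_cons /= !add0r ?scaler0 ?scale1r.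
rewrite left_op_cons IH /= exprS mulN1r scaleNr; congr (_ + _).
by case: hs {IH} => [|h2 hs] /=; rewrite ?add0r ?sub0r -?opprD ?addrA ?add0r.
Qed.

Lemma leftA_op_split h KA hs a : leftA_op hE KA (h :: hs) a =
  merge_op (h :: hs) KA a + (-1) ^+ (size hs).+1 *: push_op (h :: hs) KA a.
Proof.
rewrite leftA_op_cons left_op_split /= exprS mulN1r scaleNr.
by case: hs => [|h2 hs] /=; rewrite ?add0r ?sub0r -?opprD ?addrA ?add0r.
Qed.

Lemma push_twistE h KA x hs a : A_multilinear KA ->
  push_twist h KA x hs a = sw2 h (fun h1 h2 => KA (w h1 x) (h2 :: hs) a).
Proof. by move=> Kl; apply: twistA_A. Qed.

Lemma push_twist_lin h KA : A_multilinear KA -> A_multilinear (push_twist h KA).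
Proof. by move=> Kl; apply: (E_multilinear_A (twistA_E_multilinear hE h Kl)). Qed.

Lemma push_op_sw KA hs a1 a : A_multilinear KA ->
  push_op hs KA (a1 :: a) = lsw2 hs (fun s1 s2 => KA (wactl w s1 a1) s2 a).
Proof.
elim: hs KA => [|h hs IH] KA Kl //=.
rewrite IH -?lsw2_sw2; last exact: push_twist_lin.
by apply: eq_lsw2 => s1 s2 _ _; rewrite push_twistE.
Qed.

Lemma merge_op_sw KA hs a : A_multilinear KA -> merge_op hs KA a =
  \sum_(1 <= j < size hs) (-1) ^+ j *:
    lsw2 (take j.-1 hs) (fun u1 u2 =>
    sw2 (nth 0 hs j.-1) (fun x1 x2 => sw2 (nth 0 hs j) (fun y1 y2 =>
      KA (wactl w u1 (f2 f x1 y1)) (u2 ++ (x2 * y2) :: drop j.+1 hs) a))).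
Proof.
elim: hs KA => [|h [|h2 hs] IH] KA Kl; try by rewrite /= ?subr0 big_geq.
rewrite -[LHS]/(- twistA h KA (1 # h2) hs a - merge_op (h2 :: hs) (push_twist h KA) a).
rewrite IH; last exact: push_twist_lin.
rewrite -[size [:: h, h2 & hs]]/(size (h2 :: hs)).+1 [in RHS]big_nat_recl //=.
rewrite expr1 scaleN1r twistA_H // drop0; congr (_ + _).
rewrite -sumrN /= !big_add1 /=; apply: eq_bigr => j _.
rewrite [in RHS]exprS mulN1r scaleNr; congr (- (_ *: _)).
rewrite -lsw2_sw2; apply: eq_lsw2 => u1 u2 _ _.
rewrite [RHS]tsum_exchange; apply: eq_tsum => x1 x2.
rewrite [RHS]tsum_exchange; apply: eq_tsum => y1 y2.
by rewrite push_twistE.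
Qed.

End Values.
End PushMerge.

(** * Colinearity of the left part *)

Section Colinear.
Variables (k : comNzRingType) (H : hopfAlgType k) (A : algType k).
Variables (w : weak_action H A) (f : {linear tensor H H -> A}).
Hypothesis hE : is_crossed_product w f.
Notation E := (crossed_product hE).
Notation "a # h" := (cprod hE a h) (at level 35).

Lemma wactl_slotlin a : slotlin (fun s => wactl w s a).
Proof.
move=> s1 s2; elim: s1 => [|h s1 IH] /=; first exact: wactlinl.
exact: (linear_comp (@wactlin _ _ _ w h) IH).
Qed.

Lemma prod_slotlin : slotlin (fun s : seq H => \prod_(h <- s) h).
Proof.
move=> s1 s2 c x y; rewrite !big_cat !big_cons /=.
by rewrite mulrDl mulrDr -scalerAl -scalerAr.
Qed.

Section Values.
Variable W : lmodType k.
Implicit Types (K : E -> seq H -> seq A -> W) (KA : A -> seq H -> seq A -> W).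

Lemma funext3 (X Y Z T : Type) (u v : X -> Y -> Z -> T) :
  (forall x y z, u x y z = v x y z) -> u = v.
Proof. by move=> e; apply: funext => x; apply: funext => y; apply: funext => z. Qed.

Lemma push_twist_ev (X : Type) h (J : X -> A -> seq H -> seq A -> W) (m : fsum k X) :
  push_twist hE h (fun x hs a => ev (fun p => J p x hs a) m) =
  fun x hs a => ev (fun p => push_twist hE h (J p) x hs a) m.
Proof. by apply: funext3 => x hs a; rewrite /push_twist /twistA /esum -ev_tsum. Qed.

Lemma merge_op_ev (X : Type) (J : X -> A -> seq H -> seq A -> W) (m : fsum k X) hs a :
  merge_op hE hs (fun x hs a => ev (fun p => J p x hs a) m) a =
    ev (fun p => merge_op hE hs (J p) a) m.
Proof.
elim: hs J => [|h hs IH] J; first by rewrite ev0.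
rewrite [LHS]/= push_twist_ev IH -evN; case: hs IH => [|h2 hs] IH.
  by rewrite add0r; apply: eq_ev => p /=; rewrite add0r.
by rewrite /twistA /esum -ev_tsum -evN -evD.
Qed.

Lemma merge_op_sw2 (J : H -> H -> A -> seq H -> seq A -> W) h hs a :
  merge_op hE hs (fun x hs a => sw2 h (fun h1 h2 => J h1 h2 x hs a)) a =
  sw2 h (fun h1 h2 => merge_op hE hs (J h1 h2) a).
Proof.
rewrite /sw2 tsum_ev -merge_op_ev; congr merge_op; apply: funext3 => x hs' a'.
by rewrite tsum_ev.
Qed.

Lemma merge_opZ c KA hs a : merge_op hE hs (fun x hs a => c *: KA x hs a) a = c *:
  merge_op hE hs KA a.
Proof.
have := @merge_op_ev unit (fun _ => KA) [:: (c, tt)] hs a; rewrite ev_seq1 => <-.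
by congr merge_op; apply: funext3 => x hs' a'; rewrite ev_seq1.
Qed.

Lemma eq_merge_op_size KA KA' hs a :
  (forall x hs', (size hs').+1 = size hs -> KA x hs' a = KA' x hs' a) ->
    merge_op hE hs KA a = merge_op hE hs KA' a.
Proof.
elim: hs KA KA' => [|h hs IH] KA KA' e //=; congr (_ - _).
  case: hs e {IH} => [|h2 hs] e //; congr (- _).
  by apply: eq_esum => c g; rewrite e.
by apply: IH => x hs' sz; apply: eq_esum => c g; rewrite e //= sz.
Qed.

Lemma push_op_nil KA hs : push_op hE hs KA [::] = 0.
Proof. by elim: hs KA => [|h hs IH] KA //=. Qed.

Lemma sw2_coassoc2 (T : H -> H -> H -> H -> H -> H -> W) h l :
  (forall y p u q v, linear (fun x => T x y p u q v)) ->
  (forall x p u q v, linear (fun y => T x y p u q v)) ->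
  (forall x y u q v, linear (fun p => T x y p u q v)) ->
  (forall x y p q v, linear (fun u => T x y p u q v)) ->
  (forall x y p u v, linear (fun q => T x y p u q v)) ->
  (forall x y p u q, linear (T x y p u q)) ->
  sw2 h (fun x1 x2 => sw2 l (fun y1 y2 =>
    sw2 x2 (fun p q => sw2 y2 (fun u v => T x1 y1 p u q v)))) =
  sw2 h (fun x1 x2 => sw2 l (fun y1 y2 =>
    sw2 x1 (fun x p => sw2 y1 (fun y u => T x y p u x2 y2)))).
Proof.
move=> T1 T2 T3 T4 T5 T6.
transitivity (sw2 h (fun x1 x2 => sw2 x2 (fun p q =>
    sw2 l (fun y1 y2 => sw2 y2 (fun u v => T x1 y1 p u q v))))).
  by apply: eq_sw2 => x1 x2; apply: tsum_exchange.
rewrite -sw2_coassoc.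
- apply: eq_sw2 => x1 x2; rewrite [RHS]tsum_exchange; apply: eq_tsum => x p.
  by rewrite -[RHS]/(sw2 l _) [RHS]sw2_coassoc.
- by move=> *; apply: sw2_param => ? ?; apply: sw2_param => ? ?; apply: T1.
- by move=> *; apply: sw2_param => ? ?; apply: sw2_param => ? ?; apply: T3.
- by move=> *; apply: sw2_param => ? ?; apply: sw2_param => ? ?; apply: T5.
Qed.

Section Colinearity.
Variable J : A -> seq H -> seq A -> H -> W.
Hypothesis J1 : forall g, A_multilinear (fun x hs a => J x hs a g).
Hypothesis J2 : forall x hs a, linear (J x hs a).

(** [J] evaluated on the coaction of H on words that sends h to h^(1) (x) h_1^(2) ... h_l^(2). *)
Let Jb x hs a := lsw2 hs (fun t1 t2 => J x t1 a (\prod_(h <- t2) h)).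

Lemma colin_A_multilinear : A_multilinear Jb.
Proof.
split=> [hs a|x]; first by apply: lsw2_param => t1 t2; apply: (J1 _).1.
split=> [a|hs]; last by move=> s1 s2; apply: lsw2_param => t1 t2; apply: ((J1 _).2 x).2.
apply: lsw2_slotlin => s; first exact: ((J1 _).2 x).1.
by move=> s1 s2; apply: (linear_comp (J2 x s a) (prod_slotlin s1 s2)).
Qed.

Lemma push_op_colin hs a : push_op hE hs Jb a =
  lsw2 hs (fun t1 t2 => push_op hE t1 (fun x hs a => J x hs a (\prod_(h <- t2) h)) a).
Proof.
case: a => [|a1 a].
  rewrite push_op_nil lsw2_ev -[LHS](ev0 _ (lsw2_terms hs)); apply: eq_ev => p.
  by rewrite push_op_nil.
rewrite push_op_sw; last exact: colin_A_multilinear.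
rewrite -lsw2_coassoc.
- by apply: eq_lsw2 => t1 t2 _ _; rewrite push_op_sw.
- by move=> s t s1 s2; apply: (linear_comp ((J1 _).1 _ _) (wactl_slotlin a1 s1 s2)).
- by move=> r t; apply: ((J1 _).2 _).1.
- by move=> r s s1 s2; apply: (linear_comp (J2 _ _ _) (prod_slotlin s1 s2)).
Qed.

End Colinearity.

(** Merging respects the coaction: replacing two neighbours by their product keeps the total product
    of the second factors, because [coprod] is multiplicative. The factors that go into f are sorted
    out by coassociativity. *)
Lemma merge_op_colin (J : A -> seq H -> seq A -> H -> W) hs a :
  (forall g, A_multilinear (fun x hs a => J x hs a g)) ->
    (forall x hs a, linear (J x hs a)) ->
  merge_op hE hs (fun x hs a => lsw2 hs (fun t1 t2 => J x t1 a (\prod_(h <- t2) h))) a =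
  lsw2 hs (fun t1 t2 => merge_op hE t1 (fun x hs a => J x hs a (\prod_(h <- t2) h)) a).
Proof.
elim: hs J => [|h hs IH] J J1 J2 //.
have Jk := colin_A_multilinear J1 J2.
(* Moving [h] across the coefficient keeps the shape of the summand: the action on [x] and the
   second factor of the remaining letter are absorbed in [J'], to which the induction hypothesis
   applies. *)
pose J' x t1 a' g := sw2 h
  (fun h1 h2 => sw2 h2 (fun g1 g2 => J (w h1 x) (g1 :: t1) a' (g2 * g))).
have J1' g : A_multilinear (fun x hs a => J' x hs a g).
  split=> [hs' a'|x]; last split=> [a'|hs'] s1 s2.
  - apply: sw2_param => h1 h2; apply: sw2_param => g1 g2.
    exact: (linear_comp ((J1 _).1 _ _) (@wactlin _ _ _ w h1)).
  - apply: sw2_param => h1 h2; apply: sw2_param => g1 g2; apply: ((J1 _).2 _).1 _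
    (g1 :: s1) s2.
  - by apply: sw2_param => h1 h2; apply: sw2_param => g1 g2; apply: ((J1 _).2 _).2.
have J2' x hs' a' : linear (J' x hs' a').
  apply: sw2_param => h1 h2; apply: sw2_param => g1 g2.
  by apply: (linear_comp (J2 _ _ _)) => c u v; rewrite mulrDr -scalerAr.
rewrite [LHS]/=.
have -> : push_twist hE h
  (fun x hs a => lsw2 hs (fun t1 t2 => J x t1 a (\prod_(h <- t2) h))) =
    fun x hs a => lsw2 hs (fun t1 t2 => J' x t1 a (\prod_(h <- t2) h)).
  apply: funext3 => x hs' a'; rewrite push_twistE // lsw2_sw2; apply: eq_sw2 => h1 h2.
  rewrite lsw2_sw2; apply: eq_sw2 => g1 g2.
  by apply: eq_lsw2 => t1 t2 _ _; rewrite big_cons.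
rewrite IH //.
have -> : lsw2 hs (fun t1 t2 => merge_op hE t1
  (fun x hs a => J' x hs a (\prod_(h <- t2) h)) a) =
    sw2 h (fun h1 h2 => lsw2 hs (fun t1 t2 =>
      merge_op hE t1 (push_twist hE h1 (fun x hs a => J x hs a (\prod_(h <- h2 :: t2) h)))
        a)).
  rewrite -lsw2_sw2; apply: eq_lsw2 => t1 t2 _ _.
  rewrite -merge_op_sw2; congr merge_op; apply: funext3 => x hs' a'.
  rewrite /J' -sw2_coassoc.
  - by apply: eq_sw2 => h1 h2; rewrite push_twistE //; apply: eq_sw2 => g1 g2;
    rewrite big_cons.
  - by move=> y z; apply: (linear_comp ((J1 _).1 _ _) (@wactlinl _ _ _ w x)).
  - by move=> y z; exact: (((J1 _).2 _).1 a' [::] hs').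
  - by move=> y z; apply: (linear_comp (J2 _ _ _)) => c u v; rewrite mulrDl -scalerAl.
rewrite -[RHS]/(sw2 h (fun h1 h2 => lsw2 hs (fun t1 t2 =>
  merge_op hE (h1 :: t1) (fun x hs a => J x hs a (\prod_(h <- h2 :: t2) h)) a))).
rewrite -tsumN; case: hs {IH} => [|h2 hs].
  by rewrite add0r; apply: eq_tsum => h1 h2 /=; rewrite add0r.
have -> : twistA h (fun x hs a => lsw2 hs (fun t1 t2 => J x t1 a (\prod_(h <- t2) h)))
  (1 # h2) hs a
  = sw2 h (fun h1 h1' => sw2 h2 (fun k1 k2 => lsw2 hs (fun t1 t2 =>
      twistA h1 (fun x hs a => J x hs a (\prod_(h <- [:: h1', k2 & t2]) h)) (1 # k1)
        t1 a))).
  rewrite twistA_H //.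
  pose T x1 y1 p u q v := lsw2 hs (fun t1 t2 =>
    J (f2 f x1 y1) (p * u :: t1) a (q * v * \prod_(h <- t2) h)).
  transitivity (sw2 h (fun x1 x2 => sw2 h2
    (fun y1 y2 => sw2 x2 (fun p q => sw2 y2 (fun u v =>
    T x1 y1 p u q v))))).
    apply: eq_sw2 => x1 x2; apply: eq_sw2 => y1 y2; rewrite /= sw2M; last first.
      split=> [g2|g1]; apply: lsw2_param => t1 t2.
        exact: (((J1 _).2 _).1 a [::]).
      apply: (linear_comp (J2 _ _ _)) => c u v.
      by rewrite !big_cons mulrDl -scalerAl.
    apply: eq_sw2 => p q; apply: eq_sw2 => u v; rewrite /T.
    by apply: eq_lsw2 => t1 t2 _ _; rewrite big_cons.
  rewrite sw2_coassoc2.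
  - apply: eq_sw2 => x1 x2; apply: eq_sw2 => y1 y2.
    under [RHS]eq_lsw2 => t1 t2 do rewrite twistA_H //.
    rewrite lsw2_sw2; apply: eq_sw2 => p q; rewrite lsw2_sw2; apply: eq_sw2 => u v.
    by apply: eq_lsw2 => t1 t2 _ _; rewrite !big_cons mulrA.
  - move=> *; apply: lsw2_param => t1 t2; apply: (linear_comp ((J1 _).1 _ _)); exact:
    f2_linl.
  - move=> *; apply: lsw2_param => t1 t2; apply: (linear_comp ((J1 _).1 _ _)); exact:
    f2_linr.
  - move=> *; apply: lsw2_param => t1 t2; apply: (linear_comp (((J1 _).2 _).1 a [::] _)).
    by move=> c y z; rewrite mulrDl -scalerAl.
  - move=> *; apply: lsw2_param => t1 t2; apply: (linear_comp (((J1 _).2 _).1 a [::] _)).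
    by move=> c y z; rewrite mulrDr -scalerAr.
  - move=> *; apply: lsw2_param => t1 t2; apply: (linear_comp (J2 _ _ _)).
    by move=> c y z; rewrite !mulrDl -!scalerAl.
  - move=> *; apply: lsw2_param => t1 t2; apply: (linear_comp (J2 _ _ _)).
    by move=> c y z; rewrite mulrDr mulrDl -scalerAr -scalerAl.
rewrite -tsumN -tsumD; apply: eq_tsum => h1 h1'.
rewrite -!tsumN -tsumD; apply: eq_tsum => k1 k2.
by rewrite -!/(lsw2 _ _) !lsw2_ev -!evN -evD.
Qed.
End Values.
End Colinear.

(** * The letter-by-letter recursion for F brought to the form of its definition *)

Section Unrolling.
Variables (k : comNzRingType) (H : hopfAlgType k) (A : algType k).
Variables (w : weak_action H A) (f : {linear tensor H H -> A}).
Hypothesis hE : is_crossed_product w f.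
Notation E := (crossed_product hE).
Notation "a # h" := (cprod hE a h) (at level 35).
Notation Ab := (tpow (rbar A)).

Section Values.
Variable W : lmodType k.
Implicit Types (K : seq A -> H -> W) (Z : seq A -> seq H -> W).

(** Each step shortens the word by one letter in total, so this number of steps leaves exactly
    one. *)
Definition F_sum K hs a : W := F_op hE (size hs + size a).-1 K hs a.

Lemma F_op_nil n K a : F_op hE n K [::] a = 0.
Proof.
elim: n K a => [|n IH] K a; first by rewrite /F_op /= ev_nil.
by rewrite F_opS; case: a => [|a1 a]; rewrite ?leftA_op_nil ?leftA_op_nil_cons.
Qed.

Lemma F_sum_nil K a : F_sum K [::] a = 0. Proof. exact: F_op_nil. Qed.

Lemma F_sum1 K h : F_sum K [:: h] [::] = K [::] h. Proof. exact: F_op0. Qed.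

Lemma F_sum_step K hs a : (0 < size hs)%N -> (1 < size hs + size a)%N ->
  F_sum K hs a = merge_op hE hs (fun x hs' a' => F_sum (fun c => K (x :: c)) hs' a') a
    + (-1) ^+ size hs *: push_op hE hs
      (fun x hs' a' => F_sum (fun c => K (x :: c)) hs' a') a.
Proof.
case: hs => // h hs _; case E0 : (size (h :: hs) + size a)%N => [|[|n]] // _.
rewrite {1}/F_sum E0 F_opS -leftA_op_split; apply: eq_leftA_op_size => x hs' a' _.
by rewrite E0 /F_sum => -[->].
Qed.

Lemma eq_F_sum K K' hs a :
  (forall c y, (size c).+1 = (size hs + size a)%N -> K c y = K' c y) ->
  F_sum K hs a = F_sum K' hs a.
Proof.
move=> e; case: hs e => [|h hs] e; first by rewrite !F_sum_nil.
by apply: eq_F_op => c y sc; apply: e; rewrite sc.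
Qed.

Lemma F_sum_slotlin2 K : (forall y, slotlin (K^~ y)) -> (forall c, linear (K c)) ->
  slotlin2 (F_sum K).
Proof.
move=> Kc Ky; split=> [a|hs] s1 s2 c x y; rewrite /F_sum !size_cat /=.
  exact: (F_op_linH hE _ Kc Ky).1.
exact: (F_op_linH hE _ Kc Ky).2.
Qed.

Lemma F_sum_A_multilinear K : (forall y, slotlin (K^~ y)) -> (forall c, linear (K c)) ->
  A_multilinear (fun x => F_sum (fun c => K (x :: c))).
Proof.
move=> Kc Ky; split=> [hs a|z].
  by apply: ev_param => p; apply: (Kc _ [::]).
by apply: F_sum_slotlin2 => *; [apply: (@slotlin_cons _ _ _ (K^~ _)) | apply: Ky].
Qed.

Lemma F_sum_linear (V : lmodType k) (g : W -> V) K hs a : linear g ->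
  g (F_sum K hs a) = ev (fun p => g (K p.1 p.2)) (F_terms hE (size hs + size a).-1 hs a).
Proof. by move=> gl; rewrite /F_sum /F_op (ev_linear _ _ gl). Qed.

(* The [H]-component emitted last by [F_sum] is the product of the comultiples
   of all the entries of [hs]. *)
Lemma F_sum_colin K hs a : (forall y, slotlin (K^~ y)) -> (forall c, linear (K c)) ->
  F_sum K hs a = lsw2 hs (fun t1 t2 =>
    F_sum (fun c y => counit y *: K c (\prod_(h <- t2) h)) t1 a).
Proof.
have [n] := ubnP (size hs + size a); elim: n K hs a => // n IH K hs a le_n Kc Ky.
case: hs le_n => [|h hs] le_n; first by rewrite /= !F_sum_nil.
have [e1|n1] := eqVneq (size (h :: hs) + size a)%N 1%N.
  case: hs a e1 {le_n} => [|h' hs] [|a1 a] //= _; rewrite F_sum1.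
  rewrite -(sw2_counitl h (Ky [::])); apply: eq_sw2 => x y.
  by rewrite F_sum1 big_seq1.
have lt1 : (1 < size (h :: hs) + size a)%N by rewrite ltn_neqAle eq_sym n1.
rewrite F_sum_step //.
pose J x hs a g := F_sum (fun c y => counit y *: K (x :: c) g) hs a.
have J1 g : A_multilinear (fun x hs a => J x hs a g).
  apply: (F_sum_A_multilinear (K := fun c y => counit y *: K c g)) => [y|c].
    by move=> s1 s2; apply: (linear_scale _ (Kc _ s1 s2)).
  exact: counit_lin.
have J2 x hs' a' : linear (J x hs' a').
  by apply: ev_param => p; apply: (linear_scale _ (Ky _)).
have Kx x y : slotlin (fun c => K (x :: c) y) by apply: (@slotlin_cons _ _ _ (K^~ y)).
have -> : merge_op hE (h :: hs) (fun x hs' a' => F_sum (fun c => K (x :: c)) hs' a') a =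
    merge_op hE (h :: hs) (fun x hs a => lsw2 hs
      (fun t1 t2 => J x t1 a (\prod_(h <- t2) h))) a.
  apply: eq_merge_op_size => x hs' sz; apply: IH => //.
  by move: le_n; rewrite -sz; lia.
have -> : push_op hE (h :: hs) (fun x hs' a' => F_sum (fun c => K (x :: c)) hs' a') a =
    push_op hE (h :: hs) (fun x hs a => lsw2 hs
      (fun t1 t2 => J x t1 a (\prod_(h <- t2) h))) a.
  case: a le_n {n1 lt1} => [|a1 a] le_n; first by rewrite !push_op_nil.
  rewrite !push_op_sw; [|exact: colin_A_multilinear|exact: F_sum_A_multilinear].
  apply: eq_lsw2 => s1 s2 _ sz; apply: IH => //.
  by move: le_n; rewrite -sz /= addnS ltnS; lia.
rewrite merge_op_colin // push_op_colin // -lsw2Z -lsw2D.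
by apply: eq_lsw2 => t1 t2 s1 _; rewrite F_sum_step ?s1.
Qed.

(** Moves the entries of [a] across [hs] one at a time, each taking one Sweedler factor of the whole
    word; the factor that remains is handed to [Z]. It is the curried form of a^(h^(1)) (x)
    h^(2). *)
Fixpoint multipush hs a Z : W :=
  match a with
  | [::] => Z [::] hs
  | x :: a' => lsw2 hs (fun s1 s2 => multipush s2 a' (fun cs => Z (wactl w s1 x :: cs)))
  end.

Lemma eq_multipush hs a Z Z' :
  (forall cs hs', size cs = size a -> size hs' = size hs -> Z cs hs' = Z' cs hs') ->
  multipush hs a Z = multipush hs a Z'.
Proof.
elim: a hs Z Z' => [|x a IH] hs Z Z' e /=; first exact: e.
apply: eq_lsw2 => s1 s2 _ sz; apply: IH => cs hs' e1 e2.
by apply: e; rewrite /= ?e1 ?e2 ?sz.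
Qed.

Lemma multipushZ c hs a Z : multipush hs a (fun cs hs' => c *: Z cs hs') = c *:
  multipush hs a Z.
Proof.
elim: a hs Z => [|x a IH] hs Z //=; rewrite -lsw2Z.
by apply: eq_lsw2 => s1 s2 _ _; rewrite IH.
Qed.

Lemma lsw2_sum hs (I : Type) (r : seq I) (e : I -> seq H -> seq H -> W) :
  lsw2 hs (fun s1 s2 => \sum_(i <- r) e i s1 s2) = \sum_(i <- r) lsw2 hs (e i).
Proof.
elim: r => [|i r IH]; first by rewrite big_nil lsw2_ev -[RHS](ev0 W (lsw2_terms hs));
  apply: eq_ev => p; rewrite big_nil.
rewrite big_cons -IH !lsw2_ev -evD; apply: eq_ev => p.
by rewrite big_cons.
Qed.

(** With one letter there is nothing to merge: every step pushes an entry of [a] and costs a sign.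
    Up to this sign, F^(1) is thus the action. *)
Lemma F_sum_single K h a : (forall y, slotlin (K^~ y)) -> (forall c, linear (K c)) ->
  F_sum K [:: h] a = (-1) ^+ size a *: multipush [:: h]
    a (fun cs hs' => K cs (\prod_(g <- hs') g)).
Proof.
elim: a K h => [|x a IH] K h Kc Ky.
  by rewrite F_sum1 /= scale1r big_seq1.
rewrite F_sum_step // [merge_op _ _ _ _]/= subr0 add0r push_op_sw; last exact:
  F_sum_A_multilinear.
rewrite expr1 /= exprS -scalerA; congr (_ *: _).
rewrite /sw2 -tsumZ; apply: eq_tsum => y z; rewrite IH //.
by move=> g; apply: (@slotlin_cons _ _ _ (K^~ _)).
Qed.

(** The index [i] counts the entries of [a] pushed before the first merge, each with the sign
    (-1)^(size hs). A word of at least two letters must merge at some point before a single letter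
    remains, so these cases are exhaustive. *)
Lemma F_sum_unroll K hs a : (1 < size hs)%N -> (forall y, slotlin (K^~ y)) ->
  (forall c, linear (K c)) ->
  F_sum K hs a = \sum_(0 <= i < (size a).+1) (-1) ^+ (size hs * i) *:
    multipush hs (take i a) (fun cs hs' =>
      merge_op hE hs' (fun b hs'' a'' => F_sum (fun c => K (cs ++ b :: c)) hs'' a'')
        (drop i a)).
Proof.
elim: a K hs => [|x a IH] K hs sz Kc Ky.
  rewrite big_nat1 muln0 scale1r /= F_sum_step ?addn0 //; last by lia.
  by rewrite push_op_nil scaler0 addr0.
rewrite F_sum_step ?(ltn_addr _ sz) //; last by lia.
rewrite big_nat_recl //= muln0 scale1r; congr (_ + _).
rewrite push_op_sw; last exact: F_sum_A_multilinear.
transitivity ((-1) ^+ size hs *: lsw2 hs (fun s1 s2 => \sum_(0 <= i < (size a).+1)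
    (-1) ^+ (size hs * i) *: multipush s2 (take i a) (fun cs hs' =>
      merge_op hE hs' (fun b hs'' a'' => F_sum (fun c => K (wactl w s1 x :: cs ++
        b :: c)) hs'' a'') (drop i a)))).
  congr (_ *: _); apply: eq_lsw2 => s1 s2 _ e2.
  rewrite IH ?e2 // => y; exact: (@slotlin_cons _ _ _ (K^~ y)).
rewrite lsw2_sum scaler_sumr; apply: eq_bigr => i _.
by rewrite lsw2Z scalerA -exprD mulnS.
Qed.

End Values.
End Unrolling.

(** * The maps F *)

Section Regroup.
Variables (k : comNzRingType) (H : hopfAlgType k) (W : lmodType k).

(* The left-hand side is the shape of the sums in [is_F_family]. *)
Lemma regroup (U V : seq H) x y
    (T : seq H -> seq H -> seq H -> H -> H -> H -> H -> seq H -> W) :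
  lsw3 U (fun u1 u2 u3 => sw3 x (fun x1 x2 x3 => sw3 y (fun y1 y2 y3 =>
    lsw2 V (fun v1 v2 => T (u1 ++ x1 :: y1 :: v1) u2 u3 x2 x3 y2 y3 v2)))) =
  lsw2 (U ++ x :: y :: V) (fun s1 s2 => lsw2 (take (size U) s2) (fun u2 u3 =>
    sw2 (nth 0 s2 (size U)) (fun x2 x3 => sw2 (nth 0 s2 (size U).+1) (fun y2 y3 =>
      T s1 u2 u3 x2 x3 y2 y3 (drop (size U).+2 s2))))).
Proof.
elim: U T => [|h U IH] T.
  transitivity (sw2 x (fun x1 x' => sw2 y (fun y1 y' => lsw2 V (fun v1 v2 =>
      sw2 x' (fun x2 x3 => sw2 y' (fun y2 y3 => T [:: x1,
        y1 & v1] [::] [::] x2 x3 y2 y3 v2)))))).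
    apply: eq_sw2 => x1 x'; rewrite [LHS]tsum_exchange; apply: eq_sw2 => y1 y'.
    rewrite lsw2_sw2; apply: eq_sw2 => x2 x3.
    by rewrite lsw2_sw2.
  apply: eq_sw2 => x1 x'; apply: eq_sw2 => y1 y'; apply: eq_lsw2 => v1 v2 _ _.
  by apply: eq_sw2 => x2 x3; apply: eq_sw2 => y2 y3; rewrite /= drop0.
apply: eq_sw2 => h1 h'.
rewrite -[RHS]/(lsw2 (U ++ x :: y :: V) (fun s1 s2 => sw2 h' (fun h2 h3 =>
  lsw2 (take (size U) s2) (fun u2 u3 => sw2 (nth 0 s2 (size U)) (fun x2 x3 =>
  sw2 (nth 0 s2 (size U).+1) (fun y2 y3 =>
    T (h1 :: s1) (h2 :: u2) (h3 :: u3) x2 x3 y2 y3 (drop (size U).+2 s2))))))).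
rewrite lsw2_sw2; apply: eq_sw2 => h2 h3.
exact: (IH (fun s1 u2 u3 => T (h1 :: s1) (h2 :: u2) (h3 :: u3))).
Qed.

End Regroup.

Section Concatenation.
Variables (k : comNzRingType) (V : lmodType k).

Lemma tcat_linl m n (y : tpow V n) : linear (fun x : tpow V m => tcat x y).
Proof.
elim: m => [|m IH] /=; first by move=> c x z; rewrite scalerDl scalerA.
apply: tsum_linear; split=> [t|v]; first exact: tprodPl.
exact: (linear_comp (tprodPr v) IH).
Qed.

Lemma tcat_linr m n (x : tpow V m) : linear (fun y : tpow V n => tcat x y).
Proof.
elim: m x => [|m IH] x /=; first exact: linear_scale.
by apply: tsum_param => v t; apply: (linear_comp (tprodPr v) (IH t)).
Qed.

Lemma tcat_tprod m n v (t : tpow V m) (y : tpow V n) :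
  tcat (tprod v t : tpow V m.+1) y = tprod v (tcat t y).
Proof.
rewrite /= tsumE //; split=> [t'|v']; first exact: tprodPl.
exact: (linear_comp (tprodPr v') (@tcat_linl _ _ y)).
Qed.

Lemma tpow_cast_linear m n : linear (@tpow_cast k V m n).
Proof.
rewrite /tpow_cast; case: eqP => [e|_]; last exact: linear_zero.
by case: _ / e.
Qed.

Lemma tpow_cast_tpure m n s : m = n -> tpow_cast n (tpure m s : tpow V m) = tpure n s.
Proof.
move=> <-; rewrite /tpow_cast; case: eqP => // e.
by rewrite (eq_irrelevance e erefl).
Qed.

Lemma tcat_tpure m n s t : size s = m ->
  tcat (tpure m s : tpow V m) (tpure n t) = tpure (m + n) (s ++ t).
Proof.
elim: m s => [|m IH] [|v s] // ss; first by rewrite /= scale1r.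
by rewrite [tpure m.+1 _]/= tcat_tprod IH //; case: ss.
Qed.

End Concatenation.

Section BConcatenation.
Variables (k : comNzRingType) (B : algType k).

Lemma tpow_cast_bpure m n (s : seq B) : m = n -> tpow_cast n (bpure m s) = bpure n s.
Proof. exact: tpow_cast_tpure. Qed.

Lemma tcat_bpure m n (s t : seq B) : size s = m ->
  tcat (bpure m s) (bpure n t) = bpure (m + n) (s ++ t).
Proof. by move=> ss; rewrite /bpure tcat_tpure ?size_map // map_cat. Qed.

End BConcatenation.

Section Formula.
Variables (k : comNzRingType) (H : hopfAlgType k) (A : algType k).
Variables (w : weak_action H A) (f : {linear tensor H H -> A}).
Hypothesis hE : is_crossed_product w f.
Notation E := (crossed_product hE).
Notation "a # h" := (cprod hE a h) (at level 35).
Notation Ab := (tpow (rbar A)).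

Lemma counit_prod_slotlin : slotlin (fun s : seq H => (\prod_(h <- s) counit h : k^o)).
Proof.
move=> s1 s2 c x y; rewrite !big_cat !big_cons /= counit_linear.
by rewrite mulrDl mulrDr /GRing.scale /= -mulrA mulrCA.
Qed.

Lemma tact_slotlin a : slotlin (fun s => tact w s a).
Proof.
elim: a => [|x a IH]; first exact: counit_prod_slotlin.
apply: lsw2_slotlin => s s1 s2.
  apply: (linear_comp (tprodPl _)); apply: (linear_comp (@bcl_lin _ _)).
  exact: wactl_slotlin.
exact: (linear_comp (tprodPr _) (IH s1 s2)).
Qed.

(** The base case is the counit law, since [tact] acts on the empty tensor through the counit; the
    inductive step is coassociativity. *)
Lemma tact_multipush (W : lmodType k) hs a (Z : seq H -> Ab (size a) -> W) :
  (forall s, linear (Z s)) -> (forall t, slotlin (Z^~ t)) ->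
  lsw2 hs (fun s1 s2 => Z s2 (tact w s1 a)) =
  multipush w hs a (fun cs s2 => Z s2 (bpure (size a) cs)).
Proof.
elim: a hs Z => [|x a IH] hs Z Zl Zs.
  rewrite /= -(lsw2_counitl hs (Zs (1 : k^o))).
  apply: eq_lsw2 => s1 s2 _ _; rewrite -(linZ (Zl _)); congr (Z _ _).
  by rewrite /GRing.scale /= mulr1.
pose Z' b s t := Z s (tprod (bcl b) t : Ab (size (x :: a))).
have Z'l b s : linear (Z' b s) by apply: (linear_comp (Zl s) (tprodPr _)).
transitivity (lsw2 hs (fun s t => lsw2 t (fun s2 s3 => Z' (wactl w s x) s3 (tact w s2 a)))).
  rewrite -(@lsw2_coassoc _ _ _ hs (fun r s t => Z' (wactl w r x) t (tact w s a))).
  - apply: eq_lsw2 => s1 s2 _ _; rewrite [tact _ _ _]/=.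
    by rewrite (lsw2_linear _ _ (Zl s2)).
  - move=> s t s1 s2; apply: (linear_comp (Zl t)).
    apply: (linear_comp (tprodPl _)); apply: (linear_comp (@bcl_lin _ _)).
    exact: wactl_slotlin.
  - by move=> r t s1 s2; apply: (linear_comp (Z'l _ _) (tact_slotlin a s1 s2)).
  - by move=> r s; apply: Zs.
rewrite [RHS]/=; apply: eq_lsw2 => s1 s2 _ _; rewrite IH //.
by move=> t; apply: Zs.
Qed.

Lemma merge_op_param (V W : lmodType k) (K : V -> A -> seq H -> seq A -> W) hs a :
  (forall x hs a, linear (fun v => K v x hs a)) -> linear (fun v => merge_op hE hs (K v) a).
Proof.
move=> Kl c u v.
have := merge_op_ev hE (fun p : V => K p) [:: (c, u); (1, v)] hs a.
rewrite !ev_cons ev_nil addr0 scale1r => <-; congr merge_op; apply: funext3 => x hs' a'.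
by rewrite !ev_cons ev_nil addr0 scale1r Kl.
Qed.

Lemma push_op_slotlin (W : lmodType k) (K : A -> seq H -> seq A -> W) a :
  A_multilinear K -> slotlin (fun hs => push_op hE hs K a).
Proof.
move=> Kl; case: a => [|a1 a] s1 s2 c x y; first by rewrite !push_op_nil scaler0 addr0.
rewrite !push_op_sw //; apply: lsw2_slotlin => s t1 t2.
  exact: (linear_comp (Kl.1 _ _) (wactl_slotlin w a1 t1 t2)).
exact: ((Kl.2 _).1 a t1 t2).
Qed.

Lemma merge_op_slotlin (W : lmodType k) (K : A -> seq H -> seq A -> W) a :
  A_multilinear K -> slotlin (fun hs => merge_op hE hs K a).
Proof.
move=> Kl; have E1 h hs : merge_op hE (h :: hs) K a =
    leftA_op hE K (h :: hs) a - (-1) ^+ (size hs).+1 *: push_op hE (h :: hs) K a.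
  by rewrite leftA_op_split addrK.
have E2 s1 x s2 : merge_op hE (s1 ++ x :: s2) K a = leftA_op hE K (s1 ++ x :: s2) a
    - (-1) ^+ (size s1 + size s2).+1 *: push_op hE (s1 ++ x :: s2) K a.
  by case: s1 => [|h s1]; [exact: E1 | rewrite cat_cons E1 size_cat addnS].
move=> s1 s2 c x y; rewrite !E2 (leftA_op_slotlinH hE _ Kl) (push_op_slotlin _ Kl).
by rewrite scalerDr scalerBr !scalerA [c * _]mulrC opprD addrACA.
Qed.

(** The formal sum represents (-1)^r F(h^(1) (x) a) (x) h_1^(2) ... h_l^(2), from which the counit
    recovers F. [N] is the expected number of emitted letters: [bpure N] vanishes on lists of
    another length. *)
Definition F_value N hs a : Ab N :=
  (-1) ^+ size a *: F_sum hE (fun c y => counit y *: bpure N c) hs a.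

Lemma F_summand_slotlin N (y : H) : slotlin (fun c : seq A => counit y *: bpure N c).
Proof. by move=> s1 s2; apply: (linear_scale _ (bpure_linear N s1 s2)). Qed.
Lemma F_summand_linear N (c : seq A) : linear (fun y : H => counit y *: bpure N c).
Proof. exact: counit_lin. Qed.
Hint Resolve F_summand_slotlin F_summand_linear : core.

Lemma F_value_slotlin2 N : slotlin2 (F_value N).
Proof.
have [L1 L2] := F_sum_slotlin2 hE (@F_summand_slotlin N) (@F_summand_linear N).
split=> [a|hs] s1 s2; first exact: (linear_scale _ (L1 _ _ _)).
by move=> c x y; rewrite /F_value !size_cat /= L2 scalerDr !scalerA mulrC.
Qed.

Lemma push_F_value (W : lmodType k) N (g : Ab N -> W) hs a : linear g ->
  g (F_value N hs a) = (-1) ^+ size a *: F_sum hE (fun c y => counit y *: g (bpure N c))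
    hs a.
Proof.
move=> gl; rewrite /F_value (linZ gl) (F_sum_linear _ _ _ _ gl); congr (_ *: _).
by apply: eq_ev => p; rewrite (linZ gl).
Qed.

Lemma F_value_single g a : F_value (size a) [:: g] a = tact w [:: g] a.
Proof.
rewrite /F_value F_sum_single // scalerA -expr2 sqrr_sign scale1r.
rewrite -(@tact_multipush _ [:: g] a (fun s t => counit (\prod_(h <- s) h) *: t)).
- have := @lsw2_counitr k H (Ab (size a)) [:: g] (fun s => tact w s a) (tact_slotlin a).
  by [].
- by move=> s; apply: linear_scale.
- move=> t s1 s2; apply: (@linear_comp _ H H _ (fun y => counit y *: t)); first exact:
  counit_lin.
  exact: prod_slotlin.
Qed.

(** The inner map is a parameter [Ft] so that one statement covers both clauses with r >= 1 of the
    definition of F: for l = 1 it is [tact], for l >= 2 it is F^(l) itself. *)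
Lemma F_value_unroll l hs a N (n : nat -> nat) (Ft : forall i, seq H -> Ab (n i)) :
  (0 < l)%N -> size hs = l.+1 -> N = (size a + l)%N ->
  (forall i, (i <= size a)%N -> (n i).+1 = (size a - i + l)%N) ->
  (forall i hs', (i <= size a)%N -> size hs' = l -> Ft i hs' =
    F_value (n i) hs' (drop i a)) ->
  F_value N hs a = \sum_(1 <= j < l.+1) \sum_(0 <= i < (size a).+1) (-1) ^+ (i * l + j) *:
    lsw3 (take j.-1 hs) (fun u1 u2 u3 =>
    sw3 (nth 0 hs j.-1) (fun x1 x2 x3 =>
    sw3 (nth 0 hs j) (fun y1 y2 y3 =>
    lsw2 (drop j.+1 hs) (fun v1 v2 =>
      tpow_cast N (tcat (tact w (u1 ++ x1 :: y1 :: v1) (take i a))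
        (tcat (bpure 1 [:: wactl w u2 (f2 f x2 y2)]) (Ft i (u3 ++ (x3 * y3) :: v2)))))))).
Proof.
move=> l0 sz eN en eF; rewrite exchange_big /= {1}/F_value F_sum_unroll //;
  last by rewrite sz ltnS.
rewrite scaler_sumr; apply: eq_big_nat => i /andP[_]; rewrite ltnS => le_i.
pose C s (t : Ab (1 + n i)) := tpow_cast N (tcat (tact w s (take i a)) t) : Ab N.
have Cl s : linear (C s) by apply:
  (linear_comp (@tpow_cast_linear _ _ _ _) (@tcat_linr _ _ _ _ _)).
pose KA s b hs' (a' : seq A) := C s (tcat (bpure 1 [:: b]) (F_value (n i) hs' a')).
have KAl s : A_multilinear (KA s).
  split=> [hs' a'|b].
    by apply: (linear_comp (Cl s)); apply:
      (linear_comp (@tcat_linl _ _ _ _ _) (bpure_linear 1 [::] [::])).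
  have [F1 F2] := F_value_slotlin2 (n i).
  split=> [a'|hs'] s1 s2.
    by apply: (linear_comp (Cl s)); apply:
      (linear_comp (@tcat_linr _ _ _ _ _) (F1 a' s1 s2)).
  by apply: (linear_comp (Cl s)); apply:
    (linear_comp (@tcat_linr _ _ _ _ _) (F2 hs' s1 s2)).
transitivity ((-1) ^+ (i * l) *: lsw2 hs
  (fun s1 s2 => merge_op hE s2 (KA s1) (drop i a))); last first.
  rewrite -lsw2Z.
  transitivity (lsw2 hs (fun s1 s2 => \sum_(1 <= j < l.+1) (-1) ^+ (i * l + j) *:
      lsw2 (take j.-1 s2) (fun u1 u2 => sw2 (nth 0 s2 j.-1) (fun x1 x2 => sw2 (nth 0 s2 j)
      (fun y1 y2 => KA s1 (wactl w u1 (f2 f x1 y1)) (u2 ++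
        (x2 * y2) :: drop j.+1 s2) (drop i a)))))).
    apply: eq_lsw2 => s1 s2 _ e2; rewrite merge_op_sw // scaler_sumr e2 sz.
    by apply: eq_bigr => j _; rewrite scalerA -exprD.
  rewrite lsw2_sum; apply: eq_big_nat => j /andP[j0 jl]; rewrite lsw2Z; congr (_ *: _).
  have sU : size (take j.-1 hs) = j.-1 by rewrite size_takel // sz; lia.
  have ehs : hs = take j.-1 hs ++ nth 0 hs j.-1 :: nth 0 hs j :: drop j.+1 hs.
    rewrite -[in LHS](cat_take_drop j.-1 hs) (drop_nth 0) ?prednK //; last by rewrite sz;
      lia.
    by rewrite (drop_nth 0) // sz; lia.
  apply: etrans (esym (regroup _ _ _ _ (fun s1 u2 u3 x2 x3 y2 y3 v2 =>
    C s1 (tcat (bpure 1 [:: wactl w u2 (f2 f x2 y2)]) (Ft i (u3 ++ (x3 * y3) :: v2)))))).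
  rewrite -ehs sU prednK //; apply: eq_lsw2 => s1 s2 _ e2; apply: eq_lsw2 => u2 u3 _ e3.
  apply: eq_sw2 => x2 x3; apply: eq_sw2 => y2 y3; rewrite eF //.
  by rewrite size_cat /= e3 size_takel ?size_drop e2 sz; lia.
rewrite scalerA -exprD -multipushZ.
pose Z s (t : Ab (size (take i a))) := merge_op hE s (fun b hs' a' =>
  tpow_cast N (tcat t (tcat (bpure 1 [:: b]) (F_value (n i) hs' a'))) : Ab N) (drop i a).
rewrite -lsw2Z -[RHS]/(lsw2 hs (fun s1 s2 => (-1) ^+
  (i * l) *: Z s2 (tact w s1 (take i a)))).
have gl b t : linear (fun u => tpow_cast N (tcat (t :
  Ab (size (take i a))) (tcat (bpure 1 [:: b] : Ab 1) (u : Ab (n i)))) : Ab N).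
  by apply: (linear_comp (@tpow_cast_linear _ _ _ _)); apply:
    (linear_comp (@tcat_linr _ _ _ _ _) (@tcat_linr _ _ _ _ _)).
rewrite (@tact_multipush _ hs (take i a) (fun s t => (-1) ^+ (i * l) *: Z s t)).
- apply: eq_multipush => cs s2 scs e2.
  rewrite /Z -!merge_opZ; apply: eq_merge_op_size => b hs'; rewrite e2 sz => -[shs'].
  rewrite (push_F_value _ _ (gl b _)) scalerA -exprD size_drop; congr (_ *: _).
    (* With [r = size a], pushing [i] entries across [l + 1] letters gives (-1)^((l+1) i); the
       normalizations (-1)^r and (-1)^(r-i) of the two [F_value] turn this into the sign (-1)^(i l)
       of the definition. *)
    rewrite -signr_odd -[RHS]signr_odd; congr (_ ^+ _).
    by rewrite !oddD !oddM oddB //=; case: (odd l); case: (odd i); case: (odd (size a)).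
  apply: eq_F_sum => c y; rewrite shs' size_drop => sc; congr (_ *: _).
  rewrite !tcat_bpure // tpow_cast_bpure //.
  by rewrite size_takel // eN; have := en i le_i; lia.
- move=> t; apply: linear_scale; apply: merge_op_param => b hs' a'.
  by apply: (linear_comp (@tpow_cast_linear _ _ _ _) (@tcat_linl _ _ _ _ _)).
- move=> t s1 s2; apply: linear_scale; apply: merge_op_slotlin.
  have [F1 F2] := F_value_slotlin2 (n i); split=> [hs' a'|b].
    apply: (linear_comp (@tpow_cast_linear _ _ _ _)); apply:
      (linear_comp (@tcat_linr _ _ _ _ _)).
    by apply: (linear_comp (@tcat_linl _ _ _ _ _) (bpure_linear 1 [::] [::])).
  split=> [a'|hs'] t1 t2.
    exact: (linear_comp (gl b t) (F1 a' t1 t2)).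
  exact: (linear_comp (gl b t) (F2 hs' t1 t2)).
Qed.


End Formula.

Section Lift.
Variables (k : comNzRingType) (H : hopfAlgType k) (A : algType k) (W : lmodType k).
Notation Hb := (tpow (rbar H)).
Notation Ab := (tpow (rbar A)).

Lemma hpure_ext s r (g g' : {linear tensor (Hb s) (Ab r) -> W}) :
  (forall hs a, size hs = s -> size a = r -> g (hpure s r hs a) = g' (hpure s r hs a)) ->
    g = g'.
Proof.
move=> gg; apply: hom_ext; apply: tensor_ext;
  [exact: linearP | exact: linearP | move=> u v].
have lu (h : {linear tensor (Hb s) (Ab r) -> W}) u0 : linear (fun v => h (tprod u0 v)).
  exact: (linear_comp (@linearP _ _ _ _ h) (tprodPr u0)).
have lv (h : {linear tensor (Hb s) (Ab r) -> W}) v0 : linear (fun u => h (tprod u v0)).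
  exact: (linear_comp (@linearP _ _ _ _ h) (tprodPl v0)).
suff E1 : mklin (lu g u) = mklin (lu g' u) by rewrite -[LHS]/(mklin (lu g u) v) E1.
apply: bpure_ext => a sa.
rewrite -[LHS]/(g (tprod u (bpure r a))) -[RHS]/(g' (tprod u (bpure r a))).
suff E2 : mklin (lv g (bpure r a)) = mklin (lv g' (bpure r a)).
  by rewrite -[LHS]/(mklin (lv g (bpure r a)) u) E2.
by apply: bpure_ext => hs ss; apply: gg.
Qed.

Lemma hpure_lift s r (Q : seq H -> seq A -> W) : slotlin2 Q ->
  (forall a s1 s2, size a = r -> (size s1 + size s2).+1 = s -> Q (s1 ++ 1 :: s2) a = 0) ->
  (forall hs s1 s2, size hs = s -> (size s1 + size s2).+1 = r -> Q hs (s1 ++ 1 :: s2) = 0)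
    ->
  exists g : {linear tensor (Hb s) (Ab r) -> W},
    forall hs a, size hs = s -> size a = r -> g (hpure s r hs a) = Q hs a.
Proof.
move=> [Q1 Q2] N1 N2.
have /choice[F FE] : forall hs, exists g : {linear Ab r -> W},
    size hs = s -> forall a, size a = r -> g (bpure r a) = Q hs a.
  move=> hs; have [ss|ns] := eqVneq (size hs) s; last first.
    by exists 0 => ss; rewrite ss eqxx in ns.
  have [|s1 s2 e|g gE] := @normalized_lift k W A r (Q hs).
  - by move=> s1 s2 _; apply: Q2.
  - exact: N2.
  by exists g.
have [s1 s2 e c x y|s1 s2 e|phi phiE] := @normalized_lift k {linear Ab r -> W} H s F.
- apply: bpure_ext => a sa; rewrite hom_addE hom_scaleE !FE ?size_cat /= ?addnS //.
  exact: Q1.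
- apply: bpure_ext => a sa; rewrite FE ?size_cat /= ?addnS // N1 //.
have b : bilin (fun u v => phi u v).
  split=> [v|u]; last exact: linearP.
  by move=> c x y; rewrite linearP.
exists (mklin (tsum_linear b)) => hs a sh sa.
by rewrite mklinE /hpure tsumE // phiE // FE.
Qed.

End Lift.

Section FFamily.
Variables (k : comNzRingType) (H : hopfAlgType k) (A : algType k).
Variables (w : weak_action H A) (f : {linear tensor H H -> A}).
Hypothesis hE : is_crossed_product w f.
Notation Hb := (tpow (rbar H)).
Notation Ab := (tpow (rbar A)).

(** The bound [1 < l] comes from normalization: for l = 1 the value on the letter [1] is [a] itself,
    so [F_value] does not factor through the classes modulo k. *)
Lemma F_explicit_ex l r : exists g : {linear tensor (Hb l) (Ab r) -> Ab (r + l - 1)},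
  (1 < l)%N -> forall hs a, size hs = l -> size a = r ->
    g (hpure l r hs a) = F_value hE (r + l - 1) hs a.
Proof.
case: (ltnP 1 l) => l1; last by exists 0.
have Kn y : slotnorm (fun c : seq A => counit (y : H) *: bpure (r + l - 1) c).
  by move=> s1 s2; rewrite bpure_1 scaler0.
have N n := F_op_norm hE n (@F_summand_slotlin k H A (r + l - 1))
  (@F_summand_linear k H A (r + l - 1)) Kn.
have [a s1 s2 _ e|hs s1 s2 _ _|g gE] := @hpure_lift k H A _ l r _
  (F_value_slotlin2 hE (r + l - 1)).
- by rewrite /F_value /F_sum (N _).1 ?scaler0 //; lia.
- by rewrite /F_value /F_sum (N _).2 scaler0.
- by exists g.
Qed.

Definition F_explicit : F_family H A := fun l r => projT1 (cid (F_explicit_ex l r)).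

Lemma F_explicitE l r hs a : (1 < l)%N -> size hs = l -> size a = r ->
  F_explicit l r (hpure l r hs a) = F_value hE (r + l - 1) hs a.
Proof. by rewrite /F_explicit; case: cid => g /= gE l1 sh sa; apply: gE. Qed.

Lemma F_explicit_is_F_family : is_F_family w f F_explicit.
Proof.
split.
- move=> h1 h2; rewrite F_explicitE // /F_value scale1r.
  have Kl := F_sum_A_multilinear hE (@F_summand_slotlin k H A 1)
    (@F_summand_linear k H A 1).
  rewrite F_sum_step // push_op_nil scaler0 addr0 /= !subr0 twistA_H //.
  rewrite -[RHS]/(bpure 1 [:: - f2 f h1 h2]) (linN (bpure_linear 1 [::] [::])); congr (- _).
  (* After the merge one letter [x2 * y2] is left, and its counit collapses both coproducts. *)
  pose g x y : Ab 1 := bpure 1 [:: f2 f x y].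
  have gx y : linear (g^~ y) by apply: (linear_comp (bpure_linear 1 [::] [::])); apply:
    f2_linl.
  have gy x : linear (g x) by apply: (linear_comp (bpure_linear 1 [::] [::])); apply:
    f2_linr.
  rewrite -[RHS]/(g h1 h2) -(sw2_counitr h1 (gx h2)); apply: eq_sw2 => x1 x2.
  rewrite -(sw2_counitr h2 (gy x1)) /sw2 -tsumZ; apply: eq_tsum => y1 y2.
  by rewrite F_sum1 counitM scalerA.
- move=> l hs l2 sh; rewrite F_explicitE //; last by rewrite ltnS ltnW.
  rewrite /F_value scale1r F_sum_step ?sh //; last by rewrite addn0; lia.
  rewrite push_op_nil scaler0 addr0 merge_op_sw; last exact:
    (F_sum_A_multilinear hE (F_summand_slotlin _) (F_summand_linear _)).
  rewrite sh; apply: eq_big_nat => j /andP[j0 jl]; congr (_ *: _).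
  apply: eq_lsw2 => u1 u2 _ e2; apply: eq_sw2 => x1 x2; apply: eq_sw2 => y1 y2.
  have su : size (u2 ++ (x2 * y2) :: drop j.+1 hs) = l.
    rewrite size_cat /= size_drop sh e2 size_takel ?sh; lia.
  rewrite F_explicitE //; have gl b : linear (fun t : Ab (0 + l - 1) =>
      tpow_cast (0 + l.+1 - 1) (tcat (bpure 1 [:: b] : Ab 1) t) : Ab _).
    exact: (linear_comp (@tpow_cast_linear _ _ _ _) (@tcat_linr _ _ _ _ _)).
  apply: esym; apply: etrans (push_F_value hE _ [::] (gl _)) _.
  rewrite scale1r; apply: eq_F_sum => c y; rewrite su addn0 => sc.
  by rewrite tcat_bpure // tpow_cast_bpure //; lia.
- move=> r h1 h2 a r1 sa; rewrite F_explicitE //.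
  (* The clause for two letters of [H] is the case l = 1 of the recursion, with [tact] in the role
     of F^(1). *)
  rewrite (@F_value_unroll _ _ _ _ _ hE 1 [:: h1; h2] a _ (fun i => size (drop i a))
    (fun i hs' => tact w hs' (drop i a))) //.
  + by rewrite big_nat1 sa; apply: eq_bigr => i _; rewrite muln1 addn1.
  + by rewrite sa addn2 addn1 subn1.
  + by move=> i ia; rewrite size_drop addn1.
  + by move=> i [|g [|]] // ia _; rewrite F_value_single.
- move=> l r hs a l2 r1 sh sa; rewrite F_explicitE //; last by rewrite ltnS ltnW.
  rewrite (@F_value_unroll _ _ _ _ _ hE l hs a _ (fun i => r - i + l - 1)%N
    (fun i hs' => F_explicit l (r - i)%N (hpure l (r - i)%N hs' (drop i a)))) ?sa //.
  + by lia.
  + by lia.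
  + by move=> i ir; lia.
  + by move=> i hs' ir sh'; rewrite F_explicitE // size_drop sa.
Qed.

End FFamily.

(** * The maps d *)

Section RhoSum.
Variables (k : comNzRingType) (B : algType k) (V W : lmodType k) (act : V -> B -> W).

Lemma rhoE (g : seq B -> V) e s : rho act g e s =
  \sum_(1 <= i < (size s).+1) (-1) ^+ i *: act (g (mul_at i (e :: s))) 1
  + (-1) ^+ (size s).+1 *: act (g (take (size s) (e :: s))) (nth 0 (e :: s) (size s)).
Proof.
elim: s e g => [|e2 s IH] e g.
  by rewrite rho_nil big_geq // add0r expr1 scaleN1r.
rewrite rho_cons IH [size (e2 :: s)]/= [in RHS]big_nat_recl // expr1 scaleN1r.
rewrite [mul_at 1 _]/mul_at /= drop0 opprD -!addrA; congr (_ + _).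
congr (_ + _); last by rewrite [in RHS]exprS mulN1r scaleNr.
rewrite -sumrN !big_add1 /=; apply: eq_bigr => i _.
by rewrite [in RHS]exprS mulN1r scaleNr.
Qed.

End RhoSum.

Lemma bpure_size (k : comNzRingType) (B : algType k) n (s : seq B) :
  size s != n -> bpure n s = 0.
Proof.
rewrite /bpure -(size_map (@bcl k B)); elim: n (map _ s) => [|n IH] [|x t] //= ne.
by rewrite IH // (lin0 (tprodPr _)).
Qed.

Section DFamily.
Variables (k : comNzRingType) (H : hopfAlgType k) (A : algType k).
Variables (w : weak_action H A) (f : {linear tensor H H -> A}).
Hypothesis hE : is_crossed_product w f.
Notation E := (crossed_product hE).
Notation "a # h" := (cprod hE a h) (at level 35).
Notation Hb := (tpow (rbar H)).
Notation Ab := (tpow (rbar A)).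
Variable M : bimodType E.
Implicit Types Q : seq H -> seq A -> M.

Definition Klact Q (c : A) (hs : seq H) (a : seq A) : M := lact (c # 1) (Q hs a).

Definition rhoA Q hs a : M := if a is a1 :: a' then rho (@ract_base _ _ _ _ _ hE M) (Q hs)
  a1 a' else 0.

Lemma right_op_split Q hs a : right_op Q hs a = (-1) ^+ size hs *: rhoA Q hs a +
  \sum_(1 <= l < (size hs).+1) (-1) ^+ (size hs + size a) *:
    F_sum hE (fun c y => ract (Q (take (size hs - l) hs) c) (1 # y))
      (drop (size hs - l) hs) a.
Proof.
elim: hs Q => [|h hs IH] Q.
  rewrite big_geq // addr0 scale1r; case: a => [|a1 a]; first exact: right_op_nil.
  by rewrite right_op_nil_cons.
rewrite right_op_cons IH [size (h :: hs)]/= [in RHS]big_nat_recr //= subnn addSn.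
rewrite addrC opprD addrCA; congr (_ + _); first by rewrite exprS mulN1r scaleNr.
congr (_ + _).
rewrite -sumrN; apply: eq_big_nat => l /andP[l1 ls].
by rewrite subSn //= exprS mulN1r scaleNr.
Qed.

Lemma mixed_diff_split Q hs a : mixed_diff Q hs a =
  (if hs is h :: hs' then lact (1 # h) (Q hs' a) else 0)
  + (merge_op hE hs (Klact Q) a + (-1) ^+ size hs *: push_op hE hs (Klact Q) a)
  + ((-1) ^+ size hs *: rhoA Q hs a +
    \sum_(1 <= l < (size hs).+1) (-1) ^+ (size hs + size a) *:
    F_sum hE (fun c y => ract (Q (take (size hs - l) hs) c) (1 # y))
      (drop (size hs - l) hs) a).
Proof. by rewrite /mixed_diff left_op_split right_op_split. Qed.

Definition cochain_eval s r (phi : crossed_cochain M s r) : seq H -> seq A -> M :=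
  fun hs a => phi (hpure s r hs a).

Lemma cochain_eval_cochain s r (phi : crossed_cochain M s r) :
  HA_cochain (cochain_eval phi).
Proof.
have pl := @linearP _ _ _ _ phi; split; split=> [a|hs] s1 s2.
- exact: (linear_comp pl (linear_comp (tprodPl _) (bpure_linear s s1 s2))).
- exact: (linear_comp pl (linear_comp (tprodPr _) (bpure_linear r s1 s2))).
- by rewrite /cochain_eval /hpure bpure_1 (lin0 (tprodPl _)) linear0.
- by rewrite /cochain_eval /hpure bpure_1 (lin0 (tprodPr _)) linear0.
Qed.

Lemma cochain_eval0 s r (phi : crossed_cochain M s r) hs a : size hs != s ->
  cochain_eval phi hs a = 0.
Proof. by move=> ne; rewrite /cochain_eval /hpure bpure_size // (lin0 (tprodPl _))
linear0. Qed.

Lemma merge_op0 (W : lmodType k) KA hs a :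
  (forall x hs', (size hs').+1 = size hs -> KA x hs' a = 0) -> merge_op hE hs KA a = 0 :> W.
Proof.
move=> K0; rewrite (@eq_merge_op_size _ _ _ _ _ hE _ _ (fun x hs a => 0 *: KA x hs a)).
  by rewrite merge_opZ scale0r.
by move=> x hs' sz; rewrite scale0r K0.
Qed.

Lemma push_op0 (W : lmodType k) KA hs a : A_multilinear KA ->
  (forall x hs' a', size hs' = size hs -> KA x hs' a' = 0) -> push_op hE hs KA a = 0 :> W.
Proof.
move=> Kl K0; case: a => [|a1 a]; first exact: push_op_nil.
rewrite push_op_sw // (eq_lsw2 (e' := fun _ _ => 0)) => [|s1 s2 _ e]; last by rewrite K0.
by rewrite lsw2_ev ev0.
Qed.

Lemma F_sum0 (W : lmodType k) K hs a : (forall c y, K c y = 0) -> F_sum hE K hs a = 0 :> W.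
Proof. by move=> K0; rewrite (@eq_F_sum _ _ _ _ _ hE _ _ (fun _ _ => 0)) //; apply: ev0.
Qed.

Lemma Klact_lin Q : slotlin2 Q -> A_multilinear (Klact Q).
Proof.
move=> [Q1 Q2]; split=> [hs a|c]; first exact: lact_cprod_lin.
split=> [a|hs] s1 s2; first exact: (linear_comp (lactlin _) (Q1 a s1 s2)).
exact: (linear_comp (lactlin _) (Q2 hs s1 s2)).
Qed.

Lemma rhoA0 Q hs a : (forall t, Q hs t = 0) -> rhoA Q hs a = 0.
Proof.
move=> Q0; case: a => [|a1 a] //=; rewrite /rho -[RHS](ev0 M (rho_terms a1 a)).
by apply: eq_ev => p; rewrite Q0 /ract_base (lin0 (ractlin _)).
Qed.

(** Conjugation by the sign (-1)^(rs): the target has bidegree (r, s), the source (r + l - 1, s -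
    l). *)
Definition dsign r s l : k := (-1) ^+ (s * r + (s - l) * (r + l - 1)).

(** [cochain_eval phi] vanishes on words with a wrong number of letters of [H], and this selects the
    terms of [mixed_diff]. For l = 0 the pushed entry and the right part in [A] survive; in the next
    two lemmas, [1 # h], the merges and F^(1) for l = 1, and F^(l) alone for l >= 2. *)
Lemma mixed_diff_dhat0 r s (phi : crossed_cochain M (s - 0) (r + 0 - 1)) hs a :
  (0 < r)%N -> size hs = s -> size a = r ->
  dsign r s 0 *: mixed_diff (cochain_eval phi) hs a = dhat0_formula phi hs a.
Proof.
move=> r0 sh sa; have ph0 hs' a' : size hs' != s -> cochain_eval phi hs' a' = 0.
  by move=> ne; apply: cochain_eval0; rewrite subn0.
have Kl := Klact_lin (cochain_eval_cochain phi).1.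
rewrite mixed_diff_split.
have -> : (if hs is h :: hs' then lact (1 # h) (cochain_eval phi hs' a) else 0) = 0.
  case: hs sh => // h hs sh; rewrite ph0 ?(lin0 (lactlin _)) //.
  by rewrite -sh /= neq_ltn ltnSn.
rewrite merge_op0 => [|x hs' sz]; last first.
  by rewrite /Klact ph0 ?(lin0 (lactlin _)) // -sh -sz neq_ltn ltnSn.
rewrite big_nat_cond big1 => [|l /andP[/andP[l0 ls] _]]; last first.
  rewrite F_sum0 ?scaler0 // => c y; rewrite ph0 ?(lin0 (ractlin _)) //.
  by rewrite size_takel ?leq_subr // sh neq_ltn; apply/orP; left; lia.
rewrite !add0r addr0 -scalerDr scalerA sh.
have -> : dsign r s 0 * (-1) ^+ s = 1.
  rewrite /dsign -exprD subn0 addn0 -signr_odd !oddD !oddM oddB //.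
  by case: (odd s); case: (odd r).
rewrite scale1r; case: a sa => [sa|a1 a sa]; first by rewrite -sa in r0.
rewrite push_op_sw // /dhat0_formula -addrA; congr (_ + _).
subst r; rewrite /= rhoE addrC; congr (_ + _).
by apply: eq_bigr => i _; rewrite ract_base1.
Qed.

Lemma mixed_diff_dhat1 r s (phi : crossed_cochain M (s - 1) (r + 1 - 1)) hs a :
  (0 < s)%N -> size hs = s -> size a = r ->
  dsign r s 1 *: mixed_diff (cochain_eval phi) hs a = dhat1_formula phi hs a.
Proof.
move=> s0 sh sa; have Kl := Klact_lin (cochain_eval_cochain phi).1.
rewrite mixed_diff_split.
rewrite push_op0 // => [|x hs' a' e]; last first.
  by rewrite /Klact cochain_eval0 ?(lin0 (lactlin _)) // e sh; apply/eqP; lia.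
rewrite rhoA0 => [|t]; last by rewrite cochain_eval0 // sh; apply/eqP; lia.
rewrite !scaler0 addr0 add0r big_ltn ?sh // big_nat_cond big1 =>
  [|l /andP[/andP[l0 ls] _]]; last first.
  rewrite F_sum0 ?scaler0 // => c y; rewrite cochain_eval0 ?(lin0 (ractlin _)) //.
  by rewrite size_takel ?sh; apply/eqP; lia.
have es : dsign r s 1 = (-1) ^+ r.
  rewrite /dsign -signr_odd -[RHS]signr_odd oddD !oddM addnK oddB //.
  by case: (odd s); case: (odd r).
have eK : F_sum hE (fun c y => ract (cochain_eval phi (take (s - 1) hs) c) (1 # y))
  (drop (s - 1) hs) a =
    (-1) ^+ r *: sw2 (nth 0 hs s.-1) (fun x1 x2 =>
      ract (phi (tprod (bpure _ (take s.-1 hs)) (tpow_cast _ (tact w [:: x1] a))))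
        (1 # x2)).
  have -> : drop (s - 1) hs = [:: nth 0 hs s.-1].
    by rewrite subn1 (drop_nth 0) ?sh ?prednK // drop_oversize ?sh.
  have -> : take (s - 1) hs = take s.-1 hs by rewrite subn1.
  have [[Q1 Q2] _] := cochain_eval_cochain phi.
  rewrite F_sum_single; last 2 first.
  - by move=> y s1 s2; apply: (linear_comp (ractlin _) (Q2 _ s1 s2)).
  - by move=> c; apply: (linear_comp (ractlinr _) (cprod_linr _ _)).
  pose Z (t : seq H) (u : Ab (size a)) : M :=
    ract (phi (tprod (bpure _ (take s.-1 hs)) (tpow_cast _ u))) (1 # \prod_(h <- t) h).
  rewrite {1}sa; congr (_ *: _);
    transitivity (lsw2 [:: nth 0 hs s.-1] (fun s1 s2 => Z s2 (tact w s1 a))).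
    rewrite tact_multipush.
    - by apply: eq_multipush => cs hs' _ _; rewrite /Z tpow_cast_bpure // sa; lia.
    - move=> t; apply: (linear_comp (ractlin _)); apply:
      (linear_comp (@linearP _ _ _ _ phi)).
      exact: (linear_comp (tprodPr _) (@tpow_cast_linear _ _ _ _)).
    - move=> u s1 s2; apply: (linear_comp (ractlinr _)); apply:
      (linear_comp (cprod_linr _ _)).
      exact: prod_slotlin.
  by apply: eq_sw2 => x1 x2; rewrite /Z /= big_seq1.
have e2 : (s + size a = s + r)%N by rewrite sa.
rewrite eK addr0 es e2 !scalerDr !scalerA -!exprD /dhat1_formula -addrA.
case: hs sh {eK} => [sh|h hs sh]; first by rewrite -sh in s0.
rewrite -[RHS]addrA; congr (_ + _); rewrite addrC; congr (_ + _).
  congr (_ *: _); rewrite -[LHS]signr_odd -[RHS]signr_odd !oddD.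
  by case: (odd r); case: (odd s).
rewrite merge_op_sw // scaler_sumr sh; apply: eq_bigr => i _.
by rewrite scalerA -exprD.
Qed.

Lemma mixed_diff_dhatl r s l (phi : crossed_cochain M (s - l) (r + l - 1)) hs a :
  (1 < l <= s)%N -> size hs = s -> size a = r ->
  dsign r s l *: mixed_diff (cochain_eval phi) hs a = dhatl_formula (F_explicit hE)
    phi hs a.
Proof.
move=> /andP[l1 ls] sh sa; have Kl := Klact_lin (cochain_eval_cochain phi).1.
have [[Q1 Q2] _] := cochain_eval_cochain phi.
rewrite mixed_diff_split.
have -> : (if hs is h :: hs' then lact (1 # h) (cochain_eval phi hs' a) else 0) = 0.
  case: hs sh => // h hs sh; rewrite cochain_eval0 ?(lin0 (lactlin _)) //.
  by move: sh => /= sh; apply/eqP; lia.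
rewrite merge_op0 => [|x hs' sz]; last first.
  by rewrite /Klact cochain_eval0 ?(lin0 (lactlin _)) //; apply/eqP; lia.
rewrite push_op0 // => [|x hs' a' e]; last first.
  by rewrite /Klact cochain_eval0 ?(lin0 (lactlin _)) // e sh; apply/eqP; lia.
rewrite rhoA0 => [|t]; last by rewrite cochain_eval0 // sh; apply/eqP; lia.
rewrite !scaler0 !addr0 !add0r (bigD1_seq l) ?mem_index_iota ?iota_uniq //=; last first.
  by rewrite sh ltnS ls ltnW.
rewrite big1_seq => [|l' /andP[nl]]; last first.
  rewrite mem_index_iota sh => /andP[l0 ls'].
  rewrite F_sum0 ?scaler0 // => c y; rewrite cochain_eval0 ?(lin0 (ractlin _)) //.
  by rewrite size_takel ?sh; apply/eqP; move/eqP: nl; lia.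
(* The target formula applies F to the first Sweedler factors and lets the product of the second
   ones act on the right; colinearity brings the sum to this form. *)
rewrite addr0 scalerA sh sa /dhatl_formula F_sum_colin; last 2 first.
- by move=> y s1 s2; apply: (linear_comp (ractlin _) (Q2 _ s1 s2)).
- by move=> c; apply: (linear_comp (ractlinr _) (cprod_linr _ _)).
transitivity ((-1) ^+ (l * (r + s)) *: ((-1) ^+ r *: lsw2 (drop (s - l) hs) (fun t1 t2 =>
    F_sum hE (fun c y => counit y *: ract (cochain_eval phi (take (s - l) hs) c)
      (1 # \prod_(h <- t2) h)) t1 a))).
  have rl : (0 < r + l)%N by lia.
  rewrite scalerA; congr (_ *: _); rewrite /dsign -!exprD -[LHS]signr_odd -[RHS]signr_odd.
  rewrite !(oddD, oddM) !oddB // oddD.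
  by case: (odd s); case: (odd r); case: (odd l).
congr (_ *: _); rewrite -lsw2Z; apply: eq_lsw2 => t1 t2 e1 _.
have gl : linear (fun u : Ab (r + l - 1) =>
    ract (phi (tprod (bpure _ (take (s - l) hs)) u)) (1 # \prod_(h <- t2) h)).
  apply: (linear_comp (ractlin _)); apply: (linear_comp (@linearP _ _ _ _ phi)).
  exact: tprodPr.
rewrite F_explicitE //; last by rewrite e1 size_drop sh subKn.
by apply: esym; apply: etrans (push_F_value hE t1 a gl) _; rewrite sa.
Qed.

End DFamily.

(** * The comparison theorem *)

Section HochschildBridge.
Variables (k : comNzRingType) (B : algType k) (M : bimodType B).

Definition bar_eval n (phi : hochschild_cochain M n) (s : seq B) : M := phi (bpure n s).

Lemma hochschild_diff_bar n (phi : hochschild_cochain M n) s : size s = n.+1 ->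
  bar_eval (hochschild_diff M n phi) s = bar (bar_eval phi) s.
Proof.
move=> ss; rewrite /bar_eval hochschild_diffE // /hochschild_formula.
case: s ss => // e s [ss]; rewrite /= -addrA; congr (_ + _).
rewrite /rhoM rhoE ss; congr (_ + _).
by apply: eq_bigr => i _; rewrite ract1.
Qed.

End HochschildBridge.

Section Assembly.
Variables (k : comNzRingType) (H : hopfAlgType k) (A : algType k).
Variables (w : weak_action H A) (f : {linear tensor H H -> A}).
Hypothesis hE : is_crossed_product w f.
Notation E := (crossed_product hE).
Variable M : bimodType E.

Lemma mixed_diff_lin c (Q Q' : seq H -> seq A -> M) hs a :
  mixed_diff (fun hs a => c *: Q hs a + Q' hs a) hs a = c *: mixed_diff Q hs a +
    mixed_diff Q' hs a.
Proof.
rewrite /mixed_diff /left_op /right_op scalerDr addrACA -!ev_lin; congr (_ + _); apply: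
  eq_ev => p.
  by rewrite lactlin.
by rewrite ractlin.
Qed.

(** All components come from the single operator [mixed_diff], so [mixed_diff_cochain] provides the
    factorization through H/k and A/k for every l at once. *)
Lemma dhat_explicit_ex r s l : exists g :
  {linear crossed_cochain M (s - l) (r + l - 1) -> crossed_cochain M s r},
  forall phi hs a, size hs = s -> size a = r ->
    g phi (hpure s r hs a) = dsign k r s l *: mixed_diff (cochain_eval phi) hs a.
Proof.
have /choice[g gE] : forall phi : crossed_cochain M (s - l) (r + l - 1),
    exists psi : crossed_cochain M s r, forall hs a, size hs = s -> size a = r ->
      psi (hpure s r hs a) = dsign k r s l *: mixed_diff (cochain_eval phi) hs a.
  move=> phi; have [[l1 l2] [n1 n2]] := mixed_diff_cochain (cochain_eval_cochain phi).
  apply: (@hpure_lift k H A M s r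
    (fun hs a => dsign k r s l *: mixed_diff (cochain_eval phi) hs a)).
  - by split=> [a|hs] s1 s2; apply: linear_scale; [apply: l1 | apply: l2].
  - by move=> a s1 s2 _ _; rewrite (n1 a s1 s2) scaler0.
  - by move=> hs s1 s2 _ _; rewrite (n2 hs s1 s2) scaler0.
have gl : linear g.
  move=> c x y; apply: hpure_ext => hs a sh sa; rewrite hom_addE hom_scaleE !gE //.
  by rewrite -[cochain_eval _]/(fun hs a => c *: cochain_eval x hs a +
    cochain_eval y hs a) mixed_diff_lin scalerDr !scalerA mulrC.
by exists (mklin gl) => phi hs a sh sa; apply: gE.
Qed.

Definition dhat_explicit : dhat_family M := fun r s l =>
  projT1 (cid (dhat_explicit_ex r s l)).

Lemma dhat_explicitE r s l phi hs a : size hs = s -> size a = r ->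
  dhat_explicit r s l phi (hpure s r hs a) = dsign k r s l *:
    mixed_diff (cochain_eval phi) hs a.
Proof. by rewrite /dhat_explicit; case: cid => g /= gE; apply: gE. Qed.

Lemma dhat_explicit_is_dhat_family : is_dhat_family (F_explicit hE) dhat_explicit.
Proof.
move=> r s hs a sh sa; split.
- by move=> r0 phi; rewrite dhat_explicitE // mixed_diff_dhat0.
- by move=> s0 phi; rewrite dhat_explicitE // mixed_diff_dhat1.
- by move=> l ls phi; rewrite dhat_explicitE // mixed_diff_dhatl.
Qed.

Definition signed_comp n (phi : Xhat M n) s r hs a : M :=
  (-1) ^+ (s * r) *: cochain_eval (Xcomp phi s r) hs a.

(* The family of all components of [phi], with the signs [(-1) ^+ (s * r)]
   that turn [dhat_total] into [mixed_diff]. *)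
Definition Xhat_eval n (phi : Xhat M n) hs a : M := signed_comp phi (size hs) (size a) hs a.

Lemma signed_comp_cochain n (phi : Xhat M n) s r : HA_cochain (signed_comp phi s r).
Proof.
have [[l1 l2] [n1 n2]] := cochain_eval_cochain (Xcomp phi s r).
split; split=> [a|hs] s1 s2.
- exact: (linear_scale _ (l1 a s1 s2)).
- exact: (linear_scale _ (l2 hs s1 s2)).
- by rewrite /signed_comp (n1 a s1 s2) scaler0.
- by rewrite /signed_comp (n2 hs s1 s2) scaler0.
Qed.

Lemma Xhat_eval_cochain n (phi : Xhat M n) : HA_cochain (Xhat_eval phi).
Proof.
have C s r := signed_comp_cochain phi s r; split; split=> [a|hs] s1 s2.
- by move=> c x y; rewrite /Xhat_eval !size_cat /=; apply: (C _ _).1.1.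
- by move=> c x y; rewrite /Xhat_eval !size_cat /=; apply: (C _ _).1.2.
- exact: ((C _ _).2.1 a s1 s2).
- exact: ((C _ _).2.2 hs s1 s2).
Qed.

Lemma Xhat_ext n (phi psi : Xhat M n) :
  (forall hs a, (size hs + size a)%N = n -> Xhat_eval phi hs a = Xhat_eval psi hs a) ->
    phi = psi.
Proof.
move=> e; apply: functional_extensionality_dep => -[[r s] p] /=.
apply: hpure_ext => hs a sh sa.
have rs : (r + s)%N = n by apply/eqP.
have := e hs a; rewrite sh sa addnC => /(_ rs).
rewrite /Xhat_eval /signed_comp sh sa /cochain_eval /Xcomp; case: eqP => // rs'.
rewrite (eq_irrelevance p (introT eqP rs')).
by move/(can_inj (signrZK _)).
Qed.

Lemma Xhat_eval_surj n (Q : seq H -> seq A -> M) : HA_cochain Q ->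
  exists phi : Xhat M n, forall hs a, (size hs + size a)%N = n -> Xhat_eval phi hs a =
    Q hs a.
Proof.
move=> [Ql [n1 n2]].
have ex (p : bidegree n) : exists psi : crossed_cochain M (\val p).2 (\val p).1,
    forall hs a, size hs = (\val p).2 -> size a = (\val p).1 ->
      psi (hpure _ _ hs a) = (-1) ^+ ((\val p).2 * (\val p).1) *: Q hs a.
  apply: (@hpure_lift k H A M _ _ (fun hs a => (-1) ^+
    ((\val p).2 * (\val p).1) *: Q hs a)).
  - split=> [a|hs] s1 s2; apply: linear_scale;
    [exact: (Ql.1 a s1 s2) | exact: (Ql.2 hs s1 s2)].
  - by move=> a s1 s2 _ _; rewrite (n1 a s1 s2) scaler0.
  - by move=> hs s1 s2 _ _; rewrite (n2 hs s1 s2) scaler0.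
exists (fun p => projT1 (cid (ex p))) => hs a sz.
rewrite /Xhat_eval /signed_comp /cochain_eval /Xcomp; case: eqP => [e|];
  last by rewrite addnC sz.
by case: cid => psi /= ->; rewrite // signrZK.
Qed.

Lemma Xhat_eval_lin n c (phi psi : Xhat M n) hs a :
  Xhat_eval (c *: phi + psi) hs a = c *: Xhat_eval phi hs a + Xhat_eval psi hs a.
Proof.
rewrite /Xhat_eval /signed_comp /cochain_eval; have -> : Xcomp (c *: phi + psi) (size hs)
  (size a) =
    c *: Xcomp phi (size hs) (size a) + Xcomp psi (size hs) (size a).
  by rewrite /Xcomp; case: eqP => // _; rewrite scaler0 addr0.
by rewrite hom_addE hom_scaleE scalerDr !scalerA mulrC.
Qed.

Lemma Xhat_eval_dhat n (phi : Xhat M n) hs a : (size hs + size a)%N = n.+1 ->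
  Xhat_eval (dhat_total dhat_explicit n phi) hs a = mixed_diff (Xhat_eval phi) hs a.
Proof.
move=> sz; set s := size hs; set r := size a.
have rs : (r + s)%N = n.+1 by rewrite addnC.
transitivity ((-1) ^+ (s * r) *: \sum_(0 <= l < s.+1 | (0 < r + l)%N)
    dhat_explicit r s l (Xcomp phi (s - l) (r + l - 1)) (hpure s r hs a)).
  rewrite /Xhat_eval /signed_comp -/s -/r; congr (_ *: _).
  rewrite /cochain_eval /Xcomp; case: eqP => // e.
  rewrite -[LHS]/((\sum_(0 <= l < s.+1 | (0 < r + l)%N)
    dhat_explicit r s l (Xcomp phi (s - l) (r + l - 1)) :
      crossed_cochain M s r) (hpure s r hs a)).
  by elim/big_rec2: _ => // l x y _ <-.
transitivity (\sum_(0 <= l < s.+1 | (0 < r +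
  l)%N) mixed_diff (signed_comp phi (s - l) (r + l - 1)) hs a).
  rewrite scaler_sumr; apply: eq_bigr => l _; rewrite dhat_explicitE //
    /dsign scalerA exprD mulrA.
  rewrite -expr2 sqrr_sign mul1r.
  have := mixed_diff_lin ((-1) ^+ ((s - l) * (r + l - 1)))
    (cochain_eval (Xcomp phi (s - l) (r + l - 1)))
    (fun _ _ => 0) hs a.
  rewrite [mixed_diff (fun _ _ => 0) _ _]mixed_diff0 // addr0 => <-.
  by apply: eq_mixed_diff_size => hs' a' _ _; rewrite addr0.
transitivity (mixed_diff (fun hs a => \sum_(0 <= l < s.+1 | (0 < r +
  l)%N) signed_comp phi (s - l) (r + l - 1) hs a) hs a).
  elim: (index_iota _ _) => [|l t IH].
    by rewrite big_nil mixed_diff0 // => hs' a' _; rewrite big_nil.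
  rewrite big_cons IH; case: ifP => l0.
    by rewrite -mixed_diffD; apply: eq_mixed_diff_size => hs' a' _ _; rewrite big_cons l0.
  by apply: eq_mixed_diff_size => hs' a' _ _; rewrite big_cons l0.
apply: eq_mixed_diff_size => hs' a' le_hs sz'.
(* At [hs'] the only summand that can be nonzero has [l = s - size hs']. If [r = 0], the shortened
   word has lost a letter of [H], so the guard [0 < r + l] holds. *)
have l0 : (0 < r + (s - size hs'))%N by move: sz' le_hs; rewrite -/s -/r; lia.
rewrite big_mkcond (bigD1_seq (s - size hs')%N) ?mem_index_iota ?iota_uniq //=; last first.
  by rewrite ltnS leq_subr.
rewrite l0 big1_seq => [|l /andP[nl]]; last first.
  rewrite mem_index_iota => /andP[_ ls]; case: ifP => // _.
  rewrite /signed_comp cochain_eval0 ?scaler0 //; apply: contraNneq nl => e.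
  by rewrite e subKn.
rewrite addr0 subKn // /Xhat_eval; congr (signed_comp _ _ _ _ _).
by move: sz' le_hs; rewrite -/s -/r; lia.
Qed.

Lemma bar_eval_cochain n (phi : hochschild_cochain M n) :
  E_cochain (bar_eval phi : seq E -> M).
Proof.
split=> s1 s2; first exact: (linear_comp (@linearP _ _ _ _ phi) (bpure_linear n s1 s2)).
by rewrite /bar_eval bpure_1 linear0.
Qed.

Lemma bar_eval_surj n (P : seq E -> M) : E_cochain P ->
  exists phi : hochschild_cochain M n, forall s, size s = n -> bar_eval phi s = P s.
Proof.
move=> [Pl Pn]; apply: (@normalized_lift k M E n P) => s1 s2 _; first exact: Pl.
exact: Pn.
Qed.

Lemma shuffle_ex n : exists g : {linear hochschild_cochain M n -> Xhat M n},
  forall phi hs a, (size hs + size a)%N = n -> Xhat_eval (g phi) hs a =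
    shuffle (bar_eval phi : seq E -> M) hs a.
Proof.
have /choice[g gE] : forall phi : hochschild_cochain M n, exists psi : Xhat M n,
    forall hs a, (size hs + size a)%N = n -> Xhat_eval psi hs a =
      shuffle (bar_eval phi : seq E -> M) hs a.
  by move=> phi; apply/Xhat_eval_surj/shuffle_cochain/bar_eval_cochain.
have gl : linear g.
  move=> c x y; apply: Xhat_ext => hs a sz; rewrite Xhat_eval_lin !gE //.
  by rewrite /shuffle /shuffle_op -ev_lin.
by exists (mklin gl).
Qed.

Definition restriction n := projT1 (cid (shuffle_ex n)).

Lemma restrictionE n (phi : hochschild_cochain M n) hs a : (size hs + size a)%N = n ->
  Xhat_eval (restriction n phi) hs a = shuffle (bar_eval phi : seq E -> M) hs a.
Proof. by rewrite /restriction; case: cid => g /= gE; apply: gE. Qed.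

Lemma Xhat_eval0 n hs a : Xhat_eval (0 : Xhat M n) hs a = 0.
Proof. by have := Xhat_eval_lin (-1) 0 (0 : Xhat M n) hs a;
rewrite scaler0 addr0 scaleN1r addNr. Qed.

Lemma dhat_dhat n (phi : Xhat M n) :
  dhat_total dhat_explicit n.+1 (dhat_total dhat_explicit n phi) = 0.
Proof.
apply: Xhat_ext => hs a sz; rewrite Xhat_eval_dhat //
  Xhat_eval0 -(mixed_diff_square hs a (Xhat_eval_cochain phi)).
by apply: eq_mixed_diff_size => hs' a' _; rewrite sz => -[sz']; rewrite Xhat_eval_dhat.
Qed.

Lemma hochschild_diff_diff n (phi : hochschild_cochain M n) :
  hochschild_diff M n.+1 (hochschild_diff M n phi) = 0.
Proof.
apply: bpure_ext => s ss; rewrite -[LHS]/(bar_eval _ s) hochschild_diff_bar //.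
rewrite -[RHS](bar_bar (bar_eval phi) s); apply: eq_bar => t; rewrite ss => -[st].
exact: hochschild_diff_bar.
Qed.

Lemma restriction_diff n (phi : hochschild_cochain M n) :
  restriction n.+1 (hochschild_diff M n phi) =
    dhat_total dhat_explicit n (restriction n phi).
Proof.
apply: Xhat_ext => hs a sz; rewrite restrictionE // Xhat_eval_dhat //.
transitivity (shuffle (bar (bar_eval phi : seq E -> M)) hs a).
  by apply: eq_shuffle => s; rewrite sz => ss; apply: hochschild_diff_bar.
rewrite shuffle_bar; last exact: (bar_eval_cochain phi).1.
by apply: eq_mixed_diff_size => hs' a' _; rewrite sz => -[sz']; rewrite restrictionE.
Qed.

Lemma restriction_surj n (psi : Xhat M n) : exists phi, restriction n phi = psi.
Proof.
have [phi phiE] := bar_eval_surj n (shuffle_section_cochain (Xhat_eval_cochain psi)).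
exists phi; apply: Xhat_ext => hs a sz; rewrite restrictionE //.
rewrite -[RHS](shuffle_sectionK hs a (Xhat_eval_cochain psi)); apply: eq_shuffle => s ss.
by apply: phiE; rewrite ss.
Qed.

Lemma restriction_ker n (phi : hochschild_cochain M n) :
  hochschild_diff M n phi = 0 -> restriction n phi = 0 ->
  if n is m.+1 then exists T : hochschild_cochain M m, restriction m T = 0 /\
    forall s, size s = n -> bar_eval phi s = bar (bar_eval T) s
  else bar_eval phi [::] = 0.
Proof.
move=> b0 g0.
have b1 s : size s = n.+1 -> bar (bar_eval phi : seq E -> M) s = 0.
  by move=> ss; rewrite -hochschild_diff_bar // /bar_eval b0.
have g1 hs a : (size hs + size a)%N = n -> shuffle (bar_eval phi : seq E -> M) hs a = 0.
  by move=> sz; rewrite -restrictionE // g0 Xhat_eval0.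
have := ker_acyclic (bar_eval_cochain phi) b1 g1.
case: n phi b0 g0 b1 g1 => [|n] phi b0 g0 b1 g1; first by [].
move=> [T [Tc bT gT]]; have [t tE] := bar_eval_surj n Tc.
exists t; split.
  by apply: Xhat_ext => hs a sz; rewrite restrictionE // Xhat_eval0 -(gT hs a sz); apply:
    eq_shuffle => s ss; rewrite tE // ss.
by move=> s ss; rewrite -bT //; apply: eq_bar => u su; rewrite tE //; apply: succn_inj;
  rewrite su.
Qed.

Lemma restriction_ker0 (phi : hochschild_cochain M 0) :
  hochschild_diff M 0 phi = 0 -> restriction 0 phi = 0 -> phi = 0.
Proof.
by move=> b0 g0; apply: bpure_ext => -[|//] _; apply: (restriction_ker b0 g0).
Qed.

Lemma restriction_kerS n (phi : hochschild_cochain M n.+1) :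
  hochschild_diff M n.+1 phi = 0 -> restriction n.+1 phi = 0 ->
  exists2 psi, restriction n psi = 0 & phi = hochschild_diff M n psi.
Proof.
move=> b0 g0; have [psi [gpsi psiE]] := restriction_ker b0 g0.
exists psi => //; apply: bpure_ext => s ss.
by rewrite -[LHS]/(bar_eval phi s) psiE // -hochschild_diff_bar.
Qed.

End Assembly.

Theorem theorem2p2p1 (k : comNzRingType) (H : hopfAlgType k) (A : algType k)
    (w : weak_action H A) (f : {linear tensor H H -> A})
    (hE : is_crossed_product w f) (M : bimodType (crossed_product hE)) :
  exists (F : F_family H A) (d : dhat_family M),
    [/\ is_F_family w f F,
        is_dhat_family F d,
        forall n (phi : Xhat M n), dhat_total d n.+1 (dhat_total d n phi) = 0
      & forall n,
          lmod_isomorphic (cohomology (hochschild_diff M) n)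
            (cohomology (dhat_total d) n)].
Proof.
exists (F_explicit hE), (dhat_explicit M); split.
- exact: F_explicit_is_F_family.
- exact: dhat_explicit_is_dhat_family.
- exact: dhat_dhat.
- apply: (@cohomology_iso _ _ _ _ _ (restriction M)).
  + exact: hochschild_diff_diff.
  + exact: restriction_diff.
  + exact: restriction_surj.
  + exact: restriction_ker0.
  + exact: restriction_kerS.
Qed.
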